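(* Fix integers $c\geq1$, $d\geq0$ and a constant $k$. There is a polynomial-time algorithm that, given a $(c,d)$-hypergraph $H$, decides whether $\operatorname{fhw}(H)\leq k$; the degree of the polynomial bounding its running time is bounded by a fixed function of $c,d,k$.
   Context: A hypergraph $H=(V,E)$ has a finite vertex set $V$ and a set $E$ of non-empty subsets of $V$; it is a $(c,d)$-hypergraph if any $c$ distinct edges have at most $d$ common vertices. A tree decomposition of $H$ is a pair $(T,(B_u)_{u\in T})$ with $T$ a tree and bags $B_u\subseteq V$ such that every edge is contained in some bag and, for every vertex $v$, the set of nodes $u$ with $v\in B_u$ is connected in $T$. For $X\subseteq V$, $\rho^*_H(X)$ is the minimum of $\sum_{e\in E}\gamma(e)$ over all $\gamma\colon E\to[0,1]$ with $\sum_{e\ni v}\gamma(e)\geq 1$ for all $v\in X$. The fractional hypertree width $\operatorname{fhw}(H)$ is the minimum, over all tree decompositions of $H$, of $\max_{u\in T}\rho^*_H(B_u)$. *)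

(* Defs.v *)
From HB Require Import structures.
From mathcomp Require Import all_boot all_order all_algebra.
From mathcomp Require Import all_classical all_reals all_analysis.

Set Implicit Arguments.
Unset Strict Implicit.
Unset Printing Implicit Defensive.

Import Order.TTheory GRing.Theory Num.Theory.

Local Open Scope ring_scope.

Record hypergraph (V : finType) := Hypergraph {
  edges : {set {set V}};
  edges_neq0 : finset.set0 \notin edges
}.

Definition cd_hypergraph (c d : nat) (V : finType) (H : hypergraph V) : Prop :=
  forall F : {set {set V}}, F \subset edges H -> #|F| = c ->
    (#|\bigcap_(e in F) e| <= d)%N.

Definition is_tree (T : finType) (adj : rel T) : Prop :=
  [/\ (0 < #|T|)%N, symmetric adj, irreflexive adj,
      forall x y : T, connect adj x y
    & forall s : seq T, ucycle adj s -> (size s <= 2)%N].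

(* The empty set counts as connected, so a vertex that lies in no edge may be
   absent from every bag. *)
Definition connected_in (T : finType) (adj : rel T) (S : {set T}) : Prop :=
  forall x y : T, x \in S -> y \in S ->
    connect [rel a b | [&& a \in S, b \in S & adj a b]] x y.

Definition tree_decomposition (V : finType) (H : hypergraph V)
    (T : finType) (adj : rel T) (B : T -> {set V}) : Prop :=
  [/\ is_tree adj,
      forall e : {set V}, e \in edges H -> exists u : T, e \subset B u
    & forall v : V, connected_in adj [set u | v \in B u]].

(* Only the values of g on the edges of H matter. *)
Definition fractional_cover (R : realType) (V : finType) (H : hypergraph V)
    (X : {set V}) (g : {set V} -> R) : Prop :=
  (forall e : {set V}, e \in edges H -> 0 <= g e <= 1) /\
  (forall v : V, v \in X -> 1 <= \sum_(e in edges H | v \in e) g e).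

(* The infimum is that of a linear program with a compact feasible set, so it
   is a minimum as soon as X has a fractional cover; otherwise (some vertex of
   X lies in no edge) it is +oo. *)
Definition rho_star (R : realType) (V : finType) (H : hypergraph V)
    (X : {set V}) : \bar R :=
  ereal_inf [set x : \bar R | exists2 g : {set V} -> R,
    fractional_cover H X g & x = (\sum_(e in edges H) g e)%:E]%classic.

(* The trees are nonempty, so the unit -oo of maxe never shows. The infimum is
   a minimum, since rho_star takes finitely many values on the subsets of V. *)
Definition fhw (R : realType) (V : finType) (H : hypergraph V) : \bar R :=
  ereal_inf [set x : \bar R |
    exists (T : finType) (adj : rel T) (B : T -> {set V}),
      tree_decomposition H adj B /\
      x = \big[maxe/-oo%E]_(u : T) rho_star R H (B u)]%classic.

(* Random access machines in the style of Cook and Reckhow: registers X_0, X_1,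
   ... hold natural numbers and are initially 0; the input is a binary word
   read from left to right. Every instruction costs one step. There is no
   multiplication, so the numbers occurring in the first t steps of a program
   have O(t) bits, and polynomial time is the same as on Turing machines. *)
Inductive instr :=
  | Const of nat & nat        (* Const i m   : X_i := m                       *)
  | Add of nat & nat & nat    (* Add i j l   : X_i := X_j + X_l               *)
  | Sub of nat & nat & nat    (* Sub i j l   : X_i := X_j - X_l, truncated    *)
  | Fetch of nat & nat         (* Fetch i j   : X_i := X_(X_j)                 *)
  | Store of nat & nat        (* Store i j   : X_(X_i) := X_j                 *)
  | Read of nat               (* Read i      : X_i := 1 + next input bit,
                                               or 0 at the end of the input   *)
  | Jpos of nat & nat         (* Jpos i p    : if X_i > 0 go to position p    *)
  | Halt of bool.             (* Halt b      : stop with answer b             *)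

Record config := Config {
  counter : nat;
  registers : nat -> nat;
  unread : seq bool
}.

Definition update (X : nat -> nat) (i m : nat) : nat -> nat :=
  fun j => if j == i then m else X j.

Definition step (a : instr) (s : config) : config :=
  let: Config p X w := s in
  match a with
  | Const i m => Config p.+1 (update X i m) w
  | Add i j l => Config p.+1 (update X i (X j + X l)%N) w
  | Sub i j l => Config p.+1 (update X i (X j - X l)%N) w
  | Fetch i j => Config p.+1 (update X i (X (X j))) w
  | Store i j => Config p.+1 (update X (X i) (X j)) w
  | Read i =>
      if w is b :: w' then Config p.+1 (update X i (nat_of_bool b).+1) w'
      else Config p.+1 (update X i 0%N) w
  | Jpos i q => Config (if (0 < X i)%N then q else p.+1) X w
  | Halt _ => s
  end.

(* The answer given within t steps from s; None if there is none by then, or if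
   the counter has left the program. *)
Fixpoint run (P : seq instr) (t : nat) (s : config) : option bool :=
  if t is t'.+1 then
    match onth P (counter s) with
    | Some (Halt b) => Some b
    | Some a => run P t' (step a s)
    | None => None
    end
  else None.

Definition answers_within (P : seq instr) (w : seq bool) (t : nat) (b : bool) :
    Prop :=
  run P t (Config 0 (fun=> 0%N) w) = Some b.

(* The word 1^|V| 0 followed by the rows of an edge-vertex incidence matrix,
   the vertices and the edges being listed in an arbitrary order. *)
Definition encodes (V : finType) (H : hypergraph V) (w : seq bool) : Prop :=
  exists (vs : seq V) (es : seq {set V}),
    [/\ perm_eq vs (enum V), perm_eq es (enum (edges H))
      & w = nseq (size vs) true ++
            false :: flatten [seq [seq v \in e | v <- vs] | e : {set V} <- es]].

(* Main.v *)
(** A set X has rho*(X) <= k exactly when it has fractional covers of weight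
    k + th up to a defect th, for every th > 0.  In a (c,d)-hypergraph such
    covers can be supported on boundedly many edges: at a suitable scale a,
    every vertex is covered almost completely by edges of weight at least of
    order a, except for boundedly many vertices, with respect to which all the
    lighter edges fall into boundedly many classes that can be merged; the
    remaining defect is harmless because there are only finitely many linear
    programs of the resulting size.  Hence a bag of width <= k lies in a union
    of cells of boundedly many edges, and in a tree decomposition whose bags
    are as large as these unions allow, each bag is a union of boundedly many
    intersections of fewer than c edges and of boundedly many vertices.  The
    bags can therefore be named by tuples of bounded length.

    Given such a family of bags, fhw <= k is equivalent to the existence of a
    winning strategy in a monotone cops-and-robber game on the bags, which is a
    least fixed point of first-order formulas, namely of reachability followed
    by the winning positions.  The condition rho* <= k is itself first-order,
    since it only depends on which of finitely many patterns of boundedly many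
    edges occur in the bag, through a table built into the formula.  A
    random access machine evaluates a fixed-point formula by nested loops, in
    time polynomial in the length of the input. *)

Require Import Defs.
From HB Require Import structures.
From mathcomp Require Import all_boot all_order all_algebra.
From mathcomp Require Import all_classical all_reals all_analysis.
From mathcomp Require Import fintype finset zify lra.

Set Implicit Arguments.
Unset Strict Implicit.
Unset Printing Implicit Defensive.

Import Order.TTheory GRing.Theory Num.Theory.

Local Open Scope ring_scope.

(** * Fractional covers of bounded support *)

(** A circularity shapes the bound on supports. The defect that finitely many linear programs
    forgive depends on the number of edges in the support; this number depends on the scale
    separating heavy from light edges; and dropping the light edges leaves a deficit of the order of
    that scale. So a whole sequence of scales is fixed before any hypergraph is given, each at most
    the defect forgiven for the supports arising at the previous one, and a scale is selected at
    which no vertex in fewer than c heavy edges has a deficit between this scale and the next: the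
    deficit is either large, and such vertices are few, or already forgiven.

    The second obstacle is that a normalised bag depends on all bags along a tree path of unbounded
    length. This length must not enter the bounds, and it does not, because only the intersections
    that enlarge a family of edges cost anything, and a family of c edges has at most d common
    vertices. *)

Lemma pigeonhole (T : eqType) (P : nat -> T -> bool) (bs : seq T) :
    (forall b i j, P i b -> P j b -> i = j) ->
  exists2 j, (j <= size bs)%N & forall b, b \in bs -> ~~ P j b.
Proof.
move=> Pinj; pose s := iota 0 (size bs).+1.
have [/hasP[j]|/hasPn hall] := boolP (has (fun j => ~~ has (P j) bs) s).
  rewrite mem_iota add0n ltnS => /andP[_ jle] /hasPn Pj.
  by exists j.
(* An index that is hit is sent to the position of the first [b] hitting it; this map is injective,
   but there is one index more than there are positions. *)
suff : (size (map (fun j => find (P j) bs) s) <= size (iota 0 (size bs)))%N.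
  by rewrite size_map !size_iota ltnn.
apply: uniq_leq_size; last first.
  move=> _ /mapP[j js ->]; rewrite mem_iota add0n -has_find.
  by have := hall j js; rewrite negbK.
rewrite map_inj_in_uniq ?iota_uniq// => i j /hall; rewrite negbK => hi /hall.
rewrite negbK => hj eq_find.
case: bs {s hall} hi hj eq_find => // b0 bs hi hj eq_find.
apply: (Pinj (nth b0 (b0 :: bs) (find (P i) (b0 :: bs)))); first exact: nth_find.
by rewrite eq_find; exact: nth_find.
Qed.

(** * Scales without intermediate deficits *)

Section ScaleSeparation.
Variables (R : realType) (K : R) (a : nat -> R).
Hypotheses (a_gt0 : forall t, 0 < a t) (a_half : forall t, a t.+1 * 2 <= a t).

Lemma scale_anti i j : (i <= j)%N -> a j <= a i.
Proof.
move=> /subnK <-; elim: (j - i)%N => // n IH; rewrite addSn.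
apply: le_trans IH; have := a_half (n + i); have := a_gt0 (n + i).+1; lra.
Qed.

(* Induction on q: a target b far above the scales in use can only be hit by a
   set Q that contains one of boundedly many heavy elements e, and then Q minus
   e hits the target b - g e. *)
Lemma scale_avoid q m s : exists M, forall (E : finType) (g : E -> R),
    (forall e, 0 <= g e) -> \sum_e g e <= K ->
  forall bs : seq R, (size bs <= m)%N ->
  exists t, [/\ (s <= t)%N, (t <= M)%N & forall b, b \in bs ->
    forall Q : {set E}, (#|Q| <= q)%N ->
    ~~ (a t.+1 < b - \sum_(e in Q) g e <= a t)].
Proof.
(* The intervals between consecutive [a (sg j)] are disjoint, so among one more interval than
   targets some interval contains no target. *)
have window (sg : nat -> nat) bs : (forall j, sg j <= sg j.+1)%N ->
    exists2 j, (j <= size bs)%N &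
      forall b, b \in bs -> ~~ (a (sg j.+1) < b <= a (sg j)).
  move=> sg_homo; apply: (pigeonhole (P := fun j b => a (sg j.+1) < b <= a (sg j))).
  have sgm : forall i j, (i <= j)%N -> (sg i <= sg j)%N.
    by move=> i j; apply: (@homo_leq _ sg leq leqnn) => // y x z; exact: leq_trans.
  have aux b i j : (i < j)%N -> a (sg i.+1) < b -> b <= a (sg j) -> False.
    by move=> /sgm/scale_anti ij lt1 le2; move: (le_lt_trans le2 (le_lt_trans ij lt1)); rewrite ltxx.
  move=> b i j /andP[h1 h2] /andP[h3 h4]; case: (ltngtP i j) => // ij.
    by case: (aux b i j).
  by case: (aux b j i).
elim: q m s => [|q IH] m s.
  exists (s + m)%N => E g g0 gK bs bsm.
  have [] := window (fun j => s + j)%N bs; first by move=> j; rewrite leq_add2l.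
  move=> j jle hj; exists (s + j)%N; split; rewrite ?leq_addr ?leq_add2l ?(leq_trans jle)//.
  move=> b bbs Q; rewrite leqn0 cards_eq0 => /eqP->; rewrite big_set0 subr0 -addnS.
  exact: hj.
have /choice[f fP] : forall ms : nat * nat, exists M, forall (E : finType) (g : E -> R),
    (forall e, 0 <= g e) -> \sum_e g e <= K ->
  forall bs : seq R, (size bs <= ms.1)%N ->
  exists t, [/\ (ms.2 <= t)%N, (t <= M)%N & forall b, b \in bs ->
    forall Q : {set E}, (#|Q| <= q)%N ->
    ~~ (a t.+1 < b - \sum_(e in Q) g e <= a t)].
  by move=> [m' s']; exact: IH.
(* [cnt x] bounds the number of elements of weight at least [a x / (2 * q.+1)]; [nxt x] lies beyond
   every scale that the induction hypothesis, started at [x.+1], may return for the targets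
   [b - g e] with such [e]. *)
pose cnt x := Num.bound (2 * q.+1%:R * K / a x).
pose nxt x := maxn x (f (m * cnt x, x.+1)%N).+1.
pose sg j := iter j nxt s.
have sgS j : (sg j <= sg j.+1)%N by rewrite /sg iterS /nxt leq_maxl.
have sgm : forall i j, (i <= j)%N -> (sg i <= sg j)%N.
  by move=> i j; apply: (@homo_leq _ sg leq leqnn) => // y x z; exact: leq_trans.
exists (sg m.+1) => E g g0 gK bs bsm.
have [j jle hj] := window sg bs sgS.
set x := sg j in hj *.
have ax := a_gt0 x.
pose hv := enum [pred e | a x <= 2 * q.+1%:R * g e].
have hv_size : (size hv <= cnt x)%N.
  rewrite -cardE -(ler_nat R).
  have K0 : 0 <= K by apply: le_trans gK; apply: sumr_ge0.
  have: #|[pred e | a x <= 2 * q.+1%:R * g e]|%:R * a x <= 2 * q.+1%:R * K.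
    apply: (@le_trans _ _ (\sum_(e | a x <= 2 * q.+1%:R * g e) 2 * q.+1%:R * g e)).
      by rewrite mulr_natl -sumr_const; apply: ler_sum => e; rewrite inE.
    rewrite -mulr_sumr ler_wpM2l// ?mulr_ge0//.
    by apply: le_trans gK; rewrite [leRHS](bigID (fun e => a x <= 2 * q.+1%:R * g e))/= lerDl sumr_ge0.
  rewrite -ler_pdivlMr// => /le_trans; apply.
  apply: ltW; apply: le_lt_trans (archi_boundP _); last by rewrite !mulr_ge0// ?invr_ge0 ltW.
  by [].
pose bs' := [seq b - g e | b <- bs, e <- hv].
have bs'_size : (size bs' <= m * cnt x)%N by rewrite size_allpairs leq_mul.
have [t [xt tf ht]] := fP (m * cnt x, x.+1)%N E g g0 gK bs' bs'_size.
have tsg : (t.+1 <= sg j.+1)%N.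
  by rewrite /sg iterS -/(sg j) -/x /nxt; apply: leq_trans (leq_maxr _ _).
exists t; split.
- by apply: leq_trans (ltnW xt); apply: (sgm 0%N).
- by apply: leq_trans (ltnW tsg) _; apply: sgm; rewrite ltnS (leq_trans jle).
move=> b bbs Q Qq; apply/negP => /andP[lt1 le2].
have gQ0 : 0 <= \sum_(e in Q) g e by rewrite sumr_ge0.
case: (lerP b (a (sg j.+1))) => [b_small|b_big].
  have := scale_anti tsg; lra.
have {}b_big : a x < b by have := hj b bbs; rewrite b_big /= -ltNge.
(* As [a t] is at most half of [a x], a target above [a x] forces more than half of [a x] onto [Q],
   so one of its at most [q.+1] elements is heavy. *)
have gQ : a x < 2 * \sum_(e in Q) g e.
  have := scale_anti xt; have := a_half x; lra.
have [e eQ ge] : exists2 e, e \in Q & a x <= 2 * q.+1%:R * g e.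
  have [/existsP[e /andP[eQ ge]]|/existsPn hQ] :=
    boolP [exists e, (e \in Q) && (a x <= 2 * q.+1%:R * g e)]; first by exists e.
  have : q.+1%:R * (2 * \sum_(e in Q) g e) <= \sum_(e in Q) a x.
    rewrite mulrA mulr_sumr; apply: ler_sum => e eQ; rewrite (mulrC q.+1%:R).
    by have := hQ e; rewrite eQ /= -ltNge => /ltW.
  rewrite sumr_const -[a x *+ _]mulr_natl => h.
  have : q.+1%:R * a x < q.+1%:R * (2 * \sum_(e in Q) g e) by rewrite ltr_pM2l// ltr0n.
  move=> /lt_le_trans/(_ h); rewrite ltr_pM2r// ltr_nat; lia.
have bs'e : b - g e \in bs' by apply/allpairsP; exists (b, e); rewrite mem_enum inE.
have Qe : (#|Q :\ e| <= q)%N by rewrite -ltnS; move: Qq; rewrite (cardsD1 e) eQ.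
have := ht _ bs'e _ Qe; rewrite (big_setD1 e)//= in lt1 le2.
by rewrite -addrA -opprD lt1 le2.
Qed.

End ScaleSeparation.

(** * Approximate covers and their finitely many patterns *)

Section FractionalCovers.
Variables (R : realType) (k : R).

(** Weights are not capped at 1, so that edges can be merged freely; [rho_star_leP] restores the
    cap. *)
Definition approx_cover (V : finType) (S : {set {set V}}) (X : {set V}) (th : R) :=
  exists g : {set V} -> R, [/\ forall e, 0 <= g e,
    \sum_(e in S) g e <= k + th &
    forall v, v \in X -> 1 - th <= \sum_(e in S | v \in e) g e].

(* The linear program seen by an enumeration of s edges: each Q in QQ is the
   set of indices of the edges through some vertex to be covered. *)
Definition cell_cover (s : nat) (QQ : {set {set 'I_s}}) (th : R) :=
  exists x : 'I_s -> R, [/\ forall j, 0 <= x j, \sum_j x j <= k + th &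
    forall Q, Q \in QQ -> 1 - th <= \sum_(j in Q) x j].

(** Finiteness in the role of compactness: each of the finitely many [QQ] that is not feasible at
    every positive defect fails at some positive one, and the least of these is a threshold, since
    feasibility is monotone in the defect. *)
Lemma cell_cover_gap s : exists2 th0 : R, 0 < th0 &
  forall QQ : {set {set 'I_s}}, cell_cover QQ th0 ->
    forall th, 0 < th -> cell_cover QQ th.
Proof.
have mono (QQ : {set {set 'I_s}}) th th' : th <= th' -> cell_cover QQ th ->
    cell_cover QQ th'.
  move=> le_th [x [x0 xk xQ]]; exists x; split=> // [|Q /xQ]; lra.
have /choice[f fP] (QQ : {set {set 'I_s}}) : exists t, 0 < t /\
    (cell_cover QQ t -> forall th, 0 < th -> cell_cover QQ th).
  have [h|/existsNP[t /not_implyP[t0 nt]]] :=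
    pselect (forall th, 0 < th -> cell_cover QQ th); first by exists 1.
  by exists t; split.
exists (\big[Num.min/1]_QQ f QQ).
  elim/big_ind: _ => // [x y x0 y0|QQ _]; first by rewrite lt_min x0.
  by case: (fP QQ).
move=> QQ hQQ; have [_ h] := fP QQ; apply: h; apply: mono hQQ.
by rewrite (bigD1 QQ)//= ge_min lexx.
Qed.

(** One [QQ] serves all defects. Indices from [#|S|] on name the empty set and get weight 0, so the
    number of variables is [s] for every [S]. *)
Lemma approx_cover_cells (V : finType) (S : {set {set V}}) (X : {set V}) s :
    (#|S| <= s)%N -> exists (sg : 'I_s -> {set V}) (QQ : {set {set 'I_s}}),
  [/\ forall j, sg j \in S \/ sg j = set0,
      forall v, v \in X -> exists2 Q, Q \in QQ & forall j, j \in Q -> v \in sg j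
    & forall th, approx_cover S X th -> cell_cover QQ th].
Proof.
move=> Ss; pose sg (j : 'I_s) := nth set0 (enum S) j.
exists sg, [set [set j | v \in sg j] | v in X]; split.
- move=> j; rewrite /sg; case: (ltnP j #|S|) => jS.
    by left; rewrite -(mem_enum (mem S)) mem_nth -?cardE.
  by right; rewrite nth_default -?cardE.
- move=> v vX; exists [set j | v \in sg j]; first by apply/imsetP; exists v.
  by move=> j; rewrite inE.
move=> th [g [g0 gk gX]].
pose x (j : 'I_s) := if (j < #|S|)%N then g (sg j) else 0.
have sumE (P : pred {set V}) :
    \sum_(j | P (sg j)) x j = \sum_(e in S | P e) g e.
  rewrite -[in RHS]big_enum_cond/= (big_nth set0) -cardE big_mkord.
  rewrite (big_ord_widen_cond s (fun i => P (nth set0 (enum S) i))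
     (fun i => g (nth set0 (enum S) i)))//.
  by rewrite [LHS]big_mkcond [RHS]big_mkcond; apply: eq_bigr => j _;
     rewrite /x /sg; case: (P _); case: ltnP.
exists x; split.
- by move=> j; rewrite /x; case: ifP.
- have -> : \sum_j x j = \sum_(e in S) g e.
    by rewrite (sumE predT); apply: eq_bigl => e; rewrite andbT.
  exact: gk.
- move=> _ /imsetP[v vX ->]; under eq_bigl do rewrite inE.
  by rewrite (sumE (fun e => v \in e)) gX.
Qed.

(** The way back from a pattern to edges: several indices may name one edge, and their weights then
    add up. *)
Lemma cells_approx_cover (V : finType) (S : {set {set V}}) (X : {set V}) s
    (sg : 'I_s -> {set V}) (QQ : {set {set 'I_s}}) th :
    (forall j, sg j \in S \/ sg j = set0) ->
    (forall v, v \in X -> exists2 Q, Q \in QQ & forall j, j \in Q -> v \in sg j) ->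
  cell_cover QQ th -> approx_cover S X th.
Proof.
move=> sgS sgX [x [x0 xk xQ]].
exists (fun e => \sum_(j | sg j == e) x j).
have sumE (P : pred {set V}) : \sum_(e in S | P e) \sum_(j | sg j == e) x j =
    \sum_(j | (sg j \in S) && P (sg j)) x j.
  rewrite [RHS](partition_big sg (fun e => (e \in S) && P e))//=.
  apply: eq_bigr => e eSP; apply: eq_bigl => j.
  by case: eqP => [->|]; rewrite ?andbF// eSP.
split=> [e||v vX]; first by rewrite sumr_ge0.
  have -> : \sum_(e in S) \sum_(j | sg j == e) x j = \sum_(j | (sg j \in S) && true) x j.
    by rewrite -(sumE predT); apply: eq_bigl => e; rewrite andbT.
  apply: le_trans xk; rewrite [leRHS](bigID (fun j => (sg j \in S) && true))/=.
  by rewrite lerDl sumr_ge0.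
rewrite sumE; have [Q QQQ vQ] := sgX v vX; apply: le_trans (xQ Q QQQ) _.
rewrite big_mkcond [leRHS]big_mkcond; apply: ler_sum => j _.
case: ifPn => jQ; last by case: ifP.
have vj := vQ j jQ; rewrite vj andbT; case: (sgS j) => [->//|].
by move=> h; rewrite h inE in vj.
Qed.

(** The threshold depends on [s] alone, so it can enter the choice of scales before any hypergraph
    is given. *)
Lemma approx_cover_gap s : exists2 th0 : R, 0 < th0 &
  forall (V : finType) (S : {set {set V}}) (X : {set V}), (#|S| <= s)%N ->
    approx_cover S X th0 -> forall th, 0 < th -> approx_cover S X th.
Proof.
have [th0 th0_gt0 gap] := cell_cover_gap s; exists th0 => // V S X Ss acov th th_gt0.
have [sg [QQ [sgS sgX cov]]] := approx_cover_cells X Ss.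
exact: cells_approx_cover sgS sgX (gap _ (cov _ acov) _ th_gt0).
Qed.

(* Choosing heavy-on-average edges greedily: c of them would meet in too many
   points of Y. *)
Lemma few_lightly_covered (V : finType) (H : hypergraph V) (c d K : nat) (dl : R)
    (S : {set {set V}}) (g : {set V} -> R) (Y : {set V}) :
    cd_hypergraph c d H -> 0 < dl -> S \subset edges H ->
    (forall e, e \in S -> 0 <= g e /\ g e * (2 * c%:R) <= dl) ->
    \sum_(e in S) g e * 2 <= K%:R * dl ->
    (forall v, v \in Y -> dl <= \sum_(e in S | v \in e) g e) ->
  (#|Y| <= d * K ^ c)%N.
Proof.
move=> cdH dl0 SH gS gK gY; rewrite leqNgt; apply/negP => Ybig.
(* Each greedy choice costs a factor [K], so that more than [d] common points remain after [c]
   choices. *)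
suff /(_ c (leqnn c))[F [FS Fc]] : forall i, (i <= c)%N ->
    exists F : {set {set V}}, [/\ F \subset S, #|F| = i &
      (d * K ^ (c - i) < #|Y :&: \bigcap_(e in F) e|)%N].
  rewrite subnn expn0 muln1 ltnNge => /negP; apply.
  by apply: leq_trans (cdH F (fintype.subset_trans FS SH) Fc); rewrite subset_leq_card// finset.subsetIr.
elim=> [_|i IH ic].
  by exists set0; rewrite sub0set cards0 subn0 big_set0 finset.setIT.
have [F [FS Fi Fbig]] := IH (ltnW ic).
set Yi := Y :&: _ in Fbig.
have [/existsP[e /andP[/setDP[eS eF] ebig]]|/existsPn small] := boolP
    [exists e, (e \in S :\: F) && (d * K ^ (c - i.+1) < #|e :&: Yi|)%N].
  exists (e |: F); split; first by rewrite subUset sub1set eS.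
    by rewrite cardsU1 eF Fi.
  by rewrite big_setU1//= finset.setICA.
suff : \sum_(v in Yi) dl <= (d * K ^ (c - i))%:R * dl.
  rewrite sumr_const -[dl *+ _]mulr_natl ler_pM2r// ler_nat; lia.
(* The fewer than [c] chosen edges, each of weight at most [dl / (2 * c)], give at most half of [dl]
   to [v]; the rest comes from [S :\: F]. *)
have lightF v : \sum_(e in F | v \in e) g e * 2 <= dl.
  have : \sum_(e in F | v \in e) g e * (2 * c%:R) <= \sum_(e in F) dl.
    rewrite [leLHS]big_mkcondr; apply: ler_sum => e eF.
    by have [? ?] := gS e (subsetP FS e eF); case: ifP => // _; exact: ltW.
  rewrite sumr_const Fi -[dl *+ i]mulr_natl => h.
  have c0 : 0 < c%:R :> R by rewrite ltr0n (leq_ltn_trans _ ic).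
  rewrite -(ler_pM2r c0) mulr_suml.
  under eq_bigr do rewrite -mulrA.
  apply: le_trans h _; rewrite mulrC ler_pM2l// ler_nat; exact: ltnW.
have heavy v : v \in Yi -> dl <= \sum_(e in S :\: F | v \in e) g e * 2.
  move=> /setIP[/gY + _]; rewrite (bigID (fun e => e \in F))/=.
  have -> : \sum_(e | (e \in S) && (v \in e) && (e \in F)) g e = \sum_(e in F | v \in e) g e.
    apply: eq_bigl => e; case eF: (e \in F); rewrite ?andbF// (subsetP FS e eF).
    by rewrite /= andbT.
  have := lightF v; rewrite -!mulr_suml.
  have -> : \sum_(i | (i \in S) && (v \in i) && (i \notin F)) g i =
      \sum_(e in S :\: F | v \in e) g e.
    by apply: eq_bigl => e; rewrite in_setD; case: (e \in F); rewrite /= ?andbF ?andbT.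
  lra.
(* Double counting of the weight given to [Yi] from outside [F]: if every such edge met at most
   [d * K ^ (c - i.+1)] points of [Yi], the total would be too small. *)
apply: (@le_trans _ _ (\sum_(v in Yi) \sum_(e in S :\: F | v \in e) g e * 2)).
  exact: ler_sum.
rewrite (exchange_big_dep (fun e => e \in S :\: F))/=; last by move=> v e _ /andP[].
apply: (@le_trans _ _ (\sum_(e in S :\: F) (d * K ^ (c - i.+1))%:R * (g e * 2))).
  apply: ler_sum => e eSF.
  have [g0 _] : 0 <= g e /\ g e * (2 * c%:R) <= dl by apply: gS; case/setDP: eSF.
  have -> : \sum_(v in Yi | (e \in S :\: F) && (v \in e)) g e * 2 = #|e :&: Yi|%:R * (g e * 2).
    rewrite mulr_natl -sumr_const; apply: eq_bigl => v.
    by rewrite eSF finset.in_setI andbC.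
  rewrite ler_wpM2r ?mulr_ge0// ler_nat.
  by have := small e; rewrite eSF /= -leqNgt.
rewrite -mulr_sumr.
apply: (@le_trans _ _ ((d * K ^ (c - i.+1))%:R * (K%:R * dl))).
  rewrite ler_wpM2l//; apply: le_trans gK.
  rewrite [leRHS](bigID (fun e => e \in F))/=.
  have -> : \sum_(e in S :\: F) g e * 2 = \sum_(e in S | e \notin F) g e * 2.
    by apply: eq_bigl => e; rewrite in_setD andbC.
  rewrite lerDr sumr_ge0// => e /andP[eS _]; rewrite mulr_ge0//.
  by case: (gS e eS).
rewrite mulrA -natrM -mulnA -expnSr; suff -> : (c - i.+1).+1 = (c - i)%N by [].
lia.
Qed.

Lemma card_bigcup_const (I T : finType) (P : pred I) (F : I -> {set T}) n :
  (forall i, P i -> #|F i| <= n)%N -> (#|\bigcup_(i | P i) F i| <= #|P| * n)%N.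
Proof.
move=> Fn; rewrite -sum_nat_const; apply: (@leq_trans (\sum_(i | P i) #|F i|)).
  elim/big_rec2: _ => [|i m A _ IH]; first by rewrite cards0.
  by apply: leq_trans (leq_card_setU _ _) _; rewrite leq_add2l.
by rewrite [leqLHS]big_mkcond [leqRHS]big_mkcond; apply: leq_sum => i _; rewrite unfold_in; case: ifP => // /Fn.
Qed.

Lemma merge_sum (T : finType) (A : {set T}) (r : T -> T) (P : pred T) (g : T -> R) :
  \sum_(e in r @: A | P e) \sum_(e' in A | r e' == e) g e' =
  \sum_(e in A | P (r e)) g e.
Proof.
rewrite [RHS](partition_big r (fun e => (e \in r @: A) && P e))/=.
  apply: eq_bigr => e /andP[_ Pe]; apply: eq_bigl => e'.
  by case: eqP => [->|]; rewrite ?andbF// Pe !andbT.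
by move=> e /andP[eA ->]; rewrite imset_f.
Qed.

(** Let [Q] be the heavy edges through a vertex [v] outside [Z]; there are fewer than [c]. The
    choice of [t] keeps the deficit [1 - \sum_(e in Q) g e] out of the window from [a t.+1] to
    [a t]. A deficit above [a t] would put [v] into [Z2], as the light edges make up for all but
    [th] of it. So [Q] alone covers [v] up to [a t.+1], a defect that [approx_cover_gap] removes. On
    [Z] nothing is lost, because only edges with equal traces on [Z] are merged. *)
Lemma support_bound (c d : nat) : (0 < c)%N -> exists s,
  forall (V : finType) (H : hypergraph V) (X : {set V}), cd_hypergraph c d H ->
    (forall th, 0 < th -> approx_cover (edges H) X th) ->
  exists2 S : {set {set V}}, S \subset edges H & (#|S| <= s)%N /\
    forall th, 0 < th -> approx_cover S X th.
Proof.
move=> c_gt0.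
have /choice[gap gapP] s : exists th0 : R, 0 < th0 /\
    forall (V : finType) (S : {set {set V}}) (X : {set V}), (#|S| <= s)%N ->
    approx_cover S X th0 -> forall th, 0 < th -> approx_cover S X th.
  by have [th0 ? ?] := approx_cover_gap s; exists th0.
set mass := `|k| + 1.
have mass_gt0 : 0 < mass by rewrite ltr_wpDl.
(* [J a] bounds the number of edges of weight at least [a / (4 * c)]. [z a] bounds [Z]: at most [d]
   points for each set of [c] heavy edges, and the points receiving at least [a / 2] from light
   edges, by [few_lightly_covered]. [sz a] counts the heavy edges and one light edge per subset of
   [Z]. *)
pose J a : nat := Num.bound (mass * (4 * c%:R) / a).
pose Kn a : nat := Num.bound (mass * 4 / a).
pose z a := (2 ^ J a * d + d * Kn a ^ c)%N.
pose sz a := (J a + 2 ^ z a)%N.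
(* Each scale is at most half the previous one and at most the threshold for the supports arising
   there. *)
pose a t := iter t (fun x => Num.min (x / 2) (gap (sz x))) 1.
have aS t : a t.+1 = Num.min (a t / 2) (gap (sz (a t))) by rewrite /a iterS.
have a_gt0 t : 0 < a t.
  elim: t => [|t IH]; first exact: ltr01.
  by rewrite aS lt_min divr_gt0//=; case: (gapP (sz (a t))).
have a_half t : a t.+1 * 2 <= a t.
  by rewrite aS -ler_pdivlMr// ge_min lexx.
(* The only target is 1, and the sets [Q] have at most [c.-1] elements. *)
have [M avoid] := scale_avoid mass a_gt0 a_half c.-1 1 0.
exists (\max_(t < M.+1) sz (a t)) => V H X cdH cov.
pose th := a M.+1.
have th_le1 : th * 2 <= 1.
  apply: le_trans (a_half M) _; exact: (scale_anti a_gt0 a_half (leq0n M)).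
have [g [g0 gk gX]] := cov th (a_gt0 _).
have g_mass : \sum_(e in edges H) g e <= mass.
  by apply: le_trans gk _; rewrite /mass lerD// ?ler_norm//; have := a_gt0 M.+1; lra.
pose g' e := if e \in edges H then g e else 0.
have g'0 e : 0 <= g' e by rewrite /g'; case: ifP.
have g'_mass : \sum_e g' e <= mass by rewrite -big_mkcond.
have [t [_ tM tgood]] := avoid _ g' g'0 g'_mass [:: 1] isT.
have {}tgood (Q : {set {set V}}) : Q \subset edges H -> (#|Q| < c)%N ->
    ~~ (a t.+1 < 1 - \sum_(e in Q) g e <= a t).
  move=> QH Qc; have -> : \sum_(e in Q) g e = \sum_(e in Q) g' e.
    by apply: eq_bigr => e eQ; rewrite /g' (subsetP QH).
  by apply: tgood; rewrite ?inE// -ltnS prednK.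
have [gap_gt0 {}gapP] := gapP (sz (a t)).
have th_le : th <= a t.+1 by apply: (scale_anti a_gt0 a_half); rewrite ltnS.
have at0 := a_gt0 t.
have atS : a t.+1 <= gap (sz (a t)) by rewrite aS ge_min lexx orbT.
have cR : 0 < c%:R :> R by rewrite ltr0n.
pose L := [set e in edges H | a t <= g e * (4 * c%:R)].
pose Lt := edges H :\: L.
have LH : L \subset edges H by apply/subsetP => e; rewrite inE => /andP[].
have LtH : Lt \subset edges H by exact: finset.subsetDl.
have LJ : (#|L| <= J (a t))%N.
  rewrite -(ler_nat R); apply: le_trans (ltW (archi_boundP _)); last first.
    by rewrite !mulr_ge0// ?invr_ge0 ltW.
  rewrite ler_pdivlMr// [_ * a t]mulr_natl -sumr_const.
  apply: (@le_trans _ _ (\sum_(e in L) g e * (4 * c%:R))).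
    by apply: ler_sum => e; rewrite inE => /andP[].
  rewrite -mulr_suml ler_wpM2r ?mulr_ge0//; apply: le_trans g_mass.
  rewrite [leRHS](bigID (fun e => e \in L))/=.
  have -> : \sum_(e in L) g e = \sum_(e in edges H | e \in L) g e.
    by apply: eq_bigl => e; case eL: (e \in L); rewrite ?andbF// (subsetP LH).
  by rewrite lerDl sumr_ge0.
pose Z1 := \bigcup_(F : {set {set V}} | F \in [set F : {set {set V}} in powerset L | #|F| == c])
  \bigcap_(e in F) e.
pose Z2 := [set v in X | a t / 2 <= \sum_(e in Lt | v \in e) g e].
pose Z := Z1 :|: Z2.
have Z1_card : (#|Z1| <= 2 ^ J (a t) * d)%N.
  apply: (leq_trans (card_bigcup_const (n := d) _)).
    move=> F; rewrite !inE => /andP[FL /eqP Fc].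
    by apply: cdH => //; exact: fintype.subset_trans LH.
  rewrite leq_mul2r; apply/orP; right.
  apply: (@leq_trans #|powerset L|).
    by apply: subset_leq_card; apply/subsetP => F; rewrite !inE => /andP[].
  by rewrite card_powerset leq_exp2l.
have Z2_card : (#|Z2| <= d * Kn (a t) ^ c)%N.
  apply: (few_lightly_covered (dl := a t / 2) (S := Lt) (g := g) cdH) => //.
  - by rewrite divr_gt0.
  - move=> e; rewrite !inE => /andP[+ eH]; rewrite eH /= -ltNge => h; split=> //.
    rewrite ler_pdivlMr//; apply: le_trans (ltW h); rewrite -mulrA ler_wpM2l//; lra.
  - rewrite -mulr_suml; apply: (@le_trans _ _ (mass * 2)).
      rewrite ler_wpM2r//; apply: le_trans g_mass.
      rewrite [leRHS](bigID (fun e => e \in L))/=.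
      have -> : \sum_(e in Lt) g e = \sum_(e in edges H | e \notin L) g e.
        by apply: eq_bigl => e; rewrite in_setD andbC.
      by rewrite lerDr sumr_ge0.
    have : mass * 4 / a t <= (Kn (a t))%:R.
      by apply/ltW/archi_boundP; rewrite !mulr_ge0// ?invr_ge0 ltW.
    rewrite ler_pdivrMr// => h; rewrite mulrA ler_pdivlMr//; lra.
  - by move=> v; rewrite inE => /andP[].
have Z_card : (#|Z| <= z (a t))%N.
  by apply: leq_trans (leq_card_setU _ _) _; rewrite leq_add.
(* One light edge is chosen per trace on [Z]. Heavy edges stay put, so outside [Z] the weight of [Q]
   survives the merging. *)
pose rep (Y : {set V}) := odflt set0 [pick e in Lt | e :&: Z == Y].
have repP e : e \in Lt -> rep (e :&: Z) \in Lt /\ rep (e :&: Z) :&: Z = e :&: Z.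
  move=> eLt; rewrite /rep; case: pickP => [e' /andP[? /eqP]//|/(_ e)].
  by rewrite eLt eqxx.
pose r e := if e \in L then e else rep (e :&: Z).
have rP e : e \in edges H -> r e \in edges H /\ (r e :&: Z = e :&: Z).
  move=> eH; rewrite /r; case: ifPn => eL //.
  by have [|/(subsetP LtH)] := repP e; first by rewrite inE eL.
have r_mem e v : e \in edges H -> v \in Z -> (v \in r e) = (v \in e).
  move=> /rP[_ /setP/(_ v)]; rewrite !finset.in_setI => + vZ.
  by rewrite vZ !andbT.
pose S := r @: edges H.
have SH : S \subset edges H.
  by apply/subsetP => _ /imsetP[e /rP[? _] ->].
have S_card : (#|S| <= sz (a t))%N.
  apply: (@leq_trans #|L :|: rep @: powerset Z|).
    apply: subset_leq_card; apply/subsetP => _ /imsetP[e eH ->].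
    rewrite /r inE; case: ifP => [->//|_]; apply/orP; right.
    by apply: imset_f; rewrite inE finset.subsetIr.
  apply: leq_trans (leq_card_setU _ _) _; rewrite leq_add//.
  apply: leq_trans (leq_imset_card _ _) _.
  by rewrite card_powerset leq_exp2l.
exists S => //; split.
  by apply: leq_trans S_card (leq_bigmax (Ordinal (tM : t < M.+1)%N)).
apply: gapP S_card _.
exists (fun e => \sum_(e' in edges H | r e' == e) g e'); split.
- by move=> e; rewrite sumr_ge0.
- have -> : \sum_(e in S) \sum_(e' in edges H | r e' == e) g e' = \sum_(e in edges H) g e.
    transitivity (\sum_(e in S | true) \sum_(e' in edges H | r e' == e) g e').
      by apply: eq_bigl => e; rewrite andbT.
    by rewrite (merge_sum (edges H) r predT); apply: eq_bigl => e; rewrite andbT.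
  by apply: le_trans gk _; rewrite lerD2l (le_trans th_le).
move=> v vX; rewrite (merge_sum (edges H) r (fun e => v \in e)).
have [vZ|vZ] := boolP (v \in Z).
  apply: le_trans (_ : 1 - th <= _); first by rewrite lerD2l lerN2 (le_trans th_le).
  apply: le_trans (gX v vX) _; rewrite le_eqVlt; apply/orP; left; apply/eqP.
  by apply: eq_bigl => e; case eH: (e \in edges H) => //=; rewrite r_mem.
pose Q := [set e in L | v \in e].
have QL : Q \subset L by apply/subsetP => e; rewrite inE => /andP[].
have sumQ : \sum_(e in L | v \in e) g e = \sum_(e in Q) g e.
  by apply: eq_bigl => e; rewrite [e \in Q]inE.
have Qc : (#|Q| < c)%N.
  rewrite ltnNge; apply: contra vZ => cQ.
  have [F /= [FQ Fc]] : exists F : {set {set V}}, F \subset Q /\ #|F| = c.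
    have /card_geqP[s [su sc sQ]] := cQ; exists [set e in s]; split.
      by apply/subsetP => e; rewrite inE => /sQ.
    by rewrite cardsE -sc; apply/card_uniqP.
  rewrite inE; apply/orP; left; apply/bigcupP; exists F.
    by rewrite !inE Fc eqxx (fintype.subset_trans FQ QL).
  by apply/finset.bigcapP => e /(subsetP FQ); rewrite inE => /andP[].
have big : 1 - \sum_(e in Q) g e <= a t.+1.
  have := tgood Q (fintype.subset_trans QL LH) Qc; rewrite negb_and -leNgt => /orP[//|].
  rewrite -ltNge => lt1; exfalso; move/negP: vZ; apply.
  rewrite inE; apply/orP; right; rewrite inE vX/=.
  have := gX v vX; rewrite (bigID (fun e => e \in L))/=.
  have -> : \sum_(e | (e \in edges H) && (v \in e) && (e \in L)) g e = \sum_(e in Q) g e.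
    apply: eq_bigl => e; rewrite [e \in Q]inE; case eL: (e \in L); rewrite ?andbF//=.
    by rewrite (subsetP LH e eL) andbT.
  have -> : \sum_(e | (e \in edges H) && (v \in e) && (e \notin L)) g e =
      \sum_(e in Lt | v \in e) g e.
    by apply: eq_bigl => e; rewrite in_setD; case: (e \in L); rewrite /= ?andbF ?andbT.
  have := a_half t; lra.
apply: (@le_trans _ _ (\sum_(e in Q) g e)); first by lra.
rewrite -sumQ [leRHS](bigID (fun e => e \in L))/=.
rewrite [X in X <= _](_ : _ = \sum_(i | (i \in edges H) && (v \in r i) && (i \in L)) g i).
  by rewrite lerDl sumr_ge0.
apply: eq_bigl => e; case eL: (e \in L); rewrite ?andbF//= andbT.
by rewrite /r eL (subsetP LH e eL).
Qed.

(** Dividing a cover with defect [th] by [1 - th] and capping at 1 gives a true cover: an edge whose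
    weight reaches the cap covers its vertices alone. *)
Lemma rho_star_leP (V : finType) (H : hypergraph V) (X : {set V}) :
  (rho_star R H X <= k%:E)%E <->
  (forall th, 0 < th -> approx_cover (edges H) X th).
Proof.
split=> [rho_le th th0|cov].
  have : (rho_star R H X < (k + th)%:E)%E.
    by apply: le_lt_trans rho_le _; rewrite lte_fin ltrDl.
  move=> /ereal_inf_lt[_ [g [g01 gX] ->]]; rewrite lte_fin => gk.
  exists (fun e => if e \in edges H then g e else 0); split.
  - by move=> e; case: ifP => // /g01/andP[].
  - by under eq_bigr => e -> do []; exact: ltW.
  - move=> v /gX => h; apply: (@le_trans _ _ 1); first by lra.
    by rewrite (eq_bigr g)// => e /andP[->].
apply/lee_addgt0Pr => ep ep0; rewrite -EFinD.
(* Chosen so that [(k + th) / (1 - th) <= k + ep]. *)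
pose th := Num.min (1 / 2) (ep / (1 + `|k| + ep)).
have den : 0 < 1 + `|k| + ep by have := normr_ge0 k; lra.
have th0 : 0 < th by rewrite lt_min; apply/andP; split; [lra | rewrite divr_gt0].
have th2 : th <= 1 / 2 by rewrite ge_min lexx.
have thep : th * (1 + `|k| + ep) <= ep by rewrite -ler_pdivlMr// ge_min lexx orbT.
have [g [g0 gk gX]] := cov th th0.
pose g2 e := Num.min 1 (g e / (1 - th)).
have g2_le e : g2 e <= g e / (1 - th) by rewrite ge_min lexx orbT.
have g2_ge0 e : 0 <= g2 e by rewrite le_min ler01 divr_ge0//; lra.
apply: ge_ereal_inf; exists (\sum_(e in edges H) g2 e)%:E.
  exists g2 => //; split=> [e _|v vX]; first by rewrite g2_ge0 ge_min lexx.
  have [/existsP[e /and3P[eH ve ge]]|/existsPn hsmall] :=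
    boolP [exists e, [&& e \in edges H, v \in e & g2 e == 1]].
    rewrite (bigD1 e) ?eH//= (eqP ge) lerDl sumr_ge0//.
  rewrite (eq_bigr (fun e => g e / (1 - th))); last first.
    move=> e /andP[eH ve]; have := hsmall e; rewrite eH ve /= /g2.
    by rewrite minEle; case: ifP => //; rewrite eqxx.
  rewrite -mulr_suml ler_pdivlMr ?mul1r ?gX//; lra.
rewrite lee_fin; apply: (@le_trans _ _ ((k + th) / (1 - th))).
  apply: (@le_trans _ _ (\sum_(e in edges H) g e / (1 - th))).
    by apply: ler_sum.
  by rewrite -mulr_suml ler_wpM2r// invr_ge0; lra.
rewrite ler_pdivrMr; last by lra.
have := ler_norm k; nra.
Qed.

End FractionalCovers.
(** * Tree decompositions *)

Section Trees.
Variables (T : finType) (adj : rel T).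

Lemma connect_uniq_path (e : rel T) x y : connect e x y ->
  exists p, [/\ path e x p, uniq (x :: p) & last x p = y].
Proof.
by move=> /connectP[p ep ->]; case: (shortenP ep) => q eq uq _; exists q.
Qed.

Definition within (S : {set T}) : rel T :=
  fun a b => [&& a \in S, b \in S & adj a b].

Lemma path_within S x p : path (within S) x p -> path adj x p /\ {subset p <= S}.
Proof.
elim: p x => [|y p IH] x //= /andP[/and3P[_ yS ->]] /IH[-> pS]; split=> // z.
by rewrite inE => /orP[/eqP->//|]; exact: pS.
Qed.

Lemma within_path (S : {set T}) x p : x \in S -> path adj x p -> {subset p <= S} ->
  path (within S) x p.
Proof.
elim: p x => [|y p IH] x //= xS /andP[xy yp] pS.
have yS : y \in S by rewrite pS ?mem_head.
by rewrite {1}/within xS yS xy IH// => z zp; rewrite pS// inE zp orbT.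
Qed.

Lemma within_sym S : symmetric adj -> symmetric (within S).
Proof. by move=> sym a b; rewrite /within (sym a b) andbCA. Qed.

Hypothesis tree_adj : is_tree adj.

(** Two paths that part after [x] are joined through their common end without returning to [x],
    which closes a cycle of at least three nodes. *)
Lemma tree_uniq_path x p q : path adj x p -> path adj x q ->
  uniq (x :: p) -> uniq (x :: q) -> last x p = last x q -> p = q.
Proof.
have [_ sym irr _ acyc] := tree_adj.
elim: p x q => [|a p IH] x [|b q] //=.
- by move=> _ _ _ /andP[+ _] eqx; rewrite eqx mem_last.
- by move=> _ _ /andP[+ _] _ eqx; rewrite -eqx mem_last.
move=> /andP[xa ap] /andP[xb bq] /andP[xNp up] /andP[xNq uq] eq_last.
have [eq_ab|neq_ab] := eqVneq a b.
  by move: bq uq eq_last; rewrite -eq_ab => bq uq eq_last; rewrite (IH a q).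
have ab : connect (within [set~ x]) a b.
  apply: (@connect_trans _ _ (last a p)).
    apply/connectP; exists p => //; move: xNp; rewrite inE negb_or => /andP[ax xp].
    apply: within_path => // [|z zp]; first by rewrite !inE eq_sym.
    by rewrite !inE; apply: contraNneq xp => <-.
  rewrite eq_last sym_connect_sym; last exact: within_sym.
  apply/connectP; exists q => //; move: xNq; rewrite inE negb_or => /andP[bx xq].
  apply: within_path => // [|z zq]; first by rewrite !inE eq_sym.
  by rewrite !inE; apply: contraNneq xq => <-.
have [r [ar ur rb]] := connect_uniq_path ab.
have [ar' rx] := path_within ar.
suff /acyc : ucycle adj [:: x, a & r].
  by case: r ar ur rb {ar' rx} => // _ _ /= eq_ab; rewrite eq_ab eqxx in neq_ab.
rewrite /ucycle /= xa rcons_path ar' rb sym xb /= inE negb_or.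
move: ur => /= /andP[-> ->]; rewrite !andbT; apply/andP; split.
  by apply: contraTneq xa => ->; rewrite irr.
by apply/negP => /rx; rewrite !inE eqxx.
Qed.

(** The gate of [u] into the subtree [A] is the first node of [A] on a path from [u]. A path inside
    [S] first enters [A] at some [y']; continued inside [A] to [g] it must be the unique path from
    [u] to [g], so [y'] is [g]. *)
Lemma tree_gate (A : {set T}) (u : T) : connected_in adj A -> A != set0 ->
  exists2 g, g \in A & forall S, connected_in adj S -> u \in S ->
    forall y, y \in S -> y \in A -> g \in S.
Proof.
move=> Aconn /set0Pn[a aA]; have [_ sym _ conn _] := tree_adj.
have hit p x : last x p \in A -> x \notin A ->
    exists p1 y p2, [/\ p = rcons p1 y ++ p2, y \in A & all [predC A] p1].
  elim: p x => [|z p IH] x /= pA xA; first by rewrite pA in xA.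
  have [zA|zA] := boolP (z \in A); first by exists [::], z, p.
  have [p1 [y [p2 [-> yA p1A]]]] := IH z pA zA.
  by exists (z :: p1), y, p2; rewrite /= zA.
have [uA|uA] := boolP (u \in A); first by exists u.
have [p [up pu pa]] := connect_uniq_path (conn u a).
have [|p1 [g [p2 [pE gA p1A]]]] := hit p u _ uA; first by rewrite pa.
exists g => // S Sconn uS y yS yA.
have [q [uq qu qy]] := connect_uniq_path (Sconn u y uS yS).
have [|q1 [y' [q2 [qE y'A q1A]]]] := hit q u _ uA; first by rewrite qy.
have [uq' qS] := path_within uq.
have [r [yr ru rg]] := connect_uniq_path (Aconn y' g y'A gA).
have [yr' rA] := path_within yr.
have y'S : y' \in S by rewrite qS// qE mem_cat mem_rcons mem_head.
have : rcons p1 g = rcons q1 y' ++ r.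
  apply: (@tree_uniq_path u).
  - by move: up; rewrite pE cat_path => /andP[].
  - rewrite cat_path last_rcons yr' andbT.
    by move: uq'; rewrite qE cat_path => /andP[].
  - by move: pu; rewrite pE -cat_cons cat_uniq => /andP[].
  - rewrite -cat_cons cat_uniq; apply/and3P; split.
    + by move: qu; rewrite qE -cat_cons cat_uniq => /andP[].
    + apply/hasPn => z zr /=; rewrite inE mem_rcons inE !negb_or.
      have zA := rA z zr.
      apply/and3P; split; first by apply: contraNneq uA => <-.
        by move: ru => /= /andP[y'r _]; apply: contraNneq y'r => <-.
      by apply/negP => /(allP q1A); rewrite inE /= zA.
    + by move: ru => /= /andP[].
  - by rewrite last_rcons last_cat last_rcons.
case/lastP: r {yr ru yr'} rg rA => [/= eq_g _ _|r z _ _]; first by rewrite -eq_g.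
rewrite -rcons_cat => /rcons_inj[p1E _].
have : y' \in p1 by rewrite p1E mem_cat mem_rcons mem_head.
by move=> /(allP p1A); rewrite inE /= y'A.
Qed.

(** The list [p] depends on [u] and [x] only, so connectedness within varying sets [S] becomes
    membership of fixed nodes. This is what turns bags into intersections. *)
Lemma tree_segment (u x : T) : exists p : seq T, forall S : {set T},
  u \in S -> connect (within S) u x <-> {subset p <= S}.
Proof.
have [_ _ _ conn _] := tree_adj.
have [p [up pu px]] := connect_uniq_path (conn u x).
exists p => S uS; split=> [/connect_uniq_path[q [uq qu qx]]|pS].
  have [uq' qS] := path_within uq.
  by rewrite (tree_uniq_path up uq' pu qu) ?px.
by apply/connectP; exists p => //; exact: within_path.
Qed.

End Trees.

(** On a cycle of three or more nodes, both neighbours of a node of maximal rank would be its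
    parent. *)
Lemma parent_tree (T : finType) (r : T) (p : T -> T) (rank : T -> nat) :
    (forall x, x != r -> (rank (p x) < rank x)%N) ->
  is_tree [rel x y | ((x != r) && (p x == y)) || ((y != r) && (p y == x))].
Proof.
move=> rank_p; set adj := [rel x y | _].
have sym : symmetric adj by move=> x y; rewrite /= orbC.
have to_root x : connect adj x r.
  elim: {x}(rank x).+1 {-2}x (leqnn (rank x).+1) => // n IH x xn.
  have [->|xr] := eqVneq x r; first exact: connect0.
  apply: (@connect_trans _ _ (p x)).
    by apply: connect1; rewrite /= xr eqxx.
  by apply: IH; apply: leq_trans (rank_p x xr) _.
split=> //.
- by apply/card_gt0P; exists r.
- move=> x /=; rewrite orbb; apply/negP => /andP[xr /eqP pxx].
  by have := rank_p x xr; rewrite pxx ltnn.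
- move=> x y; apply: connect_trans (to_root x) _.
  by rewrite sym_connect_sym.
move=> s /andP[cs us]; rewrite leqNgt; apply/negP => s3.
have [x0 x0s] : exists x, x \in s by case: s s3 {cs us} => // x s _; exists x; rewrite mem_head.
case: (@arg_maxnP _ x0 (fun x => x \in s) rank x0s) => x xs xmax.
have up y : y \in s -> adj x y -> y = p x.
  move=> ys /orP[/andP[_ /eqP->//]|/andP[yr /eqP pyx]].
  by have := rank_p y yr; rewrite pyx ltnNge; have := xmax y ys => /= ->.
have [i t st] := rot_to xs.
have ut : uniq (x :: t) by rewrite -st rot_uniq.
have ct : cycle adj (x :: t) by rewrite -st rot_cycle.
have tS z : z \in t -> z \in s by move=> zt; rewrite -(mem_rot i) st inE zt orbT.
have : size (x :: t) = size s by rewrite -st size_rot.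
case: t ut ct tS {st} => [|y t] ut ct tS; first by move=> sz; rewrite -sz in s3.
case/lastP: t ut ct tS => [|t z] ut ct tS; first by move=> sz; rewrite -sz in s3.
move=> _; move: ct; rewrite /cycle -!rcons_cons rcons_path last_rcons => /andP[xy zx].
have yE : y = p x by apply: up; [exact/tS/mem_head | case/andP: xy].
have zE : z = p x.
  by apply: up; [apply: tS; rewrite inE mem_rcons mem_head orbT | exact: (eq_ind_r is_true zx (sym x z))].
by move: ut; rewrite yE zE /= mem_rcons mem_head andbF.
Qed.

(** * Unions of boundedly many intersections of edges *)

Section BasicSets.
Variables (V : finType) (H : hypergraph V) (c : nat).

Definition union_of_intersections (Fs : seq (seq {set V})) (Y : seq V) : {set V} :=
  [set v | has (all (fun e : {set V} => v \in e)) Fs || (v \in Y)].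

(** Families are nonempty because the empty one would contribute all of [V]; this also allows a
    short family to be padded to length [c] by repeating an edge. *)
Definition basic_set (m l : nat) (B : {set V}) : Prop :=
  exists (Fs : seq (seq {set V})) (Y : seq V),
  [/\ (size Fs <= m)%N, (size Y <= l)%N,
      forall F, F \in Fs -> [/\ (0 < size F)%N, (size F <= c)%N & {subset F <= edges H}]
    & B = union_of_intersections Fs Y].

Lemma basic_set0 : basic_set 0 0 set0.
Proof. by exists [::], [::]; split=> //; apply/setP => v; rewrite !inE. Qed.

Lemma basic_setU m l m' l' B B' : basic_set m l B -> basic_set m' l' B' ->
  basic_set (m + m') (l + l') (B :|: B').
Proof.
move=> [Fs [Y [Fm Yl FsP ->]]] [Fs' [Y' [Fm' Yl' FsP' ->]]].
exists (Fs ++ Fs'), (Y ++ Y'); rewrite !size_cat !leq_add//; split=> // [F|].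
  by rewrite mem_cat => /orP[/FsP|/FsP'].
by apply/setP => v; rewrite !inE has_cat mem_cat orbACA.
Qed.

Lemma basic_set_weak m l m' l' B : (m <= m')%N -> (l <= l')%N ->
  basic_set m l B -> basic_set m' l' B.
Proof.
move=> mm ll [Fs [Y [Fm Yl FsP BE]]]; exists Fs, Y; split=> //.
  exact: leq_trans mm.
exact: leq_trans ll.
Qed.

Lemma basic_set_bigcup (I : eqType) (s : seq I) (B : I -> {set V}) m l :
    (forall i, i \in s -> basic_set m l (B i)) ->
  basic_set (size s * m) (size s * l) (\bigcup_(i <- s) B i).
Proof.
elim: s => [|i s IH] sB; first by rewrite big_nil; exact: basic_set0.
rewrite big_cons /= !mulSn; apply: basic_setU; first by apply: sB; rewrite mem_head.
by apply: IH => j js; apply: sB; rewrite inE js orbT.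
Qed.

Lemma basic_set_finite d (B : {set V}) : (#|B| <= d)%N -> basic_set 0 d B.
Proof.
move=> Bd; exists [::], (enum B); rewrite -cardE; split=> //.
by apply/setP => v; rewrite inE /= mem_enum.
Qed.

Definition cell_union (Qs : seq {set {set V}}) : {set V} :=
  \bigcup_(Q <- Qs) \bigcap_(e in Q) e.

Lemma mem_bigcup_seq (I : eqType) (s : seq I) (B : I -> {set V}) v :
  (v \in \bigcup_(i <- s) B i) = has (fun i => v \in B i) s.
Proof. by elim: s => [|i s IH]; rewrite ?big_nil ?big_cons inE //= IH. Qed.

Lemma mem_cell_union (Qs : seq {set {set V}}) v :
  reflect (exists2 Q, Q \in Qs & v \in \bigcap_(e in Q) e) (v \in cell_union Qs).
Proof. by rewrite mem_bigcup_seq; exact: hasP. Qed.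

(* The intersection tree: intersecting with a cell union either leaves the
   intersection of F unchanged or branches into strictly larger families F; a
   family of c edges has at most d common vertices. *)
Lemma basic_set_intersection (d r n : nat) (F : {set {set V}})
    (Ms : seq (seq {set {set V}})) :
    cd_hypergraph c d H -> (0 < r)%N -> F \subset edges H -> (0 < #|F|)%N ->
    (c <= #|F| + n)%N ->
    (forall Qs, Qs \in Ms -> (size Qs <= r)%N /\
       forall Q, Q \in Qs -> Q \subset edges H) ->
  basic_set (r ^ n) (r ^ n * d) (\bigcap_(e in F) e :&: \bigcap_(Qs <- Ms) cell_union Qs).
Proof.
move=> cdH r0; elim: n F Ms => [|n IHn] F Ms FH F0 cF MsP.
  apply: (@basic_set_weak 0 d) => //; first by rewrite expn0 mul1n.
  apply: basic_set_finite; apply: leq_trans (subset_leq_card (finset.subsetIl _ _)) _.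
  have [F' [F'F F'c]] : exists F' : {set {set V}}, F' \subset F /\ #|F'| = c.
    rewrite addn0 in cF; have /card_geqP[s [su sc sF]] := cF.
    exists [set e in s]; split; first by apply/subsetP => e; rewrite inE => /sF.
    by rewrite cardsE -sc; apply/card_uniqP.
  apply: leq_trans (cdH F' (fintype.subset_trans F'F FH) F'c).
  apply/subset_leq_card/finset.bigcapsP => e /(subsetP F'F).
  exact: finset.bigcap_inf.
have [cF'|Fc] := leqP c (#|F| + n).
  by apply: basic_set_weak (IHn F Ms FH F0 cF' MsP); rewrite ?leq_mul2r leq_pexp2l// orbT.
(* [Ms] will come from a tree path, so its length must stay out of the bounds: dropping a cell union
   is free, and only enlarging [F] is paid for, with a factor [r]. *)
elim: Ms MsP => [_|Qs Ms IHMs MsP].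
  rewrite big_nil finset.setIT.
  exists [:: enum F], [::]; split; rewrite ?expn_gt0 ?r0//.
    move=> _ /[!inE]/eqP->; rewrite -!cardE F0; split=> //; first exact: leq_trans (leq_addr n _) (ltnW Fc).
    by move=> e; rewrite mem_enum; exact/subsetP.
  apply/setP => v; rewrite inE /= !orbF; apply/finset.bigcapP/allP => h e.
    by rewrite mem_enum => /h.
  by move=> eF; apply: h; rewrite mem_enum.
have [Qr QsH] := MsP Qs (mem_head _ _).
have {}MsP Qs' : Qs' \in Ms -> (size Qs' <= r)%N /\
       forall Q, Q \in Qs' -> Q \subset edges H.
  by move=> Q's; apply: MsP; rewrite inE Q's orbT.
rewrite big_cons.
have [/hasP[Q QQs QF]|/hasPn noQ] := boolP (has (fun Q : {set {set V}} => Q \subset F) Qs).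
  rewrite finset.setIA (_ : _ :&: cell_union Qs = \bigcap_(e in F) e); first exact: IHMs.
  apply/finset.setIidPl/subsetP => v /finset.bigcapP vF; apply/mem_cell_union.
  by exists Q => //; apply/finset.bigcapP => e /(subsetP QF)/vF.
have -> : \bigcap_(e in F) e :&: (cell_union Qs :&: \bigcap_(Qs <- Ms) cell_union Qs) =
    \bigcup_(Q <- Qs) (\bigcap_(e in F :|: Q) e :&: \bigcap_(Qs <- Ms) cell_union Qs).
  apply/setP => v; rewrite mem_bigcup_seq !finset.in_setI mem_bigcup_seq.
  apply/and3P/hasP => [[vF /hasP[Q QQs vQ] vMs]|[Q QQs]].
    by exists Q => //; rewrite finset.bigcap_setU !finset.in_setI vF vQ.
  rewrite finset.bigcap_setU !finset.in_setI => /andP[/andP[vF vQ] vMs].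
  by split=> //; apply/hasP; exists Q.
apply: (@basic_set_weak (size Qs * r ^ n) (size Qs * (r ^ n * d))).
- by rewrite expnS leq_mul2r Qr orbT.
- by rewrite expnS -mulnA leq_mul2r Qr orbT.
apply: basic_set_bigcup => Q QQs; apply: IHn => //.
- by rewrite subUset FH QsH.
- by apply: leq_trans F0 _; rewrite subset_leq_card// finset.subsetUl.
have : (#|F| < #|F :|: Q|)%N.
  rewrite proper_card// properE finset.subsetUl subUset subxx/=.
  exact: noQ.
lia.
Qed.

End BasicSets.

(** * A normal form for tree decompositions *)

Lemma mem_bigcap_seq (V : finType) (I : Type) (s : seq I) (B : I -> {set V}) v :
  (v \in \bigcap_(i <- s) B i) = all (fun i => v \in B i) s.
Proof. by elim: s => [|i s IH]; rewrite ?big_nil ?big_cons inE //= IH. Qed.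

Lemma sub_within (T : finType) (adj : rel T) (S S' : {set T}) x y : S \subset S' ->
  connect (within adj S) x y -> connect (within adj S') x y.
Proof.
move=> SS'; apply: connect_sub => a b /and3P[aS bS ab]; apply: connect1.
by rewrite /within !(subsetP SS')// ab.
Qed.

Section NormalForm.
Variables (R : realType) (k : R).

Definition covered (V : finType) (H : hypergraph V) (X : {set V}) : Prop :=
  forall th, 0 < th -> approx_cover k (edges H) X th.

Lemma covered_sub (V : finType) (H : hypergraph V) (X Y : {set V}) :
  X \subset Y -> covered H Y -> covered H X.
Proof.
move=> XY cov th /cov[g [g0 gk gY]]; exists g; split=> // v vX.
exact/gY/(subsetP XY).
Qed.

Lemma cell_cover_neq0 s (QQ : {set {set 'I_s}}) (Q : {set 'I_s}) :
  (forall th, 0 < th -> cell_cover k QQ th) -> Q \in QQ -> Q != set0.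
Proof.
move=> cov QQQ; have [x [x0 _ /(_ Q QQQ)]] := cov (1 / 2) ltac:(lra).
by apply: contraTneq => ->; rewrite big_set0 -ltNge; lra.
Qed.

(* Every bag B u lies in a union M u of cells of boundedly many edges. Growing
   the bags inside the sets M u as far as connectedness allows makes the trace
   of a bag B' u on an edge e, covered by the bag of x0, equal to the
   intersection of e with all M y for y on the tree path from u to x0. *)
Lemma normal_bags (c d : nat) : (0 < c)%N -> exists m l,
  forall (V : finType) (H : hypergraph V) (T : finType) (adj : rel T) (B : T -> {set V}),
    cd_hypergraph c d H -> tree_decomposition H adj B -> (forall u, covered H (B u)) ->
  exists B' : T -> {set V}, tree_decomposition H adj B' /\
    forall u, covered H (B' u) /\ basic_set H c m l (B' u).
Proof.
move=> c0; have [s sP] := support_bound k d c0.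
pose r := (2 ^ s)%N.
exists (s * r ^ c)%N, (s * (r ^ c * d))%N => V H T adj B cdH [tree cover conn] cov.
have /choice[cl clP] : forall u, exists cl : ('I_s -> {set V}) * {set {set 'I_s}},
  [/\ forall j, cl.1 j \in edges H \/ cl.1 j = set0,
      forall v, v \in B u -> exists2 Q, Q \in cl.2 & forall j, j \in Q -> v \in cl.1 j
    & forall th, 0 < th -> cell_cover k cl.2 th].
  move=> u; have [S SH [Ss Scov]] := sP V H (B u) cdH (cov u).
  have [sg [QQ [sgS sgX QQcov]]] := approx_cover_cells k (B u) Ss.
  exists (sg, QQ); split=> //= [j|th /Scov]; last exact: QQcov.
  by case: (sgS j) => [/(subsetP SH)|]; [left|right].
(* A discarded [Q] has an index naming the empty set, so its cell contains no vertex. *)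
pose Qs u := [seq (cl u).1 @: Q | Q : {set 'I_s} <- enum (cl u).2 &
  [forall j in Q, (cl u).1 j \in edges H]].
pose M u := cell_union (Qs u).
have memM u v : v \in M u <->
    exists2 Q, Q \in (cl u).2 & forall j, j \in Q -> v \in (cl u).1 j.
  have [sgH _ _] := clP u.
  split=> [/mem_cell_union[_ /mapP[Q + ->]]|[Q QQQ vQ]].
    rewrite mem_filter mem_enum => /andP[_ QQQ] /finset.bigcapP vQ; exists Q => // j jQ.
    by apply: vQ; apply: imset_f.
  apply/mem_cell_union; exists ((cl u).1 @: Q); last first.
    by apply/finset.bigcapP => _ /imsetP[j jQ ->]; exact: vQ.
  apply/mapP; exists Q => //; rewrite mem_filter mem_enum QQQ andbT.
  apply/forall_inP => j /vQ; case: (sgH j) => // ->; by rewrite inE.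
have Qs_size u : (size (Qs u) <= r)%N.
  rewrite size_map size_filter; apply: leq_trans (count_size _ _) _.
  rewrite -cardE; apply: leq_trans (max_card _) _.
  by rewrite -cardsT -powersetT card_powerset cardsT card_ord.
have QsH u Q : Q \in Qs u -> Q \subset edges H.
  move=> /mapP[Q' + ->]; rewrite mem_filter => /andP[/forall_inP QH _].
  by apply/subsetP => _ /imsetP[j /QH jH ->].
have BM u : B u \subset M u by apply/subsetP => v vB; apply/memM; case: (clP u) => _ h _; exact: h.
pose W v := [set y | v \in M y].
pose S v := [set y | v \in B y].
have SW v : S v \subset W v by apply/subsetP => y; rewrite !inE; exact: subsetP.
have [_ sym _ _ _] := tree.
have wsym A := sym_connect_sym (within_sym A sym).
(* For fixed [v], the nodes [u] with [v \in B' u] form the part of [W v] connected to [S v]. *)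
pose B' u := [set v in M u | [exists x, (v \in B x) && connect (within adj (W v)) u x]].
have B'P u v : reflect (v \in M u /\ exists2 x, v \in B x & connect (within adj (W v)) u x) (v \in B' u).
  rewrite inE; apply: (iffP andP) => -[vM].
    by move=> /existsP[x /andP[vx ux]]; split=> //; exists x.
  by move=> [x vx ux]; split=> //; apply/existsP; exists x; rewrite vx.
have BB' u : B u \subset B' u.
  apply/subsetP => v vB; apply/B'P; split; first exact: (subsetP (BM u)).
  by exists u.
have tdB' : tree_decomposition H adj B'.
  split=> // [e /cover[u eu]|v].
    by exists u; exact: fintype.subset_trans (BB' u).
  set S' := [set u | v \in B' u].
  have SS' : S v \subset S' by apply/subsetP => y; rewrite 2!in_set; exact: (subsetP (BB' y)).
  have toS x : x \in S' -> exists2 x0, x0 \in S v & connect (within adj S') x x0.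
    rewrite inE => /B'P[vM [x0 vx0 xx0]]; exists x0; first by rewrite inE.
    have [p pP px0] := connectP xx0; rewrite px0 {xx0}.
    have xS' : x \in S'.
      by rewrite inE; apply/B'P; split=> //; exists x0 => //; apply/connectP; exists p.
    elim: p x {vM} xS' pP px0 => [|y p IH] x xS' /=; first by rewrite connect0.
    move=> /andP[/and3P[xW yW xy] pP] px0.
    have yS' : y \in S'.
      rewrite inE; apply/B'P; split; first by move: yW; rewrite inE.
      by exists x0 => //; apply/connectP; exists p.
    apply: connect_trans (IH y yS' pP px0); apply: connect1.
    by rewrite /within xS' yS' xy.
  move=> x y /toS[x0 x0S xx0] /toS[y0 y0S yy0].
  apply: connect_trans xx0 _; rewrite wsym in yy0; apply: connect_trans yy0.
  exact: sub_within SS' (conn v x0 y0 x0S y0S).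
exists B'; split=> // u; have [sgH sgB QQcov] := clP u; split.
  move=> th th0; apply: (cells_approx_cover (sg := (cl u).1) (QQ := (cl u).2)) => //.
    by move=> v /B'P[/memM].
  exact: QQcov.
(* Every [Q] in a feasible pattern is nonempty, so each vertex of the bag lies in one of the [s]
   named edges. *)
have -> : B' u = \bigcup_(j <- enum 'I_s) ((cl u).1 j :&: B' u).
  apply/setP => v; rewrite mem_bigcup_seq; apply/idP/hasP => [vB'|[j _]]; last first.
    by rewrite inE => /andP[].
  have /B'P[/memM[Q QQQ vQ] _] := vB'.
  have /set0Pn[j jQ] := cell_cover_neq0 QQcov QQQ.
  by exists j; rewrite ?mem_enum// finset.in_setI vB' vQ.
rewrite -[s in (s * _)%N](size_enum_ord s) -[s in (s * (_ * _))%N](size_enum_ord s).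
apply: basic_set_bigcup => j _.
case: (sgH j) => [eH|->]; last first.
  by rewrite finset.set0I; exact: basic_set_weak (basic_set0 H c).
set e := (cl u).1 j in eH *.
have [x0 ex0] := cover e eH.
have [p pP] := tree_segment tree u x0.
(* For [v] in [e] the node [x0] lies in [S v], which is connected inside [W v]; hence reaching any
   node of [S v] from [u] amounts to reaching [x0]. *)
have -> : e :&: B' u = \bigcap_(e' in [set e]) e' :&:
    \bigcap_(Qs <- map Qs (u :: p)) cell_union Qs.
  apply/setP => v; rewrite big_set1 !finset.in_setI mem_bigcap_seq all_map.
  apply: andb_id2l => ve; apply/B'P/allP => /=.
    move=> [vM [x vx ux]] y; rewrite inE => /orP[/eqP->//|yp].
    have ux0 : connect (within adj (W v)) u x0.
      apply: connect_trans ux (sub_within (SW v) (conn v x x0 _ _)); rewrite inE//.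
      exact: (subsetP ex0).
    have uW : u \in W v by rewrite inE.
    by have := (pP _ uW).1 ux0 y yp; rewrite inE.
  move=> vM; have uW : u \in W v by rewrite inE; apply: vM; rewrite mem_head.
  split; first by apply: vM; rewrite mem_head.
  exists x0; first exact: (subsetP ex0).
  by apply/(pP _ uW) => y yp; rewrite inE; apply: vM; rewrite inE yp orbT.
apply: basic_set_intersection => //.
- by rewrite expn_gt0.
- by rewrite sub1set.
- by rewrite cards1.
- by rewrite leq_addl.
- by move=> _ /mapP[y _ ->]; split; [exact: Qs_size | exact: QsH].
Qed.

End NormalForm.
(** * The cops-and-robber game *)

Section Game.
Variables (V : finType) (H : hypergraph V).
Implicit Types (B D Rt U : {set V}) (x y z v : V) (e : {set V}).

Definition adjacent : rel V :=
  fun x y => [exists e in edges H, (x \in e) && (y \in e)].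

(** Vertices in no edge cannot be covered and need not occur in any bag, so the robber never starts
    there. *)
Definition active (x : V) : bool := [exists e in edges H, x \in e].

(** If [x] lies in [B] this is [x] alone; the positions of interest have [x] outside [B]. *)
Definition component (B : {set V}) (x : V) : {set V} :=
  [set z | connect (within adjacent (~: B)) x z].

Definition border (B : {set V}) (x : V) : {set V} :=
  [set y in B | [exists z in component B x, adjacent z y]].

(* The cops occupy B, the robber is in the component of x in the complement of
   B; the cops may move to B' if B' guards the border of that component. *)
Inductive cops_win (F : {set V} -> Prop) : {set V} -> V -> Prop :=
  CopsWin B x B' : F B' -> border B x \subset B' ->
    (forall z, z \in component B x -> z \notin B' -> cops_win F B' z) ->
  cops_win F B x.

Lemma adjacent_sym : symmetric adjacent.
Proof.
by move=> x y; apply/exists_inP/exists_inP => -[e eH]; rewrite andbC => h; exists e.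
Qed.

Lemma adjacentP x y :
  reflect (exists e, [/\ e \in edges H, x \in e & y \in e]) (adjacent x y).
Proof.
apply: (iffP exists_inP) => [[e eH /andP[xe ye]]|[e [eH xe ye]]]; exists e => //.
by rewrite xe.
Qed.

Lemma component_refl B x : x \in component B x.
Proof. by rewrite inE connect0. Qed.

Lemma component_step B x a b : a \in component B x -> a \notin B -> b \notin B ->
  adjacent a b -> b \in component B x.
Proof.
rewrite !inE => xa aB bB ab; apply: connect_trans xa (connect1 _).
by rewrite /within !inE aB bB.
Qed.

Lemma component_ind B x (P : V -> Prop) : P x ->
    (forall a b, a \in component B x -> P a -> a \notin B -> b \notin B ->
      adjacent a b -> P b) ->
  forall z, z \in component B x -> P z.
Proof.
move=> Px step z; rewrite inE => /connectP[p pP ->] {z}.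
have : x \in component B x by rewrite inE connect0.
move: pP Px; move: {1 2 3 5}x => a; elim: p a => [|b p IH] a //= /andP[/and3P[+ + ab] pP] Pa aC.
rewrite !inE => aB bB; apply: IH => //; first exact: step Pa aB bB ab.
by move: aC; rewrite !inE => xa; apply: connect_trans xa (connect1 _); rewrite /within !inE aB bB.
Qed.

Lemma component_disjoint B x z : x \notin B -> z \in component B x -> z \notin B.
Proof. by move=> xB; apply: (@component_ind B x (fun z => z \notin B)). Qed.

Lemma component_eq B x z : z \in component B x -> component B z = component B x.
Proof.
rewrite inE => xz; apply/setP => y; rewrite !inE.
rewrite (same_connect _ xz)//; apply: sym_connect_sym.
exact: within_sym adjacent_sym.
Qed.

Lemma component_active B x z : active x -> z \in component B x -> active z.
Proof.
move=> xa; apply: (@component_ind B x active) => // a b _ _ _ _ /adjacentP[e [eH _ be]].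
by apply/exists_inP; exists e.
Qed.

Lemma component_border B x a b : x \notin B -> a \in component B x ->
  adjacent a b -> b \in component B x :|: border B x.
Proof.
move=> xB aC ab; rewrite in_setU; have [bB|bB] := boolP (b \in B).
  by apply/orP; right; rewrite inE bB; apply/exists_inP; exists a.
by rewrite (component_step aC (component_disjoint xB aC) bB ab).
Qed.

Lemma component_sub B B' x z : x \notin B -> border B x \subset B' ->
  z \in component B x -> z \notin B' -> component B' z \subset component B x.
Proof.
move=> xB NB' zC zB'; apply/subsetP; apply: (@component_ind B' z (fun y => y \in component B x)) => // a b _ aC aB' bB' ab.
have := component_border xB aC ab; rewrite in_setU => /orP[//|/(subsetP NB')].
by rewrite (negPf bB').
Qed.

(** * From tree decompositions to strategies *)

Section Completeness.
Variables (T : finType) (adj : rel T) (B : T -> {set V}) (F : {set V} -> Prop).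
Hypotheses (tdB : tree_decomposition H adj B) (BF : forall u, F (B u)).

Let nodes (D : {set V}) x := [set u | B u :&: component D x != set0].

Let nodesP D x u : reflect (exists2 z, z \in B u & z \in component D x) (u \in nodes D x).
Proof.
rewrite inE; apply: (iffP (set0Pn _)) => [[z /setIP[]]|[z zB zC]]; exists z => //.
by rewrite inE zB.
Qed.

Let has_bag x : active x -> exists u, x \in B u.
Proof.
have [_ cover _] := tdB.
by move=> /exists_inP[e /cover[u eu] xe]; exists u; exact: (subsetP eu).
Qed.

(** Adjacent vertices of the component share an edge, hence a bag, so the connected node sets of its
    vertices overlap along paths. *)
Lemma nodes_connected D x : active x -> connected_in adj (nodes D x).
Proof.
move=> /has_bag[r xr]; have [[_ sym _ _ _] cover conn] := tdB.
have step z : z \in component D x -> [set u | z \in B u] \subset nodes D x.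
  by move=> zC; apply/subsetP => u; rewrite inE => zB; apply/nodesP; exists z.
have rP : forall z, z \in component D x -> forall u, z \in B u ->
    connect (within adj (nodes D x)) r u.
  apply: (@component_ind D x (fun z => forall u, z \in B u -> connect _ r u)) => [u xu|a b aC IH aD bD ab u bu].
    apply: (sub_within (step x (component_refl _ _))).
    by apply: conn; rewrite inE.
  have /adjacentP[e [eH ae be]] := ab; have [w ew] := cover e eH.
  apply: connect_trans (IH w (subsetP ew _ ae)) _.
  apply: (sub_within (step b (component_step aC aD bD ab))).
  by apply: conn; rewrite inE// (subsetP ew).
move=> u1 u2 /nodesP[z1 /rP h1 /h1 r1] /nodesP[z2 /rP h2 /h2 r2].
apply: connect_trans r2; rewrite sym_connect_sym//; exact: within_sym.
Qed.

(** From [B u] the cops move to the gate of [u] into the subtree of nodes whose bags meet the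
    robber's component. A border vertex lies in [B u] and, through a shared edge, in some bag of
    that subtree, hence in the bag of the gate. The gate then drops out of the subtree, which
    shrinks. *)
Lemma cops_win_of_nodes n D x : (#|nodes D x| <= n)%N -> active x -> x \notin D ->
  D = set0 \/ (exists u, D = B u) -> cops_win F D x.
Proof.
elim: n D x => [|n IH] D x Dn xact xD Dpos; have [u0 xu0] := has_bag xact;
    have u0D : u0 \in nodes D x by apply/nodesP; exists x => //; exact: component_refl.
  by move: Dn; rewrite leqn0 cards_eq0 => /eqP D0; rewrite D0 inE in u0D.
have [tree cover conn] := tdB.
have [g gD border_g] : exists2 g, g \in nodes D x & border D x \subset B g.
  case: Dpos => [->|[u Du]].
    exists u0; first by apply/nodesP; exists x => //; exact: component_refl.
    by apply/subsetP => y; rewrite !inE.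
  have [|g gD gP] := tree_gate tree u (@nodes_connected D x xact).
    by apply/set0Pn; exists u0.
  exists g => //; apply/subsetP => y; rewrite inE => /andP[yD /exists_inP[z zC]].
  move=> /adjacentP[e [eH ze ye]]; have [w ew] := cover e eH.
  have := gP _ (conn y) _ w; rewrite !inE; apply.
  - by rewrite -Du.
  - exact: (subsetP ew).
  - by apply/set0Pn; exists z; rewrite inE (subsetP ew).
apply: (CopsWin (BF g) border_g) => z zC zg.
apply: IH => //; last by right; exists g.
  rewrite -ltnS; apply: leq_trans Dn; apply: proper_card.
  apply/properP; split; last first.
    exists g => //; apply/nodesP => -[y yg yC].
    by have := component_disjoint zg yC; rewrite yg.
  apply/subsetP => u /nodesP[y yu yC]; apply/nodesP; exists y => //.
  exact: (subsetP (component_sub xD border_g zC zg)).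
exact: component_active zC.
Qed.

Lemma cops_win_of_tree x : active x -> cops_win F set0 x.
Proof.
move=> xact; apply: (cops_win_of_nodes (leqnn _)) => //; first by rewrite inE.
by left.
Qed.

End Completeness.

(** * From strategies to tree decompositions *)

Section Soundness.
Variable P : {set V} -> Prop.

Definition parent_rel (T : finType) (r : T) (p : T -> T) : rel T :=
  [rel s t | ((s != r) && (p s == t)) || ((t != r) && (p t == s))].

(** The tree is a parent function with a decreasing rank, so that gluing never has to reprove
    acyclicity; [parent_tree] is applied once at the end. *)
Definition rooted_td (Rt U : {set V}) (E : {set V} -> Prop) : Prop :=
  exists (T : finType) (r : T) (p : T -> T) (rank : T -> nat) (B : T -> {set V}),
  [/\ forall t, t != r -> (rank (p t) < rank t)%N,
      B r = Rt, forall u, P (B u) /\ B u \subset U,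
      forall e, e \in edges H -> E e -> exists u, e \subset B u
    & forall v, connected_in (parent_rel r p) [set u | v \in B u]].

Lemma rooted_td_single Rt : P Rt -> rooted_td Rt Rt (fun e => e \subset Rt).
Proof.
move=> PRt; exists unit, tt, id, (fun=> 0%N), (fun=> Rt); split=> //.
by move=> v; case; case=> _ _; exact: connect0.
Qed.

Lemma rooted_td_weak Rt U U' (E E' : {set V} -> Prop) : U \subset U' ->
  (forall e, e \in edges H -> E' e -> E e) -> rooted_td Rt U E -> rooted_td Rt U' E'.
Proof.
move=> UU' EE' [T [r [p [rank [B [h1 h2 h3 h4 h5]]]]]].
exists T, r, p, rank, B; split=> //.
  by move=> u; have [? uU] := h3 u; split=> //; exact: fintype.subset_trans UU'.
by move=> e eH /(EE' e eH)/h4; apply.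
Qed.

Lemma connect_map (T T' : finType) (e : rel T) (e' : rel T') (f : T -> T') (x y : T) :
    (forall a b, e a b -> e' (f a) (f b)) ->
  connect e x y -> connect e' (f x) (f y).
Proof.
move=> ee' /connectP[p pP ->] {y}; elim: p x pP => [|b p IH] a /=.
  by rewrite connect0.
by move=> /andP[/ee'/connect1 ab /IH]; exact: connect_trans.
Qed.

(** The second root becomes a child of the first; a vertex occurring on both sides stays connected
    because it lies in both roots. *)
Lemma rooted_td_glue R1 U1 E1 R2 U2 E2 : rooted_td R1 U1 E1 -> rooted_td R2 U2 E2 ->
    U1 :&: U2 \subset R1 :&: R2 ->
  rooted_td R1 (U1 :|: U2) (fun e => E1 e \/ E2 e).
Proof.
move=> [T1 [r1 [p1 [rank1 [B1 [h1 hr1 hB1 hE1 hc1]]]]]].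
move=> [T2 [r2 [p2 [rank2 [B2 [h2 hr2 hB2 hE2 hc2]]]]]] U12.
pose r : T1 + T2 := inl r1.
pose p (x : T1 + T2) : T1 + T2 := match x with
  | inl x => inl (p1 x) | inr y => if y == r2 then inl r1 else inr (p2 y) end.
pose rank (x : T1 + T2) := match x with
  | inl x => rank1 x | inr y => (rank1 r1 + rank2 y).+1 end.
pose B (x : T1 + T2) := match x with inl x => B1 x | inr y => B2 y end.
exists (T1 + T2)%type, r, p, rank, B; split.
- case=> [x|y] /= xr; first by apply: h1; apply: contraNneq xr => ->.
  have [_|yr] := eqVneq y r2; first by rewrite ltnS leq_addr.
  by rewrite ltnS ltn_add2l h2.
- by [].
- case=> [x|y] /=.
    by have [? xU] := hB1 x; split=> //; exact: fintype.subset_trans xU (finset.subsetUl _ _).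
  by have [? yU] := hB2 y; split=> //; exact: fintype.subset_trans yU (finset.subsetUr _ _).
- move=> e eH [/(hE1 e eH)[u eu]|/(hE2 e eH)[u eu]]; first by exists (inl u).
  by exists (inr u).
move=> v.
set S := [set u | v \in B u].
have inlP (x y : T1) : v \in B1 x -> v \in B1 y ->
    connect (within (parent_rel r p) S) (inl x) (inl y).
  move=> vx vy; have := hc1 v x y; rewrite !inE => /(_ vx vy).
  apply: connect_map => a b /and3P[]; rewrite !inE => va vb ab.
  by rewrite /within !inE /= va vb.
have inrP (x y : T2) : v \in B2 x -> v \in B2 y ->
    connect (within (parent_rel r p) S) (inr x) (inr y).
  move=> vx vy; have := hc2 v x y; rewrite !inE => /(_ vx vy).
  apply: connect_map => a b /and3P[]; rewrite !inE => va vb.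
  rewrite /within !inE /= va vb /= => /orP[|] /andP[/negPf ar /eqP <-].
    by rewrite /parent_rel /= ar eqxx.
  by rewrite /parent_rel /= ar eqxx orbT.
have crossP (x : T1) (y : T2) : v \in B1 x -> v \in B2 y ->
    connect (within (parent_rel r p) S) (inl x) (inr y).
  move=> vx vy; have /(subsetP U12)/setIP[vR1 vR2] : v \in U1 :&: U2.
    by rewrite inE (subsetP (hB1 x).2)// (subsetP (hB2 y).2).
  apply: connect_trans (inlP x r1 vx _) _; first by rewrite hr1.
  apply: connect_trans (inrP r2 y _ vy); last by rewrite hr2.
  by apply: connect1; rewrite /within !inE /= hr1 vR1 hr2 vR2 /parent_rel /= !eqxx.
have wsym : symmetric (within (parent_rel r p) S).
  by apply: within_sym => a b; rewrite /parent_rel /= orbC.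
move=> [x|x] [y|y]; rewrite ![_ \in S]inE /= => vx vy.
- exact: inlP.
- exact: crossP.
- by have := crossP y x vy vx; rewrite sym_connect_sym.
- exact: inrP.
Qed.

(** One subtree is hung below [Rt] per component; a [z] in a component already treated is skipped.
    Distinct components are disjoint, so a new subtree shares only border vertices with the rest,
    and these lie in [Rt]. *)
Lemma rooted_td_assemble B Rt (zs : seq V) : P Rt -> Rt \subset B ->
    (forall z, z \in zs -> z \notin B /\ border B z \subset Rt /\
      exists2 Rz : {set V}, border B z \subset Rz &
        rooted_td Rz (component B z :|: border B z)
          (fun e => ~~ [disjoint e & component B z])) ->
  rooted_td Rt (Rt :|: \bigcup_(z <- zs) component B z)
    (fun e => e \subset Rt \/ exists2 z, z \in zs & ~~ [disjoint e & component B z]).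
Proof.
move=> PRt RtB; elim: zs => [_|z zs IH zsP].
  rewrite big_nil finset.setU0; apply: rooted_td_weak (rooted_td_single PRt) => //.
  by move=> e _ [//|[]].
have {}IH := IH (fun y yzs => zsP y (mem_behead (s := z :: zs) yzs)).
have [zB [NRt [Rz NRz tdz]]] := zsP z (mem_head _ _).
have [|zNzs] := boolP (z \in \bigcup_(z <- zs) component B z).
  rewrite mem_bigcup_seq => /hasP[y yzs zy].
  apply: rooted_td_weak IH.
    by apply: finset.setUS; rewrite big_cons finset.subsetUr.
  move=> e eH [?|[y' + ey']]; first by left.
  rewrite inE => /orP[/eqP y'z|y'zs]; right; last by exists y'.
  by exists y => //; rewrite -(component_eq zy) -y'z.
apply: rooted_td_weak (rooted_td_glue IH tdz _).
- rewrite big_cons !subUset; apply/andP; split; apply/andP; split; first exact: finset.subsetUl.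
  + by rewrite finset.setUA finset.subsetUr.
  + by rewrite finset.setUCA finset.subsetUl.
  + by apply: fintype.subset_trans NRt (finset.subsetUl _ _).
- move=> e eH [?|[y + ey]]; first by left; left.
  rewrite inE => /orP[/eqP yz|yzs]; first by right; rewrite -yz.
  by left; right; exists y.
- apply/subsetP => v /setIP[vU]; rewrite inE => /orP[vC|vN]; last first.
    by rewrite inE (subsetP NRt)// (subsetP NRz).
  have vB := component_disjoint zB vC.
  move: vU; rewrite inE => /orP[/(subsetP RtB)|]; first by rewrite (negPf vB).
  rewrite mem_bigcup_seq => /hasP[y yzs vy]; case/negP: zNzs.
  rewrite mem_bigcup_seq; apply/hasP; exists y => //.
  by rewrite -(component_eq vy) (component_eq vC) component_refl.
Qed.

Variable F : {set V} -> Prop.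
Hypothesis FP : forall B B', F B -> B' \subset B -> P B'.

(** The root bag is [B'] cut down to the robber's component and its border, since other vertices of
    [B'] could reappear elsewhere in the tree and break connectedness. This is why the width
    condition has to pass to subsets, as [FP] says. *)
Lemma rooted_td_of_win B x : cops_win F B x -> x \notin B ->
  exists2 Rt : {set V}, border B x \subset Rt &
    rooted_td Rt (component B x :|: border B x)
      (fun e => ~~ [disjoint e & component B x]).
Proof.
elim=> {}B {}x B' FB' NB' _ IH xB.
pose Rt := B' :&: (component B x :|: border B x).
pose zs := enum (component B x :\: B').
have zsP z : z \in zs -> z \in component B x /\ z \notin B'.
  by rewrite mem_enum inE => /andP[].
exists Rt; first by rewrite finset.subsetI NB' finset.subsetUr.
apply: rooted_td_weak (rooted_td_assemble (B := B') (Rt := Rt) (zs := zs) _ _ _).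
- rewrite subUset finset.subsetIr; apply/subsetP => v; rewrite mem_bigcup_seq.
  move=> /hasP[z /zsP[zC zB'] /(subsetP (component_sub xB NB' zC zB')) vC].
  by rewrite inE vC.
- move=> e eH; rewrite -setI_eq0 => /set0Pn[a /setIP[ae aC]].
  have eU b : b \in e -> b \in component B x :|: border B x.
    by move=> be; apply: component_border aC _ => //; apply/adjacentP; exists e.
  have [eB'|/subsetPn[b be bB']] := boolP (e \subset B').
    left; rewrite finset.subsetI eB'; exact/subsetP.
  have bC : b \in component B x.
    by have := eU b be; rewrite inE => /orP[//|/(subsetP NB')]; rewrite (negPf bB').
  right; exists b; first by rewrite mem_enum inE bB'.
  by rewrite -setI_eq0; apply/set0Pn; exists b; rewrite inE be component_refl.
- exact: FP FB' (finset.subsetIl _ _).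
- exact: finset.subsetIl.
move=> z /zsP[zC zB']; split=> //; split; last exact: IH.
apply/subsetP => y; rewrite inE => /andP[yB' /exists_inP[a aCz ay]].
rewrite inE yB'; apply: component_border ay => //.
exact: (subsetP (component_sub xB NB' zC zB')).
Qed.

Lemma tree_of_cops_win : P set0 -> (forall x, active x -> cops_win F set0 x) ->
  exists (T : finType) (adj : rel T) (B : T -> {set V}),
    tree_decomposition H adj B /\ forall u, P (B u).
Proof.
move=> P0 win.
have [||T [r [p [rank [B [h1 h2 h3 h4 h5]]]]]] :=
  rooted_td_assemble (B := set0) (Rt := set0) (zs := enum active) P0.
- exact: sub0set.
- move=> x; rewrite mem_enum => xact; have x0 : x \notin set0 by rewrite inE.
  split=> //; split; first by apply/subsetP => y; rewrite !inE.
  exact: rooted_td_of_win (win x xact) x0.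
exists T, (parent_rel r p), B; split; last by move=> u; case: (h3 u).
split=> //; first exact: parent_tree h1.
move=> e eH; apply: h4 => //.
have [e0|[x xe]] := set_0Vmem e; first by move: eH; rewrite e0 (negPf (edges_neq0 H)).
right; exists x; first by rewrite mem_enum; apply/exists_inP; exists e.
by rewrite -setI_eq0; apply/set0Pn; exists x; rewrite inE xe component_refl.
Qed.

End Soundness.
End Game.

(** * Fractional hypertree width as a game *)

Section FhwGame.
Variables (R : realType) (k : R).

(** The infimum is attained: if every decomposition had a bag exceeding [k], then [mn], the least of
    the finitely many values of [rho_star] above [k], would bound the width from below. *)
Lemma fhw_leP (V : finType) (H : hypergraph V) : (fhw R H <= k%:E)%E <->
  exists (T : finType) (adj : rel T) (B : T -> {set V}),
    tree_decomposition H adj B /\ forall u, covered k H (B u).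
Proof.
split=> [fhw_le|[T [adj [B [tdB cov]]]]]; last first.
  apply: ge_ereal_inf; exists (\big[maxe/-oo%E]_(u : T) rho_star R H (B u)).
    by exists T, adj, B.
  by apply/bigmax_leP; split=> [|u _]; [exact: leNye | exact/rho_star_leP/cov].
apply: contrapT => noTD.
pose mn := \big[Order.min/+oo%E]_(X : {set V} | (k%:E < rho_star R H X)%E) rho_star R H X.
have mn_gt : (k%:E < mn)%E by rewrite /mn lt_bigmin ?ltry.
have : (mn <= fhw R H)%E.
  apply: le_ereal_inf_tmp => _ [T [adj [B [tdB ->]]]].
  have [u ku] : exists u, (k%:E < rho_star R H (B u))%E.
    apply: contrapT => nou; apply: noTD; exists T, adj, B; split=> // u.
    apply/rho_star_leP; rewrite leNgt; apply/negP => ku; apply: nou; by exists u.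
  apply: le_trans (le_bigmax _ _ u).
  exact: bigmin_le_cond.
by move=> /(lt_le_trans mn_gt)/lt_le_trans/(_ fhw_le); rewrite ltxx.
Qed.

(** [F] may be any family of covered sets containing the basic ones, which leaves freedom in naming
    bags. [covered k H set0] amounts to [0 <= k] and matters when no vertex is active. *)
Lemma fhw_le_cops_win (c d : nat) : (0 < c)%N -> exists m l,
  forall (V : finType) (H : hypergraph V) (F : {set V} -> Prop), cd_hypergraph c d H ->
    (forall B, covered k H B -> basic_set H c m l B -> F B) ->
    (forall B, F B -> covered k H B) ->
  (fhw R H <= k%:E)%E <-> covered k H set0 /\ forall x, active H x -> cops_win H F set0 x.
Proof.
move=> c0; have [m [l normal]] := normal_bags k d c0.
exists m, l => V H F cdH toF ofF; rewrite fhw_leP; split.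
  move=> [T [adj [B0 [tdB0 cov0]]]]; have [[/card_gt0P[u _] _ _ _ _] _ _] := tdB0.
  split; first by apply: covered_sub (cov0 u); exact: sub0set.
  have [B [tdB BP]] := normal V H T adj B0 cdH tdB0 cov0.
  by move=> x; apply: (cops_win_of_tree tdB) => v; case: (BP v); exact: toF.
move=> [cov0 win]; apply: (tree_of_cops_win (F := F)) => //.
by move=> B B' /ofF covB B'B; exact: covered_sub covB.
Qed.

End FhwGame.
(** * Programs *)

Arguments update : simpl never.

Section Machine.
Local Open Scope nat_scope.

Definition mem := nat -> nat.
(* A fragment is given by its position in the program, on which its jump targets depend. *)
Definition code := nat -> seq instr.

(** Quantifying over the remaining time [n] makes executions compose by addition and carries the
    final answer back to the start. *)
Definition exec (P : seq instr) (t : nat) (s s' : config) : Prop :=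
  forall n, run P (t + n) s = run P n s'.

Definition placed (P : seq instr) (p : nat) (c : seq instr) : Prop :=
  exists pre post, P = pre ++ c ++ post /\ size pre = p.

Definition computes (c : code) (t : nat) (X X' : mem) : Prop :=
  forall P p w, placed P p (c p) -> exists2 t', t' <= t &
    exec P t' (Config p X w) (Config (p + size (c p)) X' w).

Definition is_halt (a : instr) := if a is Halt _ then true else false.
Definition straight (a : instr) :=
  match a with Halt _ | Jpos _ _ | Read _ => false | _ => true end.

Definition effect (X : mem) (a : instr) : mem := registers (step a (Config 0 X [::])).

Definition cseq (c1 c2 : code) : code := fun p => c1 p ++ c2 (p + size (c1 p)).
Definition cline (s : seq instr) : code := fun=> s.

Lemma placed_cat P p c1 c2 : placed P p (c1 ++ c2) ->
  placed P p c1 /\ placed P (p + size c1) c2.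
Proof.
move=> [pre [post [-> <-]]]; split; first by exists pre, (c2 ++ post); rewrite -catA.
by exists (pre ++ c1), post; rewrite !catA size_cat.
Qed.

Lemma placed_onth P p a c : placed P p (a :: c) -> onth P p = Some a.
Proof.
by move=> [pre [post [-> <-]]]; rewrite onth_cat ltnn subnn.
Qed.

Lemma placed_cons P p a c : placed P p (a :: c) -> onth P p = Some a /\ placed P p.+1 c.
Proof.
move=> h; split; first exact: placed_onth h.
by move: h => /(@placed_cat P p [:: a])[_]; rewrite addn1.
Qed.

Lemma exec_trans P t1 t2 s1 s2 s3 : exec P t1 s1 s2 -> exec P t2 s2 s3 ->
  exec P (t1 + t2) s1 s3.
Proof. by move=> h1 h2 n; rewrite -addnA h1 h2. Qed.

Lemma exec_step P p a X w : onth P p = Some a -> ~~ is_halt a ->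
  exec P 1 (Config p X w) (step a (Config p X w)).
Proof. by move=> h ha n; rewrite add1n /= h; case: a ha {h}. Qed.

Lemma computes_weak c t t' X X' : t <= t' -> computes c t X X' -> computes c t' X X'.
Proof. by move=> tt' h P p w /(h _ _ w)[t0 t0t ?]; exists t0; rewrite ?(leq_trans t0t). Qed.

Lemma computes_seq c1 c2 t1 t2 X1 X2 X3 : computes c1 t1 X1 X2 -> computes c2 t2 X2 X3 ->
  computes (cseq c1 c2) (t1 + t2) X1 X3.
Proof.
move=> h1 h2 P p w /placed_cat[/(h1 _ _ w)[t1' t1t e1] /(h2 _ _ w)[t2' t2t e2]].
exists (t1' + t2'); first exact: leq_add.
by rewrite /cseq size_cat addnA; exact: exec_trans e1 e2.
Qed.

Lemma computes_line s X : all straight s ->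
  computes (cline s) (size s) X (foldl effect X s).
Proof.
rewrite /computes /cline => ss P p w ps; exists (size s) => //.
elim: s p X ss ps => [|a s IH] p X /=; first by rewrite addn0.
move=> /andP[sa ss] /placed_cons[pa ps].
have ha : ~~ is_halt a by case: (a) sa.
rewrite -add1n; apply: exec_trans (exec_step X w pa ha) _.
rewrite addnS -addSn (_ : step a (Config p X w) = Config p.+1 (effect X a) w).
  exact: IH.
by case: (a) sa.
Qed.

(* The address modulo 8 is 0 for the variables of formulas, 1 for results of
   subformulas, 2 for constants and temporaries, 3 for the bits of the
   incidence matrix, and 4 and 5 for the two tables. *)
Definition adr (cl j : nat) := j * 8 + cl.
Notation var := (adr 0).
Notation res := (adr 1).
Notation ONE := (adr 2 0).
Notation NN := (adr 2 1).
Notation NV := (adr 2 2).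
Notation LT := (adr 2 3).
Notation ACC := (adr 2 4).
Notation CTR := (adr 2 5).
Notation TMP := (adr 2 6).

(** [Jpos ONE] is an unconditional jump, as [ONE] holds 1; truncated subtraction makes [LT] positive
    exactly while [x] is below [y]. The test stands at [p + 1], the body at [p + 4]. *)
Definition cfor (x y : nat) (c : code) : code := fun p =>
  [:: Const x 0; Defs.Sub LT y x; Jpos LT (p + 4); Jpos ONE (p + 4 + size (c (p + 4)) + 2)]
  ++ c (p + 4) ++ [:: Add x x ONE; Jpos ONE (p + 1)].

Lemma update_eq X i m : update X i m i = m.
Proof. by rewrite /update eqxx. Qed.

Lemma update_neq X i m j : j != i -> update X i m j = X j.
Proof. by rewrite /update => /negPf->. Qed.

(** [Keep j] is the loop invariant at counter [j]; it must not depend on [LT], which the test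
    overwrites. An iteration costs the body and four steps; entry and exit cost four more. *)
Lemma computes_for (x y : nat) (c : code) (t n : nat) (Keep : nat -> mem -> Prop) (X : mem) :
    uniq [:: x; y; LT; ONE] -> X y = n -> X ONE = 1 -> Keep 0 (update X x 0) ->
    (forall j Y v, Keep j Y -> Keep j (update Y LT v)) ->
    (forall j Y, j < n -> Y x = j -> Y y = n -> Y ONE = 1 -> Keep j Y ->
      exists Y', [/\ computes c t Y Y', Y' x = j, Y' y = n, Y' ONE = 1 &
        Keep j.+1 (update Y' x j.+1)]) ->
  exists X', [/\ computes (cfor x y c) (n * (t + 4) + 4) X X', Keep n X' & X' ONE = 1].
Proof.
rewrite /= !inE !negb_or !andbT => /andP[/and3P[xy xL xO] /andP[yL yO]] Xy X1 Inv0 InvL step.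
have LO : LT != ONE by [].
have loop m j Y : j + m = n -> Y x = j -> Y y = n -> Y ONE = 1 -> Keep j Y ->
    exists Y', [/\ forall P p w, placed P p (cfor x y c p) ->
      exists2 t', t' <= m * (t + 4) + 3 &
        exec P t' (Config p.+1 Y w) (Config (p + size (cfor x y c p)) Y' w),
      Keep n Y' & Y' ONE = 1].
  have test P p w Z : placed P p (cfor x y c p) ->
      exec P 1 (Config p.+1 Z w) (Config p.+2 (update Z LT (Z y - Z x)) w).
    by move=> /placed_cons[_ /placed_cons[i1 _]]; exact: (exec_step Z w i1 isT).
  elim: m j Y => [|m IH] j Y jn Yx Yy Y1 InvY.
    exists (update Y LT 0); split; [|by rewrite -jn addn0 in InvY *; exact: InvL|
      by rewrite update_neq// eq_sym].
    move=> P p w pl.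
    exists (1 + (1 + 1)) => //; apply: exec_trans (test _ _ _ _ pl) _.
    rewrite Yx Yy -jn addn0 subnn.
    have [_ /placed_cons[_ /placed_cons[i2 /placed_cons[i3 _]]]] := placed_cons pl.
    apply: exec_trans; first exact: (exec_step _ w i2 isT).
    rewrite /= ?update_eq ?ltnn.
    have := exec_step (update Y LT 0) w i3 isT.
    rewrite /= update_neq ?Y1 1?eq_sym//= !size_cat /=.
    by congr (exec _ _ _ (Config _ _ _)); lia.
  have jn' : j < n by rewrite -jn; lia.
  have [| | | | Y1' [comp Y1x Y1y Y1O Inv1]] := step j (update Y LT (n - j)) jn'.
  - by rewrite update_neq// eq_sym.
  - by rewrite update_neq// eq_sym.
  - by rewrite update_neq// eq_sym.
  - exact: InvL.
  have [| | | | | Y2 [loop2 Inv2 Y2O]] := IH j.+1 (update Y1' x j.+1).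
  - by rewrite addSnnS.
  - by rewrite update_eq.
  - by rewrite update_neq// eq_sym.
  - by rewrite update_neq// eq_sym.
  - exact: Inv1.
  exists Y2; split=> // P p w pl.
  have [t2 t2le e2] := loop2 P p w pl.
  have [_ /placed_cons[_ /placed_cons[i2 /placed_cons[_]]]] := placed_cons pl.
  rewrite -(addn4 p) => /placed_cat[body].
  have [t1 t1le e1] := comp P _ w body.
  move=> /placed_cons[i4 /placed_cons[i5 _]].
  exists (1 + (1 + (t1 + (1 + (1 + t2))))); first by lia.
  rewrite -addn1; apply: exec_trans; first by rewrite addn1; exact: test pl.
  rewrite Yx Yy.
  apply: exec_trans; first exact: (exec_step _ w i2 isT).
  rewrite /= ?update_eq subn_gt0 jn'.
  apply: exec_trans e1 _.
  apply: exec_trans; first exact: (exec_step Y1' w i4 isT).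
  rewrite /= Y1x Y1O (addn1 j).
  apply: exec_trans; first exact: (exec_step (update Y1' x j.+1) w i5 isT).
  have O_neq : ONE != x by rewrite eq_sym.
  by rewrite -(addn1 p) in e2; rewrite /= update_neq// Y1O.
have [| | | | | X' [comp InvX' X'O]] := loop n 0 (update X x 0).
- by [].
- by rewrite update_eq.
- by rewrite update_neq// eq_sym.
- by rewrite update_neq// eq_sym.
- exact: Inv0.
exists X'; split=> // P p w pl; have [t' t'le e'] := comp P p w pl.
exists (1 + t'); first by lia.
apply: exec_trans e'; have [i0 _] := placed_cons pl.
exact: (exec_step X w i0 isT).
Qed.


Lemma adr_eq cl cl' i j : cl < 8 -> cl' < 8 ->
  (adr cl i == adr cl' j) = (cl == cl') && (i == j).
Proof. rewrite /adr => ? ?; apply/eqP/andP => [?|[/eqP-> /eqP->]//]; split; apply/eqP; lia. Qed.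

Definition scratch (a : nat) := (a %% 8 == 2) && (adr 2 3 <= a).

Lemma scratch_adr cl j : cl < 8 -> scratch (adr cl j) = (cl == 2) && (3 <= j).
Proof.
move=> cl8; rewrite /scratch /adr modnMDl modn_small//; case: (cl =P 2) => [->|//] /=.
by apply/idP/idP; lia.
Qed.

(* The registers preserved by code that owns the variables from n on, the
   results from k on and the temporaries. *)
Definition keep (n k a : nat) :=
  [&& ~~ scratch a, ~~ ((a %% 8 == 0) && (var n <= a)) & ~~ ((a %% 8 == 1) && (res k <= a))].

Lemma keep_adr n k cl j : cl < 8 -> keep n k (adr cl j) =
  [&& ~~ ((cl == 2) && (3 <= j)), ~~ ((cl == 0) && (n <= j)) & ~~ ((cl == 1) && (k <= j))].
Proof.
move=> cl8; rewrite /keep scratch_adr// /adr modnMDl modn_small//.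
have -> : (cl == 0) && (n * 8 + 0 <= j * 8 + cl) = (cl == 0) && (n <= j).
  by case: (cl =P 0) => [->|//] /=; apply/idP/idP; lia.
have -> // : (cl == 1) && (k * 8 + 1 <= j * 8 + cl) = (cl == 1) && (k <= j).
by case: (cl =P 1) => [->|//] /=; apply/idP/idP; lia.
Qed.

Definition frame (n k : nat) (X X' : mem) := forall a, keep n k a -> X' a = X a.

Lemma frame_scratch n k X X' : (forall a, ~~ scratch a -> X' a = X a) -> frame n k X X'.
Proof. by move=> h a /and3P[/h]. Qed.

Lemma keep_weak n k n' k' a : n <= n' -> k <= k' -> keep n k a -> keep n' k' a.
Proof.
move=> nn' kk' /and3P[h0 h1 h2]; apply/and3P; split=> //; [move: h1|move: h2];
  apply: contra => /andP[->] /=; rewrite /adr; lia.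
Qed.

Lemma frame_trans n k n' k' X Y Z : n <= n' -> k <= k' -> frame n k X Y ->
  frame n' k' Y Z -> frame n k X Z.
Proof. by move=> nn' kk' h h' a ka; rewrite h' ?h//; exact: keep_weak ka. Qed.

(** * First-order formulas and their evaluation *)

Definition idx (N : nat) (xs : seq nat) := foldl (fun acc x => acc * N + x) 0 xs.

(* Formulas in which a quantifier at nesting depth n binds the variable n. *)
Inductive fol :=
  | FInc of nat & nat
  | FEq of nat & nat
  | FRel of bool & seq nat
  | FNeg of fol
  | FAnd of fol & fol
  | FEx of fol.

(** Two relations: [false] will hold reachability and [true] the winning positions, with tuples
    addressed through [idx]. *)
Definition tables := bool -> nat -> bool.

Section Semantics.
Variables (N : nat) (inc : nat -> nat -> bool).

Fixpoint sat (tab : tables) (n : nat) (env : nat -> nat) (f : fol) : bool :=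
  match f with
  | FInc x y => inc (env x) (env y)
  | FEq x y => env x == env y
  | FRel a xs => tab a (idx N (map env xs))
  | FNeg f => ~~ sat tab n env f
  | FAnd f g => sat tab n env f && sat tab n env g
  | FEx f => has (fun i => sat tab n.+1 (update env n i) f) (iota 0 N)
  end.

End Semantics.

Fixpoint wf (n : nat) (f : fol) : bool :=
  match f with
  | FInc x y | FEq x y => (x < n) && (y < n)
  | FRel a xs => all (fun x => x < n) xs
  | FNeg f => wf n f
  | FAnd f g => wf n f && wf n g
  | FEx f => wf n.+1 f
  end.

Section Compile.
Variables (N nv : nat) (raw : nat -> bool).
Hypothesis nv_le : nv <= N.

(** Quantified values run beyond the number of vertices; the guard keeps them from reading bits of a
    later row. *)
Definition inc_of_raw (v e : nat) : bool := (v < nv) && raw (e * nv + v).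

Definition repr (tab : tables) (n : nat) (env : nat -> nat) (X : mem) : Prop :=
  [/\ X ONE = 1, X NN = N, X NV = nv &
  [/\ forall i, X (adr 3 i) = raw i, forall i, i < n -> X (var i) = env i
    & forall (a : bool) i, X (adr (4 + a) i) = tab a i]].

Lemma repr_frame tab n k env X X' : repr tab n env X -> frame n k X X' -> repr tab n env X'.
Proof.
move=> [h1 h2 h3 [h4 h5 h6]] fr; split; first by rewrite fr.
- by rewrite fr.
- by rewrite fr.
- split=> [i|i ilt|a i].
  + by rewrite fr// keep_adr.
  + by rewrite fr ?h5// keep_adr//= -ltnNge ilt.
  + by rewrite fr// keep_adr//; case: a.
Qed.

Definition cmul (d s y : nat) : code :=
  cseq (cline [:: Const d 0]) (cfor CTR y (cline [:: Add d d s])).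

Lemma cmul_spec d s y X : X ONE = 1 -> uniq [:: CTR; y; LT; ONE] ->
    d \notin [:: CTR; y; LT; ONE; s] -> s \notin [:: CTR; LT] -> X y <= N ->
  exists X', [/\ computes (cmul d s y) (N * 5 + 5) X X', X' d = X s * X y &
    forall a, a \notin [:: d; CTR; LT] -> X' a = X a].
Proof.
move=> X1 uy; rewrite !inE !negb_or => /and5P[dC dy dL dO ds] /andP[sC sL] yN.
have [yC yL yO] : [/\ y != CTR, y != LT & y != ONE].
  by split; apply: contraTneq uy => ->.
pose Keep j (Y : mem) := Y d = X s * j /\ forall a, a \notin [:: d; CTR; LT] -> Y a = X a.
have [| | | | | | X' [comp [Xd XF] _]] := @computes_for CTR y (cline [:: Add d d s]) 1 (X y) Keep (update X d 0).
- by [].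
- by rewrite update_neq// eq_sym.
- by rewrite update_neq// eq_sym.
- split; first by rewrite update_neq// update_eq muln0.
  by move=> a; rewrite !inE !negb_or => /and3P[ad aC aL]; rewrite !update_neq.
- move=> j Y v [h1 h2]; split; first by rewrite update_neq.
  move=> a aN; rewrite update_neq ?h2//.
  by move: aN; rewrite !inE !negb_or => /and3P[].
- move=> j Y jlt YC Yy YO [h1 h2]; exists (update Y d (Y d + Y s)); split.
  + exact: (computes_line (s := [:: Add d d s])).
  + by rewrite update_neq// eq_sym.
  + by rewrite update_neq// eq_sym.
  + by rewrite update_neq// eq_sym.
  split; first by rewrite update_neq// update_eq h1 h2 ?mulnS 1?addnC// !inE !negb_or sC sL eq_sym ds.
  move=> a aN; have := aN; rewrite !inE !negb_or => /and3P[ad aC _].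
  by rewrite !update_neq// h2.
exists X'; split=> //.
apply: computes_weak (computes_seq (computes_line (s := [:: Const d 0]) X isT) comp).
by rewrite /=; have := leq_mul yN (leqnn 5); lia.
Qed.

Definition chorner (xs : seq nat) : code :=
  foldl (fun c x => cseq c (cseq (cmul TMP ACC NN) (cline [:: Add ACC TMP (var x)])))
    (cline [:: Const ACC 0]) xs.

Lemma chorner_spec xs X : X ONE = 1 -> X NN = N ->
  exists X', [/\ computes (chorner xs) (size xs * (N * 5 + 6) + 1) X X',
    X' ACC = idx N [seq X (var x) | x <- xs] &
    forall a, ~~ scratch a -> X' a = X a].
Proof.
move=> X1 XN; elim/last_ind: xs => [|xs x [X' [comp XA XF]]].
  exists (update X ACC 0); split; rewrite ?update_eq//.
    exact: (computes_line (s := [:: Const ACC 0])).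
  by move=> a sa; rewrite update_neq//; apply: contraNneq sa => ->.
have [| | | | | X2 [comp2 X2T X2F]] := @cmul_spec TMP ACC NN X'.
- by rewrite XF.
- by [].
- by [].
- by [].
- by rewrite XF ?XN.
exists (update X2 ACC (X2 TMP + X2 (var x))); split.
- rewrite /chorner foldl_rcons size_rcons.
  apply: computes_weak (computes_seq comp (computes_seq comp2
    (computes_line (s := [:: Add ACC TMP (var x)]) X2 isT))).
  by rewrite /=; lia.
- rewrite update_eq X2T XA (X2F (var x)) ?XF ?scratch_adr// ?inE ?adr_eq//.
  by rewrite map_rcons /idx foldl_rcons ?XF ?XN ?scratch_adr.
- move=> a sa; rewrite update_neq; last by apply: contraNneq sa => ->.
  by rewrite X2F ?XF// !inE !negb_or; apply/and3P; split; apply: contraNneq sa => ->.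
Qed.

Definition target (a : instr) : option nat :=
  match a with
  | Const i _ | Add i _ _ | Defs.Sub i _ _ | Fetch i _ => Some i
  | _ => None
  end.

Lemma effect_target a i X j : target a = Some i -> j != i -> effect X a j = X j.
Proof. by case: a => //= [i0 m [->] | i0 j0 l [->] | i0 j0 l [->] | i0 j0 [->]] ji; rewrite /effect /= update_neq. Qed.

Lemma line_keeps (P : pred nat) s X :
    all (fun a => if target a is Some i then ~~ P i else false) s ->
  forall a, P a -> foldl effect X s a = X a.
Proof.
elim: s X => //= b s IH X /andP[+ hs] a Pa; rewrite IH//.
case tb: (target b) => [i|//] Pi; apply: effect_target tb _.
by apply: contraNneq Pi => <-.
Qed.

Definition caddr (cl : nat) : code := cline
  [:: Add ACC ACC ACC; Add ACC ACC ACC; Add ACC ACC ACC; Const TMP cl; Add ACC ACC TMP].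

Lemma caddr_spec cl X : exists X', [/\ computes (caddr cl) 5 X X',
  X' ACC = adr cl (X ACC) & forall a, ~~ scratch a -> X' a = X a].
Proof.
have h := computes_line (s := caddr cl 0) X isT; eexists; split; first exact: h.
  by rewrite /= /effect /= /update !adr_eq//= /adr; lia.
exact: (line_keeps (P := fun a => ~~ scratch a)).
Qed.

(** Truth values are 0 and 1, combined by truncated subtraction. For [FInc], [1 - (nv - x)] is 1
    exactly when [x] is out of range and cancels the bit fetched. [FEq] adds the two differences.
    [FEx] counts the witnesses, and two subtractions from 1 bring the count back to 0 or 1. *)
Fixpoint fcode (n k : nat) (f : fol) : code :=
  match f with
  | FInc x y => cseq (cseq (cmul ACC (var y) NV) (cline [:: Add ACC ACC (var x)]))
      (cseq (caddr 3) (cline [:: Fetch (res k) ACC; Defs.Sub TMP NV (var x);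
        Defs.Sub TMP ONE TMP; Defs.Sub (res k) (res k) TMP]))
  | FEq x y => cline [:: Defs.Sub TMP (var x) (var y); Defs.Sub ACC (var y) (var x);
      Add TMP TMP ACC; Defs.Sub (res k) ONE TMP]
  | FRel a xs => cseq (chorner xs) (cseq (caddr (4 + a)) (cline [:: Fetch (res k) ACC]))
  | FNeg f => cseq (fcode n k f) (cline [:: Defs.Sub (res k) ONE (res k)])
  | FAnd f g => cseq (fcode n k f) (cseq (fcode n k.+1 g)
      (cline [:: Add (res k) (res k) (res k.+1); Defs.Sub (res k) (res k) ONE]))
  | FEx f => cseq (cline [:: Const (res k) 0]) (cseq
      (cfor (var n) NN (cseq (fcode n.+1 k.+1 f) (cline [:: Add (res k) (res k) (res k.+1)])))
      (cline [:: Defs.Sub (res k) ONE (res k); Defs.Sub (res k) ONE (res k)]))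
  end.

Fixpoint ftime (f : fol) : nat :=
  match f with
  | FInc x y => N * 5 + 15
  | FEq x y => 4
  | FRel a xs => size xs * (N * 5 + 6) + 7
  | FNeg f => ftime f + 1
  | FAnd f g => ftime f + (ftime g + 2)
  | FEx f => N * (ftime f + 5) + 7
  end.

Notation satN := (sat N inc_of_raw).

Lemma repr_var tab n (env : nat -> nat) (X : mem) j : repr tab n env X -> X (var n) = j ->
  repr tab n.+1 (update env n j) X.
Proof.
move=> [h1 h2 h3 [h4 h5 h6]] Xn; split=> //; split=> // i.
rewrite ltnS leq_eqVlt /update; case: eqP => [->//|_] /=; exact: h5.
Qed.

Lemma keep_res n k m : k <= m -> keep n k (res m) = false.
Proof. by move=> km; rewrite keep_adr//= km. Qed.

Lemma keep_scratch n k m : 3 <= m -> keep n k (adr 2 m) = false.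
Proof. by move=> km; rewrite keep_adr//= km. Qed.

Lemma fcode_spec tab n k (env : nat -> nat) f (X : mem) : wf n f -> repr tab n env X ->
  exists X', [/\ computes (fcode n k f) (ftime f) X X',
    X' (res k) = satN tab n env f & frame n k X X'].
Proof.
elim: f n k env X => [x y|x y|a xs|f IH|f IHf g IHg|f IH] n k env X /=.
- move=> /andP[xn yn] rX; have [X1 XN XV [Xraw Xvar _]] := rX.
  have [| | | | | X2 [comp2 X2A X2F]] := @cmul_spec ACC (var y) NV X.
  + exact: X1.
  + by [].
  + by rewrite !inE !adr_eq.
  + by rewrite !inE !adr_eq.
  + by rewrite XV.
  have comp3 := computes_line (s := [:: Add ACC ACC (var x)]) X2 isT.
  set X3 := foldl _ _ _ in comp3.
  have [X4 [comp4 X4A X4F]] := caddr_spec 3 X3.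
  have comp5 := computes_line (s := [:: Fetch (res k) ACC; Defs.Sub TMP NV (var x);
        Defs.Sub TMP ONE TMP; Defs.Sub (res k) (res k) TMP]) X4 isT.
  have X3F a : ~~ scratch a -> X3 a = X a.
    move=> sa; rewrite /X3 (line_keeps (P := fun a => ~~ scratch a))// X2F//.
    by rewrite !inE !negb_or; apply/and3P; split; apply: contraNneq sa => ->.
  have X3A : X3 ACC = env y * nv + env x.
    by rewrite /X3 /= /effect /= update_eq X2A XV Xvar// X2F ?Xvar// !inE !adr_eq.
  eexists; split.
  + apply: computes_weak (computes_seq (computes_seq comp2 comp3) (computes_seq comp4 comp5)).
    by rewrite /=; lia.
  + rewrite /= /effect /= /update !adr_eq//= !eqxx /=.
    rewrite X4A X3A !X4F ?scratch_adr// !X3F ?scratch_adr// Xraw X1 XV Xvar//.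
    rewrite /inc_of_raw; case: (raw _); lia.
  + apply: (@frame_trans _ _ n k _ X4) => //.
      by apply: frame_scratch => a sa; rewrite X4F ?X3F.
    by move=> a; apply: line_keeps; rewrite /= keep_res// ?keep_scratch.
- move=> /andP[xn yn] [X1 _ _ [_ Xvar _]].
  have comp := computes_line (s := fcode n k (FEq x y) 0) X isT.
  eexists; split; first exact: comp.
    rewrite /= /effect /= /update !adr_eq//= X1 !Xvar// !eqxx.
    by case: (env x =P env y) => ?; rewrite /=; lia.
  by move=> a; apply: line_keeps; rewrite /= keep_res// ?keep_scratch.
- move=> xsn [X1 XN _ [_ Xvar Xtab]].
  have [X2 [comp2 X2A X2F]] := chorner_spec xs X1 XN.
  have [X3 [comp3 X3A X3F]] := caddr_spec (4 + a) X2.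
  have comp4 := computes_line (s := [:: Fetch (res k) ACC]) X3 isT.
  eexists; split.
  + apply: computes_weak (computes_seq comp2 (computes_seq comp3 comp4)).
    by rewrite /=; lia.
  + rewrite /= /effect /= update_eq X3A X3F ?scratch_adr//; last by case: (a).
    rewrite X2F ?scratch_adr//; last by case: (a).
    rewrite Xtab X2A; congr (nat_of_bool (tab _ (idx _ _))).
    by apply/eq_in_map => x /(allP xsn) /Xvar.
  + apply: (@frame_trans _ _ n k _ X3) => //.
      by apply: frame_scratch => b sb; rewrite X3F ?X2F.
    by move=> b; apply: line_keeps; rewrite /= keep_res// ?keep_scratch.
- move=> fn rX; have [X2 [comp2 X2r X2F]] := IH n k env X fn rX.
  have comp3 := computes_line (s := [:: Defs.Sub (res k) ONE (res k)]) X2 isT.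
  eexists; split; first exact: (computes_seq comp2 comp3).
    rewrite /= /effect /= update_eq X2r.
    have [-> _ _ _] := repr_frame rX X2F; by case: sat.
  apply: (@frame_trans _ _ n k _ X2) => //.
  by move=> b; apply: line_keeps; rewrite /= keep_res// ?keep_scratch.
- move=> /andP[fn gn] rX.
  have [X2 [comp2 X2r X2F]] := IHf n k env X fn rX.
  have rX2 := repr_frame rX X2F.
  have [X3 [comp3 X3r X3F]] := IHg n k.+1 env X2 gn rX2.
  have comp4 := computes_line
    (s := [:: Add (res k) (res k) (res k.+1); Defs.Sub (res k) (res k) ONE]) X3 isT.
  have X3F' : frame n k X X3 by apply: frame_trans X2F X3F.
  eexists; split; first exact: (computes_seq comp2 (computes_seq comp3 comp4)).
    rewrite /= /effect /= /update !adr_eq//= !eqxx /= X3r.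
    rewrite X3F ?X2r ?keep_adr//= ?ltnn//.
    by have [-> _ _ _] := repr_frame rX X3F'; do 2!case: sat.
  apply: (@frame_trans _ _ n k _ X3) => //.
  by move=> b; apply: line_keeps; rewrite /= keep_res// ?keep_scratch.
move=> fn rX; have [X1 XN _ _] := rX.
have comp0 := computes_line (s := [:: Const (res k) 0]) X isT.
set X0 := foldl _ _ _ in comp0.
have X0F : frame n k X X0 by move=> b; apply: line_keeps; rewrite /= keep_res// ?keep_scratch.
pose Keep j (Y : mem) := [/\ frame n k X Y, Y (var n) = j &
  Y (res k) = count (fun i => satN tab n.+1 (update env n i) f) (iota 0 j)].
have keepLT a : keep n k a -> a != LT.
  by move=> ka; apply: contraTneq ka => ->; rewrite keep_adr.
have keepn a : keep n k a -> a != var n.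
  by move=> ka; apply: contraTneq ka => ->; rewrite keep_adr//= leqnn.
have [| | | | | |  X2 [comp2 [X2F _ X2r] X2O]] := @computes_for (var n) NN
   (cseq (fcode n.+1 k.+1 f) (cline [:: Add (res k) (res k) (res k.+1)])) (ftime f + 1) N Keep X0.
- by rewrite /= !inE !adr_eq.
- by rewrite X0F ?keep_adr.
- by rewrite X0F ?keep_adr.
- split=> [a ka||]; rewrite ?update_eq//.
    by rewrite update_neq ?keepn ?X0F.
  by rewrite update_neq ?adr_eq// /X0 /= /effect /= update_eq.
- move=> j Y v [YF Yn Yr]; split=> [a ka||].
  + by rewrite update_neq ?keepLT ?YF.
  + by rewrite update_neq ?adr_eq.
  + by rewrite update_neq ?adr_eq.
- move=> j Y jN Yn YN YO [YF _ Yr].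
  have rY := repr_var (repr_frame rX YF) Yn.
  have [Y1 [compf Y1r Y1F]] := IH n.+1 k.+1 (update env n j) Y fn rY.
  have compa := computes_line (s := [:: Add (res k) (res k) (res k.+1)]) Y1 isT.
  eexists; split.
  + exact: (computes_seq compf compa).
  + by rewrite /= /effect /= update_neq ?adr_eq// Y1F ?keep_adr//= -ltnNge ltnSn.
  + by rewrite /= /effect /= update_neq ?adr_eq// Y1F ?keep_adr.
  + by rewrite /= /effect /= update_neq ?adr_eq// Y1F ?keep_adr.
  split=> [a ka||]; rewrite ?update_eq//.
  + rewrite update_neq ?keepn//= /effect /= update_neq; last first.
      by apply: contraTneq ka => ->; rewrite keep_res.
    by rewrite Y1F ?YF//; exact: keep_weak ka.
  + rewrite -(addn1 j) iotaD count_cat add0n.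
    rewrite update_neq ?adr_eq//= /effect /= update_eq Y1F ?keep_adr//= -?ltnNge ?ltnSn//.
    by rewrite Yr Y1r addn0.
have comp3 := computes_line (s := [:: Defs.Sub (res k) ONE (res k); Defs.Sub (res k) ONE (res k)]) X2 isT.
eexists; split.
- apply: computes_weak (computes_seq comp0 (computes_seq comp2 comp3)).
  by rewrite /=; lia.
- rewrite /= /effect /= update_eq update_neq ?adr_eq// X2O update_eq X2r has_count.
  case: count => //= m; lia.
- apply: (@frame_trans _ _ n k _ X2) => //.
  by move=> b; apply: line_keeps; rewrite /= keep_res// ?keep_scratch.
Qed.

(** * Loop programs acting on the two tables *)

Inductive cmd :=
  | Assign of bool & seq nat & fol
  | Loop of cmd
  | Then of cmd & cmd.

(** Entries are never erased: an assignment forms the disjunction with the old entry, so that loops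
    can climb to a least fixed point. *)
Definition extend (tab : tables) (a : bool) (i : nat) (b : bool) : tables :=
  fun a' i' => tab a' i' || [&& a' == a, i' == i & b].

Fixpoint csem (M : nat) (inc : nat -> nat -> bool) (n : nat) (env : nat -> nat)
    (tab : tables) (c : cmd) : tables :=
  match c with
  | Assign a xs f => extend tab a (idx M (map env xs)) (sat M inc tab n env f)
  | Loop c => foldl (fun tab i => csem M inc n.+1 (update env n i) tab c) tab (iota 0 M)
  | Then c1 c2 => csem M inc n env (csem M inc n env tab c1) c2
  end.

Fixpoint wfc (n : nat) (c : cmd) : bool :=
  match c with
  | Assign a xs f => all (fun x => x < n) xs && wf n f
  | Loop c => wfc n.+1 c
  | Then c1 c2 => wfc n c1 && wfc n c2
  end.

Fixpoint ccode (n : nat) (c : cmd) : code :=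
  match c with
  | Assign a xs f => cseq (fcode n 0 f) (cseq (chorner xs) (cseq (caddr (4 + a))
      (cline [:: Fetch TMP ACC; Add TMP TMP (res 0); Defs.Sub TMP ONE TMP;
        Defs.Sub TMP ONE TMP; Store ACC TMP])))
  | Loop c => cfor (var n) NN (ccode n.+1 c)
  | Then c1 c2 => cseq (ccode n c1) (ccode n c2)
  end.

Fixpoint ctime (c : cmd) : nat :=
  match c with
  | Assign a xs f => ftime f + (size xs * (N * 5 + 6) + 11)
  | Loop c => N * (ctime c + 4) + 4
  | Then c1 c2 => ctime c1 + ctime c2
  end.

Lemma repr_weak tab n (env : nat -> nat) (X : mem) j :
  repr tab n.+1 (update env n j) X -> repr tab n env X.
Proof.
move=> [h1 h2 h3 [h4 h5 h6]]; split=> //; split=> // i ilt.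
by rewrite h5 ?ltnS ?(ltnW ilt)// update_neq// ltn_eqF.
Qed.

Lemma frame_update n k (X : mem) i v : ~~ keep n k i -> frame n k X (update X i v).
Proof. by move=> ki a ka; rewrite update_neq//; apply: contraNneq ki => <-. Qed.

Lemma ccode_spec tab n (env : nat -> nat) c (X : mem) : wfc n c -> repr tab n env X ->
  exists2 X', computes (ccode n c) (ctime c) X X' &
    repr (csem N inc_of_raw n env tab c) n env X'.
Proof.
elim: c tab n env X => [a xs f|c IH|c1 IH1 c2 IH2] tab n env X /=.
- move=> /andP[xsn fn] rX.
  have [X2 [comp2 X2r X2F]] := fcode_spec 0 fn rX.
  have rX2 := repr_frame rX X2F; have [X21 X2N _ [_ X2var _]] := rX2.
  have [X3 [comp3 X3A X3F]] := chorner_spec xs X21 X2N.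
  have [X4 [comp4 X4A X4F]] := caddr_spec (4 + a) X3.
  have comp5 := computes_line (s := [:: Fetch TMP ACC; Add TMP TMP (res 0);
    Defs.Sub TMP ONE TMP; Defs.Sub TMP ONE TMP; Store ACC TMP]) X4 isT.
  eexists.
    apply: computes_weak (computes_seq comp2 (computes_seq comp3 (computes_seq comp4 comp5))).
    by rewrite /=; lia.
  have X4F2 b : ~~ scratch b -> X4 b = X2 b by move=> sb; rewrite X4F ?X3F.
  have X3A' : X3 ACC = idx N (map env xs).
    by rewrite X3A; congr idx; apply/eq_in_map => x /(allP xsn)/X2var.
  have a8 : 4 + a < 8 by case: (a).
  have [h1 h2 h3 [h4 h5 h6]] := rX2.
  rewrite /= /effect /=.
  rewrite (_ : update _ TMP _ ACC = adr (4 + a) (idx N (map env xs))); last first.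
    by rewrite !update_neq ?adr_eq//= X4A X3A'.
  split; [| | |split].
  + by rewrite !update_neq ?adr_eq//; first rewrite X4F2 ?scratch_adr//; case: (a).
  + by rewrite !update_neq ?adr_eq//; first rewrite X4F2 ?scratch_adr//; case: (a).
  + by rewrite !update_neq ?adr_eq//; first rewrite X4F2 ?scratch_adr//; case: (a).
  + by move=> i; rewrite !update_neq ?adr_eq//; first rewrite X4F2 ?scratch_adr//; case: (a).
  + by move=> i ilt; rewrite !update_neq ?adr_eq//; rewrite X4F2 ?scratch_adr ?h5.
  + move=> a' i.
    have a'8 : 4 + a' < 8 by case: (a').
    have TMPn j : adr (4 + a') j != TMP by rewrite adr_eq//; case: (a').
    rewrite /extend {1}/update adr_eq// eqn_add2l.
    have -> : (nat_of_bool a' == nat_of_bool a) = (a' == a) by case: (a); case: (a').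
    have Xold : X4 (adr (4 + a') i) = tab a' i.
      by rewrite X4F2 ?h6// scratch_adr//; case: (a').
    case: (a' =P a) => [aa|_] /=; last by rewrite !update_neq ?TMPn// Xold orbF.
    case: (i =P _) => [ii|_] /=; last by rewrite !update_neq ?TMPn// Xold orbF.
    rewrite /update !adr_eq//= X4A X3A'.
    rewrite -ii -aa Xold.
    rewrite !X4F2 ?scratch_adr// X21 X2r.
    by case: (tab _ _); case: (sat _ _ _ _ _ _).
- move=> cn rX; have [X1 XN _ _] := rX.
  pose Keep j (Y : mem) := repr (foldl (fun tab i => csem N inc_of_raw n.+1 (update env n i) tab c)
    tab (iota 0 j)) n env Y.
  have varK : ~~ keep n 0 (var n) by rewrite keep_adr//= leqnn.
  have LTK : ~~ keep n 0 LT by rewrite keep_scratch.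
  have [| | | | | | X2 [comp2 X2I _]] := @computes_for (var n) NN (ccode n.+1 c) (ctime c) N Keep X.
  + by rewrite /= !inE !adr_eq.
  + exact: XN.
  + exact: X1.
  + exact: (repr_frame rX (frame_update _ _ varK)).
  + by move=> j Y v IY; exact: (repr_frame IY (frame_update _ _ LTK)).
  + move=> j Y jN Yn YN YO IY.
    have [Y' comp' rY'] := IH _ _ _ _ cn (repr_var IY Yn).
    have [h1 h2 _ [_ h5 _]] := rY'.
    exists Y'; split=> //; first by rewrite h5// ?update_eq.
    apply: repr_frame (frame_update _ _ varK).
    by rewrite -(addn1 j) iotaD foldl_cat; exact: repr_weak rY'.
  by exists X2.
move=> /andP[c1n c2n] rX.
have [X2 comp2 rX2] := IH1 _ _ _ _ c1n rX.
have [X3 comp3 rX3] := IH2 _ _ _ _ c2n rX2.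
by exists X3 => //; exact: computes_seq comp2 comp3.
Qed.

End Compile.

(** [Read] returns one more than the bit, so a value still positive after subtracting 1 is a 1 of
    the header. Matrix bits go to the addresses [adr 3 i], starting at 3 with the stride 8 kept in
    [LT]. [NN] ends as the length of the input, the range of all quantifiers. *)
Definition reader : seq instr := [::
  (*  0 *) Const ONE 1;
  (*  1 *) Read ACC;
  (*  2 *) Defs.Sub TMP ACC ONE;
  (*  3 *) Jpos TMP 5;
  (*  4 *) Jpos ONE 7;
  (*  5 *) Add NV NV ONE;
  (*  6 *) Jpos ONE 1;
  (*  7 *) Const CTR 3;
  (*  8 *) Const LT 8;
  (*  9 *) Add NN NV ONE;
  (* 10 *) Read ACC;
  (* 11 *) Jpos ACC 13;
  (* 12 *) Jpos ONE 18;
  (* 13 *) Defs.Sub ACC ACC ONE;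
  (* 14 *) Store CTR ACC;
  (* 15 *) Add CTR CTR LT;
  (* 16 *) Add NN NN ONE;
  (* 17 *) Jpos ONE 10 ].

Lemma exec_cons P t p a X w s' : onth P p = Some a -> ~~ is_halt a ->
  exec P t (step a (Config p X w)) s' -> exec P t.+1 (Config p X w) s'.
Proof. by move=> pa ha h; rewrite -add1n; apply: exec_trans h; exact: exec_step. Qed.

Ltac exec_next := eapply exec_cons; [exact: erefl | exact: isT | rewrite /=].

Lemma reader_header rest bs m i (Y : mem) : Y ONE = 1 -> Y NV = i ->
    (forall a, a \notin [:: ONE; NV; ACC; TMP] -> Y a = 0) ->
  exists Y', [/\ Y' ONE = 1, Y' NV = i + m,
    forall a, a \notin [:: ONE; NV; ACC; TMP] -> Y' a = 0 &
    exec (reader ++ rest) (m * 5 + 4) (Config 1 Y (nseq m true ++ false :: bs)) (Config 7 Y' bs)].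
Proof.
elim: m i Y => [|m IH] i Y Y1 Yi Y0.
  exists (update (update Y ACC 1) TMP 0); split.
  - by rewrite !update_neq.
  - by rewrite !update_neq ?addn0.
  - move=> a aN; have := aN; rewrite !inE !negb_or => /and4P[_ _ aA aT].
    by rewrite !update_neq ?Y0.
  - rewrite mul0n add0n.
    exec_next; exec_next; rewrite ?update_eq update_neq// Y1 subnn.
    by exec_next; rewrite ?update_eq /=; exec_next; rewrite !update_neq// Y1.
pose Y2 := update (update (update Y ACC 2) TMP 1) NV i.+1.
have [| | |  Y' [Y'1 Y'i Y'0 ex]] := IH i.+1 Y2.
- by rewrite /Y2 !update_neq.
- by rewrite /Y2 ?update_eq.
- move=> a aN; have := aN; rewrite !inE !negb_or => /and4P[_ aN' aA aT].
  by rewrite /Y2 !update_neq ?Y0.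
exists Y'; split=> //; first by rewrite Y'i addSnnS.
rewrite [_ + 4](_ : _ = (m * 5 + 4).+4.+1); last by lia.
exec_next; exec_next; rewrite ?update_eq update_neq// Y1.
exec_next; rewrite ?update_eq /=.
exec_next; rewrite !update_neq// Yi Y1 addn1.
by exec_next; rewrite !update_neq// Y1 /=.
Qed.

Lemma reader_bits rest nv bs0 bs i (Y : mem) : bs = drop i bs0 -> i <= size bs0 ->
    Y LT = 8 -> Y CTR = adr 3 i -> Y NN = nv + i.+1 ->
    (forall n env, n = 0 -> repr (nv + i.+1) nv (fun j => (j < i) && nth false bs0 j)
      (fun _ _ => false) n env Y) ->
  exists2 Y', repr (nv + (size bs0).+1) nv (nth false bs0) (fun _ _ => false) 0 (fun=> 0) Y' &
    exec (reader ++ rest) (size bs * 7 + 3) (Config 10 Y bs) (Config 18 Y' [::]).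
Proof.
elim: bs i Y => [|b bs IH] i Y bsE ile YL YC YN rY.
  have iE : i = size bs0.
    by apply/eqP; rewrite eqn_leq ile -subn_eq0 -size_drop -bsE.
  exists (update Y ACC 0).
    apply: (repr_frame (n := 0) (k := 0)); last by apply: frame_update; rewrite keep_scratch.
    have [h1 h2 h3 [h4 h5 h6]] := rY 0 (fun=> 0) erefl.
    rewrite -iE; split=> //; split=> // j; rewrite h4 iE; case: ltnP => //= jle.
    by rewrite nth_default.
  have [Y1 _ _ _] := rY 0 (fun=> 0) erefl.
  rewrite /= mul0n add0n.
  by exec_next; exec_next; rewrite ?update_eq /=; exec_next; rewrite update_neq// Y1.
have [Y1 _ YV [Yraw _ Ytab]] := rY 0 (fun=> 0) erefl.
have ilt : i < size bs0 by rewrite ltnNge; apply/negP => /drop_oversize h; rewrite h in bsE.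
have [bE bsE'] : b = nth false bs0 i /\ bs = drop i.+1 bs0.
  by move: bsE; rewrite (drop_nth false)// => -[].
pose Y2 := update (update (update (update (update Y ACC b.+1) ACC b) (adr 3 i) b) CTR (adr 3 i.+1)) NN (nv + i.+2).
have [| | | |  Y' rY' ex] := IH i.+1 Y2 bsE' ilt.
- by rewrite /Y2 !update_neq ?adr_eq.
- by rewrite /Y2 update_neq// ?update_eq.
- by rewrite /Y2 ?update_eq.
- move=> n env ->; split.
  + by rewrite /Y2 !update_neq ?adr_eq.
  + by rewrite /Y2 ?update_eq.
  + by rewrite /Y2 !update_neq ?adr_eq.
  split=> [j|//|a j].
    rewrite /Y2 /update !adr_eq//= ltnS; case: (j =P i) => [->|/eqP ji].
      by rewrite leqnn bE.
    by rewrite Yraw [in RHS]leq_eqVlt (negPf ji).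
  by rewrite /Y2 !update_neq ?adr_eq//; case: (a).
exists Y' => //.
rewrite /= [_ + 3](_ : _ = (size bs * 7 + 3).+4.+3); last by lia.
exec_next; exec_next; rewrite ?update_eq /=.
exec_next; rewrite ?update_eq update_neq// Y1 subn1 /=.
exec_next; rewrite [update _ ACC b ACC]update_eq ![update _ ACC _ CTR]update_neq// YC.
exec_next; rewrite ![update _ _ _ CTR]update_neq ?adr_eq// YC ![update _ _ _ LT]update_neq ?adr_eq// YL.
have -> : adr 3 i + 8 = adr 3 i.+1 by rewrite /adr; lia.
exec_next; rewrite ![update _ _ _ NN]update_neq ?adr_eq// YN ![update _ _ _ ONE]update_neq ?adr_eq// Y1.
have -> : nv + i.+1 + 1 = nv + i.+2 by lia.
exec_next; rewrite ![update _ _ _ ONE]update_neq ?adr_eq// Y1 /=.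
exact: ex.
Qed.

(** 18 is the number of instructions of [reader]; the final jump skips [Halt false] when the formula
    holds. *)
Definition program (c : cmd) (f : fol) : seq instr :=
  let body := cseq (ccode 0 c) (fcode 0 0 f) 18 in
  reader ++ body ++ [:: Jpos (res 0) (18 + size body + 2); Halt false; Halt true].

(** * Polynomial running time *)

Definition poly_bounded (t : nat -> nat) := exists C D, forall N, 0 < N -> t N <= C * N ^ D.

Lemma poly_const m : poly_bounded (fun=> m).
Proof. by exists m, 0 => N _; rewrite expn0 muln1. Qed.

Lemma poly_id : poly_bounded id.
Proof. by exists 1, 1 => N _; rewrite expn1 mul1n. Qed.

Lemma poly_add t u : poly_bounded t -> poly_bounded u -> poly_bounded (fun N => t N + u N).
Proof.
move=> [C [D h]] [C' [D' h']]; exists (C + C'), (maxn D D') => N N0.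
rewrite mulnDl; apply: leq_add.
  by apply: leq_trans (h N N0) _; rewrite leq_mul2l leq_pexp2l ?leq_maxl ?orbT.
by apply: leq_trans (h' N N0) _; rewrite leq_mul2l leq_pexp2l ?leq_maxr ?orbT.
Qed.

Lemma poly_mul t u : poly_bounded t -> poly_bounded u -> poly_bounded (fun N => t N * u N).
Proof.
move=> [C [D h]] [C' [D' h']]; exists (C * C'), (D + D') => N N0.
by rewrite expnD mulnACA leq_mul ?h ?h'.
Qed.

Lemma poly_ftime f : poly_bounded (ftime^~ f).
Proof.
have lin C : poly_bounded (fun N => N * C).
  exact: poly_mul poly_id (poly_const _).
elim: f => [x y|x y|a xs|f IH|f IHf g IHg|f IH] /=.
- exact: poly_add (lin _) (poly_const _).
- exact: poly_const.
- apply: poly_add (poly_const _); apply: poly_mul (poly_const _) _.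
  exact: poly_add (lin _) (poly_const _).
- exact: poly_add IH (poly_const _).
- exact: poly_add IHf (poly_add IHg (poly_const _)).
- apply: poly_add (poly_const _); apply: poly_mul poly_id _.
  exact: poly_add IH (poly_const _).
Qed.

Lemma poly_ctime c : poly_bounded (ctime^~ c).
Proof.
have lin C : poly_bounded (fun N => N * C).
  exact: poly_mul poly_id (poly_const _).
elim: c => [a xs f|c IH|c1 IH1 c2 IH2] /=.
- apply: poly_add (poly_ftime f) (poly_add _ (poly_const _)).
  by apply: poly_mul (poly_const _) (poly_add (lin _) (poly_const _)).
- apply: poly_add (poly_const _); apply: poly_mul poly_id _.
  exact: poly_add IH (poly_const _).
- exact: poly_add.
Qed.

Definition decides (c : cmd) (f : fol) (nv : nat) (bs : seq bool) : bool :=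
  let M := nv + (size bs).+1 in
  let inc := inc_of_raw nv (nth false bs) in
  sat M inc (csem M inc 0 (fun=> 0) (fun _ _ => false) c) 0 (fun=> 0) f.

Lemma run_halt P n p b X w : onth P p = Some (Halt b) -> run P n.+1 (Config p X w) = Some b.
Proof. by move=> /= ->. Qed.

Lemma program_correct (c : cmd) (f : fol) : wfc 0 c -> wf 0 f ->
  exists C D, forall nv bs, let w := nseq nv true ++ false :: bs in
    answers_within (program c f) w (C * size w ^ D) (decides c f nv bs).
Proof.
move=> wc wff.
(* [N * 12 + 20] pays for the reader: five steps per header bit, seven per matrix bit, and
   constants. *)
have [C [D timeP]] : poly_bounded (fun N => N * 12 + 20 + (ctime N c + ftime N f)).
  apply: poly_add (poly_add (poly_ctime c) (poly_ftime f)).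
  exact: poly_add (poly_mul poly_id (poly_const _)) (poly_const _).
exists C, D => nv bs w.
set N := size w; have NE : N = nv + (size bs).+1 by rewrite /N size_cat size_nseq.
set body := cseq (ccode 0 c) (fcode 0 0 f).
set tl := [:: Jpos (res 0) (18 + size (body 18) + 2); Halt false; Halt true].
have PE : program c f = reader ++ (body 18 ++ tl) by [].
rewrite /answers_within PE.
pose X0 : mem := update (fun=> 0) ONE 1.
have [| | |  X1 [X1O X1V X10 ex1]] := @reader_header (body 18 ++ tl) bs nv 0 X0.
- by rewrite /X0 update_eq.
- by rewrite /X0 update_neq.
- by move=> a; rewrite !inE !negb_or => /and4P[? _ _ _]; rewrite /X0 update_neq.
pose X2 := update (update (update X1 CTR 3) LT 8) NN (nv + 1).
have X2_0 a : a \notin [:: ONE; NV; ACC; TMP; CTR; LT; NN] -> X2 a = 0.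
  rewrite !inE !negb_or => /and5P[? ? ? ? /and3P[? ? ?]].
  by rewrite /X2 !update_neq// X10// !inE !negb_or; apply/and4P.
have [| | | | | | X3 rX3 ex3] := @reader_bits (body 18 ++ tl) nv bs bs 0 X2.
- by rewrite drop0.
- by [].
- by rewrite /X2 update_neq// update_eq.
- by rewrite /X2 2?update_neq// update_eq.
- by rewrite /X2 update_eq.
- move=> n env ->; split.
  + by rewrite /X2 !update_neq.
  + by rewrite /X2 update_eq.
  + by rewrite /X2 !update_neq.
  split=> [j|//|a j]; rewrite X2_0// !inE !adr_eq//; by case: (a).
have nvN : nv <= N by rewrite NE leq_addr.
rewrite -NE in rX3.
have [X4 comp4 rX4] := ccode_spec nvN wc rX3.
have [X5 [comp5 X5r _]] := fcode_spec nvN 0 wff rX4.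
have comp := computes_seq comp4 comp5.
have [|t tle ex5] := comp (program c f) 18 [::]; first by exists reader, tl; rewrite PE.
set b := decides c f nv bs.
have X5b : X5 (res 0) = b by rewrite X5r /b /decides -NE.
pose p := 18 + size (body 18).
have onth_tl i : i < 3 -> onth (program c f) (p + i) = onth tl i.
  move=> i3; rewrite PE catA onth_cat size_cat.
  by rewrite ltnNge leq_addr /= (_ : p + i - _ = i)//; rewrite /p addKn.
have total : exec (program c f) (1 + ((nv * 5 + 4) + (3 + ((size bs * 7 + 3) + (t + 1)))))
    (Config 0 (fun=> 0) w) (Config (if b then p + 2 else p + 1) X5 [::]).
  have step0 : exec (program c f) 1 (Config 0 (fun=> 0) w) (Config 1 X0 w).
    by rewrite PE; exec_next.
  apply: exec_trans step0 _; rewrite -[X in exec X]PE in ex1.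
  apply: exec_trans ex1 _; rewrite PE.
  eapply exec_cons; [exact: erefl|exact: isT|].
  eapply exec_cons; [exact: erefl|exact: isT|].
  eapply exec_cons; [exact: erefl|exact: isT|].
  rewrite [Defs.step _ _]/=.
  rewrite ?update_eq ![update _ _ _ NV]update_neq// ![update _ _ _ ONE]update_neq// X1V X1O add0n.
  apply: exec_trans ex3 _.
  apply: exec_trans ex5 _.
  have := exec_step X5 [::] (onth_tl 0 isT) isT.
  by rewrite /= X5b /p !addn0 => h n; rewrite h; case: (b); rewrite /= ?addn1.
set t0 := (X in exec _ X _ _) in total.
have N0 : 0 < N by rewrite NE addnS.
(* Strictly less, because [Halt] itself takes a unit of time. *)
have t0lt : t0 < C * N ^ D.
  apply: leq_trans (timeP N N0); rewrite /t0; lia.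
rewrite -PE -(subnKC t0lt) addSnnS total.
by case: (b); apply: run_halt; rewrite onth_tl.
Qed.

End Machine.
(** * Fixed points and formulas *)

Section LeastFixpoint.
Local Open Scope nat_scope.
Variables (M : nat) (inc : nat -> nat -> bool).
Notation csemM := (csem M inc).

Lemma idx_rcons xs x : idx M (rcons xs x) = idx M xs * M + x.
Proof. by rewrite /idx foldl_rcons. Qed.

Lemma idx_inj xs ys : size xs = size ys -> all (fun x => x < M) xs ->
  all (fun x => x < M) ys -> idx M xs = idx M ys -> xs = ys.
Proof.
elim/last_ind: xs ys => [|xs x IH] ys; first by case: ys.
case/lastP: ys => [|ys y]; first by rewrite size_rcons.
rewrite !size_rcons !all_rcons !idx_rcons => -[sz] /andP[xM xsM] /andP[yM ysM] eqi.
have M0 : 0 < M by apply: leq_ltn_trans xM.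
have eqx : x = y by rewrite -(modn_small xM) -(modn_small yM) -(modnMDl (idx M xs)) eqi modnMDl.
rewrite eqx (IH ys)//; move/eqP: eqi; rewrite eqx eqn_add2r eqn_pmul2r//.
by move=> /eqP.
Qed.

Definition tab_le (tab tab' : tables) := forall a i, tab a i -> tab' a i.

Lemma csem_le n env tab c : tab_le tab (csemM n env tab c).
Proof.
elim: c n env tab => [a xs f|c IH|c1 IH1 c2 IH2] n env tab a' i /=.
- by rewrite /extend => ->.
- elim: (iota 0 M) tab => //= j s IHs tab h; apply: IHs; exact: IH.
- by move=> /IH1/IH2.
Qed.

(* The environment after entering loops for the variables n, ..., n + m - 1. *)
Definition extend_env (env : nat -> nat) (n m : nat) (g : nat -> nat) : nat -> nat :=
  fun v => if n <= v < n + m then g (v - n) else env v.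

Lemma extend_env0 env n g : extend_env env n 0 g = env.
Proof. by apply/funext => v; rewrite /extend_env; case: ifP => //; lia. Qed.

Lemma extend_envS env n m g :
  extend_env (update env n (g 0)) n.+1 m (fun i => g i.+1) = extend_env env n m.+1 g.
Proof.
apply/funext => v; rewrite /extend_env /update.
case: ifP => [?|?]; case: (v =P n) => [vn|vn]; case: ifP => ? //; try lia.
  by congr g; lia.
by congr g; lia.
Qed.

(** [G] is indexed by the number of passes through the body: constant in the index it is an
    invariant, otherwise it measures progress, as with the iterates of [op] in [lfp_spec]. *)
Lemma loops_inv (G : nat -> tables -> Prop) c n m env tab j :
    (forall i g tab, (forall v, v < m -> g v < M) -> G i tab ->
      G i.+1 (csemM (n + m) (extend_env env n m g) tab c)) ->
  G j tab -> G (j + M ^ m) (csemM n env tab (iter m Loop c)).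
Proof.
elim: m n env tab j => [|m IH] n env tab j step Gj.
  rewrite expn0 addn1; have := step j id tab _ Gj; rewrite addn0 extend_env0; exact.
rewrite iterS /= expnS.
suff h s : (forall i, i \in s -> i < M) -> forall tab j, G j tab ->
    G (j + size s * M ^ m) (foldl (fun tab i => csemM n.+1 (update env n i) tab (iter m Loop c)) tab s).
  by rewrite -{1}(size_iota 0 M); apply: h => // i; rewrite mem_iota.
elim: s => [_|i s IHs sM] /= {}tab {}j {}Gj; first by rewrite addn0.
rewrite mulSn addnA; apply: IHs; first by move=> i' i's; apply: sM; rewrite inE i's orbT.
apply: IH => // i' g tab' gM Gi'.
pose g' v := if v is v'.+1 then g v' else i.
have := step i' g' tab'; rewrite -extend_envS addnS; apply => //.
by case=> [_|v vm] /=; [apply: sM; rewrite mem_head|exact: gM].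
Qed.

(** Some pass runs the body at [g], on an intermediate table [tab']; all other passes only add
    entries. *)
Lemma loops_cover c n m env tab g : (forall v, v < m -> g v < M) ->
  exists tab', tab_le tab tab' /\
    tab_le (csemM (n + m) (extend_env env n m g) tab' c) (csemM n env tab (iter m Loop c)).
Proof.
elim: m n env tab g => [|m IH] n env tab g gM.
  by exists tab; rewrite extend_env0 addn0; split.
rewrite iterS /=; pose body (tab : tables) i := csemM n.+1 (update env n i) tab (iter m Loop c).
rewrite -[foldl _ _ _]/(foldl body tab (iota 0 M)).
have -> : iota 0 M = iota 0 (g 0) ++ g 0 :: iota (g 0).+1 (M - (g 0).+1).
  by rewrite -[in LHS](subnKC (gM 0 isT)) addSnnS iotaD.
have body_le s tab1 : tab_le tab1 (foldl body tab1 s).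
  elim: s tab1 => [|i s IHs] tab1 //= a i' h; apply: IHs; exact: csem_le.
rewrite foldl_cat /=; set tab1 := foldl body tab _.
have [|tab' [le1 le2]] := IH n.+1 (update env n (g 0)) tab1 (fun i => g i.+1).
  by move=> v vm; apply: gM.
exists tab'; split; first by move=> a i h; apply: le1; exact: body_le.
by move=> a i h; apply: body_le; apply: le2; rewrite extend_envS addSnnS.
Qed.

(** The outer loops count [M ^ r] rounds, as many as there are tuples, enough for an increasing
    iteration to stabilise. The inner loops run through the tuples, held in the variables from [r]
    to [r + r - 1]. *)
Definition lfp (a : bool) (r : nat) (f : fol) : cmd :=
  iter r Loop (iter r Loop (Assign a (iota r r) f)).

Lemma lfp_other a r f tab0 : csemM 0 (fun=> 0) tab0 (lfp a r f) (~~ a) = tab0 (~~ a).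
Proof.
pose G (_ : nat) (tab : tables) := tab (~~ a) = tab0 (~~ a).
apply: (@loops_inv G _ _ _ _ tab0 0) => // i g tab _ Gtab.
apply: (@loops_inv G _ _ _ _ tab i) => // i' g' tab' _ Gtab'.
by apply/funext => j; rewrite /= /extend Gtab'; case: (a); rewrite orbF.
Qed.

Section Spec.
Variables (a : bool) (r : nat) (f : fol) (P : tables -> seq nat -> bool) (tab0 : tables).

Definition valid (xs : seq nat) := (size xs == r) && all (fun x => x < M) xs.

Hypothesis satP : forall tab env, valid (map env (iota r r)) ->
  sat M inc tab (r + r) env f = P tab (map env (iota r r)).

Hypothesis P_mono : forall tab tab' xs, valid xs -> tab (~~ a) = tab0 (~~ a) ->
  tab' (~~ a) = tab0 (~~ a) ->
  (forall ys, valid ys -> tab a (idx M ys) -> tab' a (idx M ys)) ->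
  P tab xs -> P tab' xs.

Hypothesis tab0_empty : forall i, tab0 a i = false.

Let T := r.-tuple 'I_M.
Let entries (tab : tables) : {set T} := [set t : T | tab a (idx M (map val t))].
Let table_of (A : {set T}) : tables :=
  fun b i => if b == a then [exists t in A, idx M (map val (t : T)) == i] else tab0 b i.
Let op (A : {set T}) : {set T} := [set t : T | P (table_of A) (map val t)].

Lemma valid_tuple (t : T) : valid (map val t).
Proof.
by rewrite /valid size_map size_tuple eqxx /=; apply/allP => _ /mapP[i _ ->].
Qed.

Lemma tuple_valid xs : valid xs -> exists t : T, xs = map val t.
Proof.
move=> /andP[/eqP sx /allP xM].
case: M xM @T @entries @table_of @op => [|M'] xM *.
  case: xs sx xM => [sx _|x xs _ /(_ x (mem_head _ _))//].
  by exists (tcast sx [tuple]); rewrite val_tcast.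
have szt : size (map (@inord M') xs) == r by rewrite size_map sx.
exists (Tuple szt) => /=; rewrite -map_comp -[LHS]map_id; apply/eq_in_map => x xxs /=.
by rewrite inordK// xM.
Qed.

Lemma table_ofE A xs : valid xs -> table_of A a (idx M xs) = [exists t in A, map val (t : T) == xs].
Proof.
move=> vxs; rewrite /table_of eqxx; apply/exists_inP/exists_inP => -[t tA /eqP tx]; exists t => //.
  apply/eqP; apply: idx_inj tx => //; first by case/andP: vxs => /eqP->; rewrite size_map size_tuple.
    by case/andP: (valid_tuple t).
  by case/andP: vxs.
by rewrite tx.
Qed.

Lemma op_mono : {homo op : A B / A \subset B}.
Proof.
move=> A B AB; apply/subsetP => t; rewrite !inE; apply: P_mono.
- exact: valid_tuple.
- by apply/funext => i; rewrite /table_of; case: (a).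
- by apply/funext => i; rewrite /table_of; case: (a).
- move=> ys vys; rewrite !table_ofE// => /exists_inP[t' t'A e]; apply/exists_inP.
  by exists t' => //; exact: (subsetP AB).
Qed.

Let lfpset : {set T} := fixset op.

(** Entries written in a round are visible later in the same round, so a round is not one
    application of [op]: it contains [op] of the table at its start and stays inside every set
    closed under [P]. Together the two bounds give the least fixed point; the last clause is its
    induction principle. *)
Lemma lfp_spec : let tab := csemM 0 (fun=> 0) tab0 (lfp a r f) in
  [/\ tab (~~ a) = tab0 (~~ a),
      forall xs, valid xs -> P tab xs -> tab a (idx M xs) &
      forall S : seq nat -> Prop,
        (forall tab' xs, valid xs -> tab' (~~ a) = tab0 (~~ a) ->
          (forall ys, valid ys -> tab' a (idx M ys) -> S ys) -> P tab' xs -> S xs) ->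
        forall xs, valid xs -> tab a (idx M xs) -> S xs].
Proof.
have valid_env env g : (forall v, v < r -> g v < M) ->
    valid (map (extend_env env r r g) (iota r r)).
  move=> gM; rewrite /valid size_map size_iota eqxx /=; apply/allP => _ /mapP[i + ->].
  by rewrite mem_iota /extend_env => ri; rewrite ri gM//; lia.
have neg_a : (~~ a == a) = false by case: (a).
pose stable (S : seq nat -> Prop) := forall tab' xs, valid xs ->
  tab' (~~ a) = tab0 (~~ a) ->
  (forall ys, valid ys -> tab' a (idx M ys) -> S ys) -> P tab' xs -> S xs.
have inner (S : seq nat -> Prop) : stable S ->
    let Keep (_ : nat) (tab : tables) := tab (~~ a) = tab0 (~~ a) /\
      forall xs, valid xs -> tab a (idx M xs) -> S xs in
    forall j env tab, Keep j tab ->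
      Keep j (csemM r env tab (iter r Loop (Assign a (iota r r) f))).
  move=> hS Keep j env tab Invj; apply: (@loops_inv Keep _ _ _ _ _ j) => // i g tab1 gM [tabN tabS].
  split; first by apply/funext => i'; rewrite /= /extend neg_a orbF tabN.
  move=> xs vxs /=; rewrite /extend eqxx /= => /orP[/tabS|/andP[/eqP]]; first exact.
  rewrite satP ?valid_env// => eqi Ptab.
  have vy := valid_env env g gM.
  have -> : xs = map (extend_env env r r g) (iota r r).
    have /andP[/eqP sx xM] := vxs; have /andP[/eqP sy yM] := vy.
    by apply: idx_inj eqi => //; rewrite sx sy.
  exact: hS Ptab.
have sound (S : seq nat -> Prop) (hS : stable S) : let tab := csemM 0 (fun=> 0) tab0 (lfp a r f) in
    tab (~~ a) = tab0 (~~ a) /\ forall xs, valid xs -> tab a (idx M xs) -> S xs.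
  move=> tab; pose Keep (_ : nat) (tab : tables) := tab (~~ a) = tab0 (~~ a) /\
      forall xs, valid xs -> tab a (idx M xs) -> S xs.
  apply: (@loops_inv Keep _ _ _ _ _ 0) => [i g tab' _ Keep'|].
    rewrite add0n; exact: (inner S hS i _ _ Keep').
  by split=> // xs _; rewrite tab0_empty.
set tab := csemM _ _ _ _ in sound *.
have tabN : tab (~~ a) = tab0 (~~ a) by exact: lfp_other.
have op_fix : op lfpset = lfpset by apply: fixsetK; exact: op_mono.
have entriesP tab' (A : {set T}) : (forall t : T, tab' a (idx M (map val t)) -> t \in A) ->
    forall ys, valid ys -> tab' a (idx M ys) -> table_of A a (idx M ys).
  move=> hA ys vys h; rewrite table_ofE//; have [t tE] := tuple_valid vys.
  by apply/exists_inP; exists t; rewrite -?tE// hA// -tE.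
have tableN A : table_of A (~~ a) = tab0 (~~ a).
  by apply/funext => i; rewrite /table_of neg_a.
have below t : tab a (idx M (map val (t : T))) -> t \in lfpset.
  have [|_ h ht] := sound (fun xs => forall t : T, xs = map val t -> t \in lfpset).
    move=> tab' xs vxs tab'N tab'S Pxs t' xsE; rewrite -op_fix inE -xsE.
    apply: P_mono Pxs => //; apply: (entriesP tab' lfpset) => t'' ht''.
    exact: tab'S (valid_tuple _) ht'' _ erefl.
  exact: (h _ (valid_tuple t) ht).
have above t : t \in lfpset -> tab a (idx M (map val (t : T))).
  pose G j (tab : tables) := tab (~~ a) = tab0 (~~ a) /\ iter j op set0 \subset entries tab.
  (* [fixset] iterates as often as there are tuples, which is the number of rounds. *)
  suff [_ /subsetP h] : G (M ^ r) tab.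
    by rewrite /lfpset /fixset card_tuple card_ord => /h; rewrite inE.
  apply: (@loops_inv G _ _ _ _ _ 0); last by split; rewrite ?sub0set.
  move=> j g tab1 _ [tab1N tab1A]; rewrite add0n.
  set res := csemM _ _ _ _.
  have [resN _] : res (~~ a) = tab0 (~~ a) /\ forall xs, valid xs -> res a (idx M xs) -> True.
    exact: (inner (fun=> True) (fun _ _ _ _ _ _ => I) 0).
  split=> //; apply/subsetP => t'; rewrite iterS inE => Pt'.
  have vt' := valid_tuple t'.
  pose g' := nth 0 (map val t').
  have g'M v : v < r -> g' v < M.
    move=> vr; case/andP: vt' => /eqP sz /allP; apply; apply: mem_nth; by rewrite sz.
  have [tab' [le1 le2]] := @loops_cover (Assign a (iota r r) f) r r (extend_env (fun=> 0) 0 r g) tab1 g' g'M.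
  have tab'N : tab' (~~ a) = tab0 (~~ a).
    apply/funext => i; apply/idP/idP => h.
      by rewrite -resN; apply: le2; apply: csem_le.
    by apply: le1; rewrite tab1N.
  rewrite inE; apply: le2 => /=; rewrite /extend eqxx /=.
  have envE : map (extend_env (extend_env (fun=> 0) 0 r g) r r g') (iota r r) = map val t'.
    apply: (@eq_from_nth _ 0); first by rewrite !size_map size_iota size_tuple.
    move=> i; rewrite size_map size_iota => ir.
    by rewrite (nth_map 0) ?size_iota// nth_iota// /extend_env leq_addr ltn_add2l ir addKn.
  rewrite satP envE ?eqxx//=; apply/orP; right.
  apply: P_mono Pt' => // ys vys; rewrite table_ofE// => /exists_inP[t'' + /eqP<-].
  by move=> /(subsetP tab1A); rewrite inE => /le1.
split=> // [xs vxs Pxs|S hS]; last by have [] := sound S hS.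
have [t tE] := tuple_valid vxs; rewrite tE; apply: above.
rewrite -op_fix inE -tE; apply: P_mono Pxs => //.
by apply: (entriesP tab lfpset) => t'; exact: below.
Qed.

End Spec.
End LeastFixpoint.

(** * Derived connectives *)

Definition fOr f g := FNeg (FAnd (FNeg f) (FNeg g)).
Definition fImp f g := FNeg (FAnd f (FNeg g)).
Definition fAll f := FNeg (FEx (FNeg f)).
Definition fFalse n := FEx (FNeg (FEq n n)).
Definition fOrs n fs := foldr fOr (fFalse n) fs.
Definition fAnds n fs := FNeg (fOrs n (map FNeg fs)).

Arguments fOr : simpl never.
Arguments fImp : simpl never.
Arguments fAll : simpl never.
Arguments fOrs : simpl never.
Arguments fAnds : simpl never.

Section Connectives.
Local Open Scope nat_scope.

Section Semantics.
Variables (M : nat) (inc : nat -> nat -> bool) (tab : tables).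
Notation satM := (sat M inc tab).

Lemma sat_neg n env f : satM n env (FNeg f) = ~~ satM n env f.
Proof. by []. Qed.

Lemma sat_and n env f g : satM n env (FAnd f g) = satM n env f && satM n env g.
Proof. by []. Qed.

Lemma sat_or n env f g : satM n env (fOr f g) = satM n env f || satM n env g.
Proof. by rewrite /fOr /= negb_and !negbK. Qed.

Lemma sat_imp n env f g : satM n env (fImp f g) = (satM n env f ==> satM n env g).
Proof. by rewrite /fImp /= negb_and negbK implybE. Qed.

Lemma sat_all n env f :
  reflect (forall i, i < M -> satM n.+1 (update env n i) f) (satM n env (fAll f)).
Proof.
rewrite /fAll /= -all_predC; apply: (iffP allP) => [h i iM|h i].
  by have := h i; rewrite mem_iota iM /= negbK; apply.
by rewrite mem_iota /= negbK; exact: h.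
Qed.

Lemma sat_ex n env f :
  reflect (exists2 i, i < M & satM n.+1 (update env n i) f) (satM n env (FEx f)).
Proof.
apply: (iffP hasP) => [[i + h]|[i iM h]]; last by exists i; rewrite ?mem_iota.
by rewrite mem_iota => iM; exists i.
Qed.

Lemma sat_ors n env fs : satM n env (fOrs n fs) = has (satM n env) fs.
Proof.
elim: fs => [|f fs IH]; last by rewrite /fOrs [foldr _ _ _]/= sat_or -/(fOrs n fs) IH.
by apply/negP => /sat_ex[i _] /=; rewrite eqxx.
Qed.

Lemma sat_ands n env fs : satM n env (fAnds n fs) = all (satM n env) fs.
Proof.
rewrite /fAnds [LHS]/= sat_ors has_map -all_predC; apply: eq_all => f /=.
by rewrite negbK.
Qed.

Lemma sat_ors_map (I : Type) (F : I -> fol) (r : seq I) n env :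
  satM n env (fOrs n (map F r)) = has (fun i => satM n env (F i)) r.
Proof. by rewrite sat_ors has_map. Qed.

Lemma sat_ands_map (I : Type) (F : I -> fol) (r : seq I) n env :
  satM n env (fAnds n (map F r)) = all (fun i => satM n env (F i)) r.
Proof. by rewrite sat_ands all_map. Qed.

Lemma sat_exs m n env f : satM n env (iter m FEx f) <->
  exists g, (forall i, i < m -> g i < M) /\ satM (n + m) (extend_env env n m g) f.
Proof.
elim: m n env => [|m IH] n env.
  rewrite addn0 /=; split=> [h|[g [_]]]; last by rewrite extend_env0.
  by exists id; rewrite extend_env0.
rewrite iterS; split=> [/sat_ex[a aM /IH[g [gM]]]|[g [gM]]].
  exists (fun i => if i is j.+1 then g j else a); rewrite -extend_envS addnS; split=> //.
  by case=> // i; exact: gM.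
rewrite -extend_envS -addSnnS => h; apply/sat_ex; exists (g 0); first exact: gM.
by apply/IH; exists (fun i => g i.+1); split=> // i im; exact: gM.
Qed.

End Semantics.

Lemma wf_ors n fs : wf n (fOrs n fs) = all (wf n) fs.
Proof. by rewrite /fOrs; elim: fs => [|f fs IH] /=; rewrite ?ltnSn // /fOr /= IH. Qed.

Lemma wf_ands n fs : wf n (fAnds n fs) = all (wf n) fs.
Proof. by rewrite /fAnds [LHS]/= wf_ors all_map. Qed.

Lemma wf_ors_map (I : Type) (F : I -> fol) (r : seq I) n :
  wf n (fOrs n (map F r)) = all (fun i => wf n (F i)) r.
Proof. by rewrite wf_ors all_map. Qed.

Lemma wf_ands_map (I : Type) (F : I -> fol) (r : seq I) n :
  wf n (fAnds n (map F r)) = all (fun i => wf n (F i)) r.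
Proof. by rewrite wf_ands all_map. Qed.

Lemma wf_or n f g : wf n (fOr f g) = wf n f && wf n g. Proof. by []. Qed.

Lemma wf_imp n f g : wf n (fImp f g) = wf n f && wf n g. Proof. by []. Qed.

Lemma wf_all n f : wf n (fAll f) = wf n.+1 f. Proof. by []. Qed.

Lemma wf_and n f g : wf n (FAnd f g) = wf n f && wf n g. Proof. by []. Qed.

Lemma wf_ex n f : wf n (FEx f) = wf n.+1 f. Proof. by []. Qed.

Lemma wf_neg n f : wf n (FNeg f) = wf n f. Proof. by []. Qed.

Lemma wf_exs m n f : wf n (iter m FEx f) = wf (n + m) f.
Proof. by elim: m n => [|m IH] n; rewrite ?addn0 // iterS /= IH addSnnS. Qed.

Lemma wf_loops m n c : wfc n (iter m Loop c) = wfc (n + m) c.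
Proof. by elim: m n => [|m IH] n; rewrite ?addn0 // iterS /= IH addSnnS. Qed.

End Connectives.

(** * First-order description of the game *)

Section Formulas.
Local Open Scope nat_scope.
Variables (R : realType) (k : R) (V : finType) (H : hypergraph V).
Variables (vs : seq V) (es : seq {set V}) (M : nat) (inc : nat -> nat -> bool) (c m l s : nat).
Hypotheses (vs_uniq : uniq vs) (mem_vs : forall v, v \in vs) (vsM : size vs < M).
Hypotheses (mem_es : forall e, (e \in es) = (e \in edges H)) (esM : size es < M).
Hypothesis incE : forall i j, inc i j = if onth vs i is Some v then v \in nth finset.set0 es j else false.
Hypothesis c_gt0 : 0 < c.
Hypothesis support : forall X, covered k H X -> exists2 S : {set {set V}}, S \subset edges H &
  #|S| <= s /\ forall th : R, (0 < th)%R -> approx_cover k S X th.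

(* A bag is given by a tuple f of ids: m blocks of c edge ids, followed by l
   vertex ids; ids out of range stand for the empty edge and for no vertex. *)
Definition bag_size := m * c + l.
Notation b := bag_size.

Definition bag (f : nat -> nat) : {set V} := [set v | active H v &&
  (has (fun i => all (fun j => v \in nth finset.set0 es (f (i * c + j))) (iota 0 c)) (iota 0 m)
  || has (fun j => onth vs (f (m * c + j)) == Some v) (iota 0 l))].

Definition is_id (x : nat) (v : V) := onth vs x = Some v.

Lemma is_idP v : exists2 x, x < M & is_id x v.
Proof.
have /onthP[x vx] := mem_vs v; exists x => //; apply: leq_ltn_trans vsM.
by apply: ltnW; rewrite -onthTE vx.
Qed.

Lemma is_id_inj x y v : is_id x v -> is_id y v -> x = y.
Proof.
rewrite /is_id => vx vy; apply: (@onth_inj _ vs x y vs_uniq); last by rewrite vx vy.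
by rewrite gtn_min -!onthTE vx vy.
Qed.

Lemma inc_id x v j : is_id x v -> inc x j = (v \in nth finset.set0 es j).
Proof. by move=> vx; rewrite incE vx. Qed.

Lemma inc_isid x j : inc x j -> exists v, is_id x v.
Proof. by rewrite incE; case vx: (onth vs x) => [v|//] _; exists v. Qed.

Lemma nth_edge (v : V) j : v \in nth finset.set0 es j -> nth finset.set0 es j \in edges H /\ j < M.
Proof.
case: (ltnP j (size es)) => [js _|js]; last by rewrite nth_default// inE.
by rewrite -mem_es mem_nth// (ltn_trans js).
Qed.

Lemma edge_id e : e \in edges H -> exists2 j, j < M & nth finset.set0 es j = e.
Proof.
rewrite -mem_es => ee; exists (index e es); last exact: nth_index.
by apply: ltn_trans esM; rewrite index_mem.
Qed.

Lemma bag_ext f g : (forall i, i < b -> f i = g i) -> bag f = bag g.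
Proof.
move=> fg; apply/setP => v; rewrite !inE; congr (_ && (_ || _)).
  apply: eq_in_has => i; rewrite mem_iota => im; apply: eq_in_all => j.
  rewrite mem_iota => jc; rewrite fg// /b.
  have : i * c + j < m * c by apply: leq_trans (_ : i.+1 * c <= _); [rewrite mulSn addnC ltn_add2r|rewrite leq_mul2r; lia].
  lia.
by apply: eq_in_has => j; rewrite mem_iota => jl; rewrite fg// /b ltn_add2l.
Qed.

Definition act_f n x := FEx (FInc x n).
Definition adj_f n x y := FEx (FAnd (FInc x n) (FInc y n)).
Definition bag_f n x t := fOr
  (fOrs n [seq fAnds n [seq FInc x (t + (i * c + j)) | j <- iota 0 c] | i <- iota 0 m])
  (fOrs n [seq FEq x (t + (m * c + j)) | j <- iota 0 l]).

Section Sat.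
Variable tab : tables.
Notation satM := (sat M inc tab).

Lemma sat_act n env x : x < n ->
  satM n env (act_f n x) <-> exists2 v, is_id (env x) v & active H v.
Proof.
move=> xn; split=> [/sat_ex[j jM]|[v vx /exists_inP[e /edge_id[j jM je] ve]]].
  rewrite /= update_neq ?ltn_eqF// ?update_eq => xj; have [v vx] := inc_isid xj.
  exists v => //; move: xj; rewrite (inc_id _ vx) => vj.
  by have [? _] := nth_edge vj; apply/exists_inP; eexists; [|exact: vj].
apply/sat_ex; exists j => //=; rewrite update_eq update_neq ?ltn_eqF//.
by rewrite (inc_id _ vx) je.
Qed.

Lemma sat_adj n env x y : x < n -> y < n ->
  satM n env (adj_f n x y) <-> exists u v,
    [/\ is_id (env x) u, is_id (env y) v & adjacent H u v].
Proof.
move=> xn yn; split=> [/sat_ex[j jM]|[u [v [ux vy /adjacentP[e [/edge_id[j jM je] ue ve]]]]]].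
  rewrite /= update_eq !update_neq ?ltn_eqF// => /andP[xj yj].
  have [u ux] := inc_isid xj; have [v vy] := inc_isid yj.
  exists u, v; split=> //; move: xj yj; rewrite (inc_id _ ux) (inc_id _ vy) => uj vj.
  by apply/adjacentP; exists (nth finset.set0 es j); have [? _] := nth_edge uj.
apply/sat_ex; exists j => //=; rewrite update_eq !update_neq ?ltn_eqF//.
by rewrite (inc_id _ ux) (inc_id _ vy) je ue.
Qed.

Lemma sat_bag n env x t v : is_id (env x) v -> active H v ->
  satM n env (bag_f n x t) = (v \in bag (fun i => env (t + i))).
Proof.
move=> vx va; rewrite sat_or !sat_ors_map inE va andTb; congr (_ || _).
  apply: eq_has => i.
  by cbv beta; rewrite sat_ands_map; apply: eq_all => j; exact: inc_id.
apply: eq_has => j /=; apply/eqP/eqP => [<-//|vy].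
exact: is_id_inj vx vy.
Qed.

(** The feasible patterns [QQ] are selected classically when the formula is built, so nothing about
    the real number [k] has to be computed. *)
Definition cover_f n t := iter s FEx (fOrs (n + s)
  [seq fAll (fImp (act_f (n + s).+1 (n + s)) (fImp (bag_f (n + s).+1 (n + s) t)
     (fOrs (n + s).+1 [seq fAnds (n + s).+1 [seq FInc (n + s) (n + j) | j : 'I_s <- enum Q]
       | Q : {set 'I_s} <- enum QQ])))
  | QQ : {set {set 'I_s}} <- enum [set QQ | `[< forall th : R, (0 < th)%R -> cell_cover k QQ th >]]]).

Lemma sat_cover n env t : t + b <= n ->
  satM n env (cover_f n t) <-> covered k H (bag (fun i => env (t + i))).
Proof.
move=> tn; have bagE g i : bag (fun j => update (extend_env env n s g) (n + s) i (t + j)) =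
    bag (fun i => env (t + i)).
  apply: bag_ext => j jb; rewrite update_neq; last by rewrite ltn_eqF//; lia.
  by rewrite /extend_env; case: ifP => //; lia.
rewrite /cover_f sat_exs; split.
  move=> [g [gM]]; rewrite sat_ors_map => /hasP[QQ].
  rewrite mem_enum inE => /asboolP QQcov /sat_all h th th0.
  apply: (cells_approx_cover (sg := fun j : 'I_s => nth finset.set0 es (g j)) (QQ := QQ)).
  - move=> j; case: (ltnP (g j) (size es)) => js; last by right; rewrite nth_default.
    by left; rewrite -mem_es mem_nth.
  - move=> v vB; have [x xM vx] := is_idP v.
    have va : active H v by move: vB; rewrite inE => /andP[].
    have := h x xM; rewrite 2!sat_imp; set env' := update _ _ _.
    have xE : env' (n + s) = x by rewrite /env' update_eq.
    have vx' : is_id (env' (n + s)) v by rewrite xE.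
    have -> : satM (n + s).+1 env' (act_f (n + s).+1 (n + s)).
      by apply/sat_act => //; exists v.
    rewrite (sat_bag _ _ vx' va) bagE vB /= sat_ors_map => /hasP[Q].
    rewrite mem_enum => QQQ; rewrite sat_ands_map => /allP hQ.
    exists Q => // j jQ; have := hQ j; rewrite mem_enum /= => /(_ jQ).
    rewrite (inc_id _ vx') /env' update_neq; last by rewrite ltn_eqF// ltn_add2l.
    by rewrite /extend_env leq_addr ltn_add2l ltn_ord addKn.
  - exact: QQcov.
move=> /support[S SH [Ss Scov]].
have [sg [QQ [sgS sgX QQcov]]] := approx_cover_cells k (bag (fun i => env (t + i))) Ss.
(* The empty set is not in [es], so its index is [size es], an id out of range that names the empty
   edge again. *)
pose g i := if insub i is Some j then index (sg j) es else 0.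
have gE (j : 'I_s) : g j = index (sg j) es by rewrite /g valK.
exists g; split=> [i il|].
  rewrite (gE (Ordinal il)); apply: leq_ltn_trans esM; exact: index_size.
rewrite sat_ors_map; apply/hasP; exists QQ.
  by rewrite mem_enum inE; apply/asboolP => th th0; exact/QQcov/Scov.
apply/sat_all => x xM; rewrite 2!sat_imp; set env' := update _ _ _.
have xE : env' (n + s) = x by rewrite /env' update_eq.
apply/implyP => /sat_act[//|v vx va]; apply/implyP.
rewrite (sat_bag _ _ vx va) bagE => /sgX[Q QQQ vQ].
rewrite sat_ors_map; apply/hasP; exists Q; rewrite ?mem_enum//.
rewrite sat_ands_map; apply/allP => j; rewrite mem_enum => jQ /=.
rewrite (inc_id _ vx) /env' update_neq; last by rewrite ltn_eqF// ltn_add2l.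
rewrite /extend_env leq_addr ltn_add2l ltn_ord addKn gE nth_index ?vQ//.
case: (sgS j) => [/(subsetP SH)|sg0]; first by rewrite mem_es.
by have := vQ j jQ; rewrite sg0 inE.
Qed.

End Sat.
Notation tup f := (map f (iota 0 b)).

Lemma map_env env (f : nat -> nat) t : (forall i, i < b -> env (t + i) = f i) ->
  map env (iota t b) = tup f.
Proof.
move=> ef; rewrite -{1}(addn0 t) iotaDl -map_comp; apply/eq_in_map => i.
by rewrite mem_iota => ib /=; rewrite ef.
Qed.

Lemma tup_ext (f g : nat -> nat) : (forall i, i < b -> f i = g i) -> tup f = tup g.
Proof. by move=> fg; apply/eq_in_map => i; rewrite mem_iota => /fg. Qed.

Lemma nth_tup f xs i : nth 0 (tup f ++ xs) i = if i < b then f i else nth 0 xs (i - b).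
Proof.
rewrite nth_cat size_map size_iota; case: ifP => // ib.
by rewrite (nth_map 0) ?size_iota// nth_iota.
Qed.

Lemma valid_tup r f xs : (forall i, i < b -> f i < M) -> all (fun x => x < M) xs ->
  b + size xs = r -> valid M r (tup f ++ xs).
Proof.
move=> fM xsM br; rewrite /valid size_cat size_map size_iota br eqxx all_cat xsM andbT.
by apply/allP => _ /mapP[i + ->]; rewrite mem_iota; exact: fM.
Qed.

Lemma valid_nth r xs i : valid M r xs -> i < r -> nth 0 xs i < M.
Proof. by move=> /andP[/eqP sx /allP xM] ir; apply: xM; rewrite mem_nth ?sx. Qed.

(** The first [b.+2] variables are the round counters of [lfp]; the tuple of [f], [x] and [y] comes
    next, and [n] is the first free variable. *)
Definition reach_f := let n := b.+2 + b.+2 in let x := b.+2 + b in let y := b.+2 + b.+1 in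
  FAnd (act_f n y) (FAnd (FNeg (bag_f n y b.+2)) (fOr (FEq x y)
    (FEx (FAnd (FRel false (iota b.+2 b ++ [:: x; n])) (adj_f n.+1 n y))))).

Definition reach_step (tab : tables) f x y := exists v, [/\ is_id y v, active H v, v \notin bag f &
  x = y \/ exists2 z, z < M & tab false (idx M (tup f ++ [:: x; z])) /\
    exists2 u, is_id z u & adjacent H u v].

Lemma reach_step_ext tab f g x y : (forall i, i < b -> f i = g i) ->
  reach_step tab f x y -> reach_step tab g x y.
Proof. by move=> fg; rewrite /reach_step (bag_ext fg) (tup_ext fg). Qed.

Lemma sat_reach tab env : sat M inc tab (b.+2 + b.+2) env reach_f <->
  reach_step tab (fun i => env (b.+2 + i)) (env (b.+2 + b)) (env (b.+2 + b.+1)).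
Proof.
have ltx : b.+2 + b < b.+2 + b.+2 by rewrite ltn_add2l.
have lty : b.+2 + b.+1 < b.+2 + b.+2 by rewrite ltn_add2l.
rewrite /reach_f; cbv zeta; set n := b.+2 + b.+2 in ltx lty *.
have tupE z : map (update env n z) (iota b.+2 b ++ [:: b.+2 + b; n]) =
    tup (fun i => env (b.+2 + i)) ++ [:: env (b.+2 + b); z].
  rewrite map_cat (map_env (f := fun i => env (b.+2 + i))).
    by rewrite /= update_eq update_neq// ltn_eqF.
  by move=> i ib; rewrite update_neq// ltn_eqF//; rewrite /n; lia.
rewrite sat_and sat_and sat_neg [X in _ && (_ && X)]sat_or; split.
  case/andP => /(sat_act _ _ lty)[v vy va] /andP[].
  rewrite (sat_bag _ _ _ vy va) => vB h; exists v; split=> //.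
  case/orP: h => [/eqP|/sat_ex[z zM]]; first by left.
  rewrite sat_and => /andP[hz /sat_adj[| |u [w [uz wy uw]]]]; rewrite ?ltnS//; first exact: ltnW.
  right; exists z => //; split; first by rewrite -tupE.
  rewrite update_eq in uz; rewrite update_neq ?ltn_eqF// in wy.
  exists u => //; move: wy; rewrite /is_id vy => -[->]; exact: uw.
move=> [v [vy va vB h]]; rewrite (sat_bag _ _ _ vy va) vB andTb.
apply/andP; split; first by apply/sat_act => //; exists v.
case: h => [xy|[z zM [hz [u uz uv]]]]; first by apply/orP; left; apply/eqP.
apply/orP; right; apply/sat_ex; exists z => //; rewrite sat_and; apply/andP; split.
  by rewrite -tupE in hz.
apply/sat_adj; rewrite ?ltnS//; first exact: ltnW.
by exists u, v; rewrite update_eq update_neq ?ltn_eqF//; split.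
Qed.

Definition reach (f : nat -> nat) x y := exists u v,
  [/\ is_id x u, is_id y v, active H v, u \notin bag f & v \in component H (bag f) u].

Definition reach_table : tables :=
  csem M inc 0 (fun=> 0) (fun _ _ => false) (lfp false b.+2 reach_f).

Lemma reach_tableP f x y : (forall i, i < b -> f i < M) -> x < M -> y < M ->
  reach_table false (idx M (tup f ++ [:: x; y])) <-> reach f x y.
Proof.
move=> fM xM yM.
pose P (tab : tables) xs := `[< reach_step tab (nth 0 xs) (nth 0 xs b) (nth 0 xs b.+1) >].
have nthx (g : nat -> nat) z1 z2 : nth 0 (tup g ++ [:: z1; z2]) b = z1.
  by rewrite nth_tup ltnn subnn.
have nthy (g : nat -> nat) z1 z2 : nth 0 (tup g ++ [:: z1; z2]) b.+1 = z2.
  by rewrite nth_tup ltnNge leqnSn /= subSnn.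
have nthf (g : nat -> nat) z1 z2 i : i < b -> nth 0 (tup g ++ [:: z1; z2]) i = g i.
  by move=> ib; rewrite nth_tup ib.
have [||| _ closed least] := @lfp_spec M inc false b.+2 reach_f P (fun _ _ => false).
- move=> tab env _; rewrite /P; apply/idP/asboolP.
    move=> /sat_reach; rewrite !(nth_map 0) ?size_iota// !nth_iota//.
    apply: reach_step_ext => i ib.
    by rewrite (nth_map 0) ?size_iota ?nth_iota//; lia.
  move=> h; apply/sat_reach; move: h; rewrite !(nth_map 0) ?size_iota// !nth_iota//.
  apply: reach_step_ext => i ib.
  by rewrite (nth_map 0) ?size_iota ?nth_iota//; lia.
- move=> tab tab' xs vxs _ _ le /asboolP[v [vy va vB h]]; apply/asboolP; exists v; split=> //.
  case: h => [->|[z zM [hz hu]]]; first by left.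
  right; exists z => //; split=> //; apply: le hz; apply: valid_tup => //=.
    by move=> i ib; apply: valid_nth vxs _; lia.
    by rewrite zM (valid_nth vxs)//.
  by rewrite addn2.
- by [].
split.
  move=> h; pose S xs := reach (nth 0 xs) (nth 0 xs b) (nth 0 xs b.+1).
  have reach_ext g g' z1 z2 : (forall i, i < b -> g i = g' i) -> reach g z1 z2 -> reach g' z1 z2.
    by move=> gg'; rewrite /reach (bag_ext gg').
  have : S (tup f ++ [:: x; y]).
    apply: (least S _ _ _ h); last by apply: valid_tup; rewrite //= ?xM ?yM ?addn2.
    move=> tab' xs vxs _ sound /asboolP[v [vy va vB]].
    case=> [xy|[z zM [hz [u uz uv]]]].
      by exists v, v; rewrite component_refl xy.
    have vz : valid M b.+2 (tup (nth 0 xs) ++ [:: nth 0 xs b; z]).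
      apply: valid_tup; rewrite /= ?zM ?(valid_nth vxs)// ?addn2//.
      by move=> i ib; apply: valid_nth vxs _; lia.
    have [u0 [u1 [ux u1z u1a u0B u1C]]] := sound _ vz hz.
    rewrite nthx in ux; rewrite nthy in u1z.
    move: u0B u1C; rewrite (bag_ext (nthf _ _ _)) => u0B u1C.
    exists u0, v; split=> //.
    have uE : u1 = u by move: u1z; rewrite /is_id uz => -[].
    by apply: (component_step u1C (component_disjoint u0B u1C) vB); rewrite uE.
  by rewrite /S nthx nthy; apply: reach_ext => i ib; rewrite nthf.
move=> [u [v [ux vy va uB vC]]].
have ua : active H u.
  have vu : u \in component H (bag f) v by rewrite (component_eq vC) component_refl.
  exact: component_active vu.
elim/component_ind: v / vC y yM vy {va} => [|v1 v2 v1C IH v1B v2B v12] y yM vy.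
  apply: closed; first by apply: valid_tup; rewrite //= ?xM ?yM ?addn2.
  apply/asboolP; rewrite nthx nthy; exists u; rewrite (bag_ext (nthf _ _ _)); split=> //.
  left; exact: is_id_inj ux vy.
have [z zM v1z] := is_idP v1.
apply: closed; first by apply: valid_tup; rewrite //= ?xM ?yM ?addn2.
apply/asboolP; rewrite nthx nthy; exists v2; rewrite (bag_ext (nthf _ _ _)); split=> //.
  have v2C := component_step v1C v1B v2B v12; exact: component_active v2C.
right; exists z => //; rewrite (tup_ext (nthf _ _ _)); split; first exact: IH.
by exists v1.
Qed.

(** [FRel false] occurs negatively, but its table is complete by then and left unchanged;
    [FRel true] occurs only positively, which gives the monotonicity that [lfp_spec] asks for. *)
Definition win_f := let n := b.+1 + b.+1 in let p := n + b in let x := b.+1 + b in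
  iter b FEx (FAnd (cover_f p n) (FAnd
    (fAll (fAll (fImp (FRel false (iota b.+1 b ++ [:: x; p])) (fImp (adj_f p.+2 p p.+1)
      (fImp (bag_f p.+2 p.+1 b.+1) (bag_f p.+2 p.+1 n))))))
    (fAll (fImp (act_f p.+1 p) (fImp (FRel false (iota b.+1 b ++ [:: x; p]))
      (fImp (FNeg (bag_f p.+1 p n)) (FRel true (iota n b ++ [:: p])))))))).

Definition win_step (tab : tables) f x := exists g, [/\ forall i, i < b -> g i < M,
  covered k H (bag g),
  forall z u v, is_id z u -> tab false (idx M (tup f ++ [:: x; z])) -> adjacent H u v ->
    v \in bag f -> v \in bag g &
  forall z u, is_id z u -> active H u -> tab false (idx M (tup f ++ [:: x; z])) ->
    u \notin bag g -> tab true (idx M (tup g ++ [:: z]))].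

Lemma win_step_ext tab f g x : (forall i, i < b -> f i = g i) ->
  win_step tab f x -> win_step tab g x.
Proof. by move=> fg; rewrite /win_step (bag_ext fg) (tup_ext fg). Qed.

Lemma is_id_lt z v : is_id z v -> z < M.
Proof.
by move=> vz; apply: leq_ltn_trans vsM; apply: ltnW; rewrite -onthTE; move: vz; rewrite /is_id => ->.
Qed.

Lemma adjacent_active u v : adjacent H u v -> active H u /\ active H v.
Proof. by move=> /adjacentP[e [eH ue ve]]; split; apply/exists_inP; exists e. Qed.

Lemma sat_win tab env : sat M inc tab (b.+1 + b.+1) env win_f <->
  win_step tab (fun i => env (b.+1 + i)) (env (b.+1 + b)).
Proof.
rewrite /win_f; cbv zeta; set n := b.+1 + b.+1; set p := n + b.
have np : n <= p by rewrite leq_addr.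
pose env1 g := extend_env env n b g.
have env1_old g i : i < n -> env1 g i = env i.
  by move=> ni; rewrite /env1 /extend_env; case: ifP => //; lia.
have env1_new g i : i < b -> env1 g (n + i) = g i.
  by move=> ib; rewrite /env1 /extend_env leq_addr ltn_add2l ib addKn.
have upd1 g z i : i < p -> update (env1 g) p z i = env1 g i.
  by move=> ip; rewrite update_neq// ltn_eqF.
have upd2 g z y i : i < p -> update (update (env1 g) p z) p.+1 y i = env1 g i.
  by move=> ip; rewrite update_neq ?upd1// ltn_eqF// ltnW.
have upd2p g z y : update (update (env1 g) p z) p.+1 y p = z.
  by rewrite update_neq ?update_eq// ltn_eqF.
have old_lt i : i <= b -> b.+1 + i < n by rewrite /n; lia.
have old1 g i : i <= b -> env1 g (b.+1 + i) = env (b.+1 + i).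
  by move=> ib; rewrite env1_old// old_lt.
have bag_old2 g z y : bag (fun i => update (update (env1 g) p z) p.+1 y (b.+1 + i)) =
    bag (fun i => env (b.+1 + i)).
  apply: bag_ext => i ib; have := old_lt i (ltnW ib) => h.
  by rewrite upd2 ?env1_old// (leq_trans h).
have bag_new2 g z y : bag (fun i => update (update (env1 g) p z) p.+1 y (n + i)) = bag g.
  by apply: bag_ext => i ib; rewrite upd2 ?env1_new// ltn_add2l.
have bag_new1 g z : bag (fun i => update (env1 g) p z (n + i)) = bag g.
  by apply: bag_ext => i ib; rewrite upd1 ?env1_new// ltn_add2l.
have tup1 g z : map (update (env1 g) p z) (iota b.+1 b ++ [:: b.+1 + b; p]) =
    tup (fun i => env (b.+1 + i)) ++ [:: env (b.+1 + b); z].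
  rewrite map_cat (map_env (f := fun i => env (b.+1 + i))).
    by rewrite /= update_eq upd1 ?old1//; apply: leq_trans np; exact: old_lt (leqnn b).
  move=> i ib; rewrite upd1 ?old1 ?(ltnW ib)//.
  by apply: leq_trans np; exact: old_lt (ltnW ib).
have tup2 g z y : map (update (update (env1 g) p z) p.+1 y) (iota b.+1 b ++ [:: b.+1 + b; p]) =
    tup (fun i => env (b.+1 + i)) ++ [:: env (b.+1 + b); z].
  rewrite -(tup1 g z); apply/eq_in_map => i; rewrite mem_cat mem_iota !inE => h.
  rewrite update_neq// ltn_eqF// ltnS.
  by case/orP: h => [|/orP[/eqP->|/eqP->//]]; have := old_lt b (leqnn b); lia.
have tup3 g z : map (update (env1 g) p z) (iota n b ++ [:: p]) = tup g ++ [:: z].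
  rewrite map_cat (map_env (f := g)) /= ?update_eq// => i ib.
  by rewrite upd1 ?env1_new// ltn_add2l.
have bag_new g : bag (fun i => env1 g (n + i)) = bag g.
  by apply: bag_ext => i ib; rewrite env1_new.
have ltp1 : p < p.+1 by [].
have ltp2 : p < p.+2 by [].
have ltp3 : p.+1 < p.+2 by [].
rewrite sat_exs; split=> [[g [gM]]|[g [gM gcov gN gwin]]].
  rewrite sat_and sat_and => /and3P[/(sat_cover _ _ (leqnn _))].
  rewrite -/(env1 g) bag_new => gcov /sat_all hN /sat_all hwin.
  exists g; split=> //.
    move=> z u v uz hz uv vf; have [y yM vy] := is_idP v.
    have [ua va] := adjacent_active uv.
    have := hN z (is_id_lt uz) => /sat_all/(_ y yM).
    rewrite -/(env1 g) 3!sat_imp; set env2 := update (update _ _ _) _ _.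
    have zE : env2 p = z by exact: upd2p.
    have yE : env2 p.+1 = y by rewrite /env2 update_eq.
    have vy' : is_id (env2 p.+1) v by rewrite yE.
    rewrite [sat _ _ _ _ _ (FRel _ _)]/= tup2 hz.
    have -> : sat M inc tab p.+2 env2 (adj_f p.+2 p p.+1).
      by apply/sat_adj => //; exists u, v; rewrite zE yE; split.
    by rewrite !(sat_bag _ _ _ vy' va) bag_old2 bag_new2 vf.
  move=> z u uz ua hz ug; have := hwin z (is_id_lt uz).
  rewrite -/(env1 g) 3!sat_imp sat_neg; set env2 := update _ _ _.
  have zE : env2 p = z by rewrite /env2 update_eq.
  have uz' : is_id (env2 p) u by rewrite zE.
  have -> : sat M inc tab p.+1 env2 (act_f p.+1 p) by apply/sat_act => //; exists u.
  rewrite (sat_bag _ _ _ uz' ua) bag_new1 ug.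
  by rewrite ![sat _ _ _ _ _ (FRel _ _)]/= tup1 tup3 hz.
exists g; split=> //; rewrite sat_and sat_and; apply/and3P; split.
- by apply/(sat_cover _ _ (leqnn _)); rewrite -/(env1 g) bag_new.
- apply/sat_all => z zM; apply/sat_all => y yM.
  rewrite -/(env1 g) 3!sat_imp; set env2 := update (update _ _ _) _ _.
  have zE : env2 p = z by exact: upd2p.
  have yE : env2 p.+1 = y by rewrite /env2 update_eq.
  rewrite [sat _ _ _ _ _ (FRel _ _)]/= tup2; apply/implyP => hz.
  apply/implyP => /(sat_adj _ _ ltp2 ltp3)[u [v]]; rewrite zE => -[uz vy uv].
  have [ua va] := adjacent_active uv.
  rewrite !(sat_bag _ _ _ vy va) bag_old2 bag_new2; apply/implyP.
  exact: gN uz hz uv.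
- apply/sat_all => z zM; rewrite -/(env1 g) 3!sat_imp sat_neg; set env2 := update _ _ _.
  have zE : env2 p = z by rewrite /env2 update_eq.
  apply/implyP => /(sat_act _ _ ltp1)[u uz ua].
  rewrite (sat_bag _ _ _ uz ua) bag_new1 ![sat _ _ _ _ _ (FRel _ _)]/= tup1 tup3.
  rewrite zE in uz; apply/implyP => hz; apply/implyP; exact: gwin uz ua hz.
Qed.

Definition bag_family (B : {set V}) := covered k H B /\
  exists g, (forall i, i < b -> g i < M) /\ B = bag g.

Definition win_table : tables :=
  csem M inc 0 (fun=> 0) reach_table (lfp true b.+1 win_f).

(** The table and [cops_win] are least fixed points of the same rule, so each direction is the
    induction principle of one side applied to the other. *)
Lemma win_tableP f x u : (forall i, i < b -> f i < M) -> is_id x u -> active H u ->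
    u \notin bag f ->
  win_table true (idx M (tup f ++ [:: x])) <-> cops_win H bag_family (bag f) u.
Proof.
move=> fM ux ua uf; have xM := is_id_lt ux.
pose P (tab : tables) xs := `[< win_step tab (nth 0 xs) (nth 0 xs b) >].
have nthx (g : nat -> nat) z : nth 0 (tup g ++ [:: z]) b = z.
  by rewrite nth_tup ltnn subnn.
have nthf (g : nat -> nat) z i : i < b -> nth 0 (tup g ++ [:: z]) i = g i.
  by move=> ib; rewrite nth_tup ib.
have valid1 g z : (forall i, i < b -> g i < M) -> z < M -> valid M b.+1 (tup g ++ [:: z]).
  by move=> gM zM; apply: valid_tup; rewrite /= ?zM ?addn1.
have [| | | win_other closed least] := @lfp_spec M inc true b.+1 win_f P reach_table.
- move=> tab env _; rewrite /P; apply/idP/asboolP.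
    move=> /sat_win; rewrite !(nth_map 0) ?size_iota// !nth_iota//.
    apply: win_step_ext => i ib.
    by rewrite (nth_map 0) ?size_iota ?nth_iota//; lia.
  move=> h; apply/sat_win; move: h; rewrite !(nth_map 0) ?size_iota// !nth_iota//.
  apply: win_step_ext => i ib.
  by rewrite (nth_map 0) ?size_iota ?nth_iota//; lia.
- move=> tab tab' xs vxs tabN tab'N le /asboolP[g [gM gcov gN gwin]]; apply/asboolP.
  exists g; split=> // [z w v|z w] wz; first by rewrite tab'N -tabN; exact: gN.
  move=> wa; rewrite tab'N -tabN => hz ug.
  by apply: le; [exact: valid1 gM (is_id_lt wz)|exact: gwin hz ug].
- by move=> i; rewrite /reach_table (lfp_other M inc false).
split.
  move=> h; pose S xs := forall u, is_id (nth 0 xs b) u -> active H u ->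
    u \notin bag (nth 0 xs) -> cops_win H bag_family (bag (nth 0 xs)) u.
  have : S (tup f ++ [:: x]).
    apply: (least S _ _ _ h); last exact: valid1.
    move=> tab' xs vxs tab'N sound /asboolP[g [gM gcov gN gwin]] u1 ux1 ua1 uf1.
    have fM' i : i < b -> nth 0 xs i < M by move=> ib; apply: valid_nth vxs _; lia.
    have xM' : nth 0 xs b < M by apply: valid_nth vxs _.
    have in_reach z w : is_id z w -> active H w -> w \in component H (bag (nth 0 xs)) u1 ->
        tab' false (idx M (tup (nth 0 xs) ++ [:: nth 0 xs b; z])).
      move=> wz wa wC; rewrite tab'N; apply/reach_tableP => //; first exact: is_id_lt wz.
      by exists u1, w; split.
    apply: (CopsWin (B' := bag g)).
    - by split=> //; exists g.
    - apply/subsetP => v; rewrite inE => /andP[vf /exists_inP[w wC wv]].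
      have [wa va] := adjacent_active wv; have [z zM wz] := is_idP w.
      exact: (gN z w v wz (in_reach _ _ wz wa wC)).
    move=> w wC wg; have wa := component_active ua1 wC; have [z zM wz] := is_idP w.
    have := sound _ (valid1 _ _ gM zM) (gwin z w wz wa (in_reach _ _ wz wa wC) wg) w.
    by rewrite nthx (bag_ext (nthf _ _)); apply.
  move=> /(_ u); rewrite nthx (bag_ext (nthf _ _)); exact.
move=> win; move BE : (bag f) win => B win.
elim: win f x fM ux xM ua uf BE => {}B {}u B' [covB' [g [gM B'E]]] border_B' _ IH f x fM ux xM ua uf BE.
apply: closed; first exact: valid1.
apply/asboolP; apply: (@win_step_ext _ f) => [i ib|]; first by rewrite nthf.
have tableN : win_table false = reach_table false by exact: win_other.
have out_reach z w : is_id z w -> reach_table false (idx M (tup f ++ [:: x; z])) ->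
    w \in component H B u.
  move=> wz /reach_tableP-/(_ fM xM (is_id_lt wz))[u0 [v0 [u0x v0z _ _]]].
  move: u0x v0z; rewrite /is_id ux wz => -[<-] [<-]; by rewrite BE.
rewrite nthx; exists g; rewrite -B'E; split=> // [z w v wz|z w wz wa]; rewrite -/win_table tableN => hz.
  move=> wv vf; apply: (subsetP border_B'); rewrite inE -BE vf; apply/exists_inP.
  by exists w => //; rewrite BE; exact: out_reach hz.
move=> wg; apply: (IH w) => //; first exact: out_reach hz.
  exact: is_id_lt wz.
by rewrite -B'E.
Qed.


(** The empty starting bag has to be named by a tuple as well, hence the block of quantifiers; that
    this bag is covered is the test [0 <= k]. *)
Definition final_f := iter b FEx (FAnd (cover_f b 0) (FAnd
  (fAll (fImp (act_f b.+1 b) (FNeg (bag_f b.+1 b 0))))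
  (fAll (fImp (act_f b.+1 b) (FRel true (iota 0 b ++ [:: b])))))).

Definition fhw_cmd := Then (lfp false b.+2 reach_f) (lfp true b.+1 win_f).

Lemma fhw_cmd_correct :
  sat M inc (csem M inc 0 (fun=> 0) (fun _ _ => false) fhw_cmd) 0 (fun=> 0) final_f <->
  covered k H finset.set0 /\ forall v, active H v -> cops_win H bag_family finset.set0 v.
Proof.
rewrite [csem _ _ _ _ _ _]/= -/reach_table -/win_table /final_f sat_exs add0n.
pose env1 g := extend_env (fun=> 0) 0 b g.
have env1E g i : i < b -> env1 g i = g i.
  by move=> ib; rewrite /env1 /extend_env add0n ib subn0.
have bag1 g : bag (fun i => env1 g (0 + i)) = bag g by apply: bag_ext => i; exact: env1E.
have bag2 g x : bag (fun i => update (env1 g) b x (0 + i)) = bag g.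
  by apply: bag_ext => i ib; rewrite update_neq ?env1E// ltn_eqF.
have tup2 g x : map (update (env1 g) b x) (iota 0 b ++ [:: b]) = tup g ++ [:: x].
  rewrite map_cat (map_env (f := g)) /= ?update_eq// => i ib.
  by rewrite update_neq ?env1E// ltn_eqF.
have bP : b < b.+1 by [].
have leb : 0 + b <= b by [].
split=> [[g [gM]]|[cov0 win]].
  rewrite sat_and sat_and => /and3P[/(sat_cover _ _ leb)].
  rewrite -/(env1 g) bag1 => gcov /sat_all gempty /sat_all gwin.
  have g0 : bag g = finset.set0.
    apply/setP => v; rewrite [in RHS]inE; apply/negP => vg; have [x xM vx] := is_idP v.
    have va : active H v by move: vg; rewrite inE => /andP[].
    have := gempty x xM; rewrite -/(env1 g) sat_imp sat_neg; set env2 := update _ _ _.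
    have vx' : is_id (env2 b) v by rewrite /env2 update_eq.
    by rewrite (sat_bag _ _ _ vx' va) bag2 vg implybF => /negP; apply; apply/sat_act => //; exists v.
  rewrite -g0; split=> // v va; have [x xM vx] := is_idP v.
  have := gwin x xM; rewrite -/(env1 g) sat_imp; set env2 := update _ _ _.
  have vx' : is_id (env2 b) v by rewrite /env2 update_eq.
  have -> : sat M inc win_table b.+1 env2 (act_f b.+1 b) by apply/sat_act => //; exists v.
  rewrite [sat _ _ _ _ _ (FRel _ _)]/= tup2 => h.
  by apply/(win_tableP gM vx va) => //; rewrite g0 inE.
(* [M.-1] is a legal value but out of range both as a vertex and as an edge id. As [c] is positive,
   each block contains an empty edge, so the bag is empty. *)
pose g (_ : nat) := M.-1.
have gM i : i < b -> g i < M by move=> _; rewrite /g; lia.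
have g0 : bag g = finset.set0.
  apply/setP => v; rewrite !inE; apply/negP => /andP[_ /orP[]] /hasP[i _].
    move=> /allP/(_ 0); rewrite mem_iota => /(_ c_gt0).
    by rewrite nth_default ?inE// /g; lia.
  by rewrite onth_default// /g; lia.
exists g; split=> //; rewrite sat_and sat_and; apply/and3P; split.
- by apply/(sat_cover _ _ leb); rewrite -/(env1 g) bag1 g0.
- apply/sat_all => x xM; rewrite -/(env1 g) sat_imp sat_neg; apply/implyP.
  move=> /(sat_act _ _ bP)[v vx va].
  by rewrite (sat_bag _ _ _ vx va) bag2 g0 inE.
- apply/sat_all => x xM; rewrite -/(env1 g) sat_imp; apply/implyP.
  move=> /(sat_act _ _ bP)[v]; rewrite update_eq => vx va.
  rewrite [sat _ _ _ _ _ (FRel _ _)]/= tup2; apply/(win_tableP gM vx va); rewrite g0 ?inE//.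
  exact: win.
Qed.

Lemma covered_active B v : covered k H B -> v \in B -> active H v.
Proof.
move=> cov vB; have [g [_ _ /(_ v vB)]] := cov (1 / 2)%R ltac:(lra).
apply: contraTT => va; rewrite big_pred0 -?ltNge; first by lra.
move=> e; apply: contraNF va => /andP[eH ve]; by apply/exists_inP; exists e.
Qed.

Lemma bag_family_basic B : covered k H B -> basic_set H c m l B -> bag_family B.
Proof.
move=> cov [Fs [Y [Fsm Yl FsP BE]]]; split=> //.
have M0 : 0 < M by apply: leq_ltn_trans vsM.
(* A family shorter than [c] is padded by its first edge; missing families and vertices get the id
   [M.-1], which is out of range. *)
pose eid (F : seq {set V}) j := if F is e0 :: _ then index (nth e0 F j) es else M.-1.
pose vid j := if onth Y j is Some v then index v vs else M.-1.
pose g i := if i < m * c then eid (nth [::] Fs (i %/ c)) (i %% c) else vid (i - m * c).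
have indexM (T : eqType) (x : T) (r : seq T) : size r < M -> index x r < M.
  by apply: leq_ltn_trans; exact: index_size.
exists g; split.
  move=> i _; rewrite /g /eid /vid; case: ifP => _.
    by case: (nth _ _ _) => [|e0 F]; [lia|exact: indexM].
  by case: (onth _ _) => [v|]; [exact: indexM|lia].
have edgeE F v : F \in Fs -> all (fun j => v \in nth finset.set0 es (eid F j)) (iota 0 c) =
    all (fun e : {set V} => v \in e) F.
  move=> /FsP[F0 Fc FH]; case: F F0 Fc FH => // e0 F _ Fc FH.
  have eidE j : nth finset.set0 es (eid (e0 :: F) j) = nth e0 (e0 :: F) j.
    rewrite /eid nth_index// mem_es FH//.
    case: (ltnP j (size (e0 :: F))) => jF; first exact: mem_nth.
    by rewrite nth_default// mem_head.
  apply/allP/allP => [h e /(nthP e0)[j jF <-]|h j _].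
    by rewrite -eidE; apply: h; rewrite mem_iota; exact: leq_trans Fc.
  rewrite eidE; case: (ltnP j (size (e0 :: F))) => jF; first by apply: h; exact: mem_nth.
  by rewrite nth_default//; apply: h; exact: mem_head.
apply/setP => v; rewrite [in RHS]inE.
have -> : (v \in B) = active H v && (v \in B).
  by case vB: (v \in B); rewrite ?andbF// (covered_active cov vB).
congr (_ && _); rewrite BE inE; congr (_ || _).
  have gE i j : i < m -> j < c -> g (i * c + j) = eid (nth [::] Fs i) j.
    move=> im jc; rewrite /g divnMDl// divn_small// addn0 modnMDl modn_small//.
    suff -> : i * c + j < m * c by [].
    apply: (@leq_trans (i.+1 * c)); first by rewrite mulSn -addnS addnC leq_add2r.
    by rewrite leq_mul2r; lia.
  have -> : has (fun i => all (fun j => v \in nth finset.set0 es (g (i * c + j))) (iota 0 c)) (iota 0 m) =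
      has (fun i => all (fun j => v \in nth finset.set0 es (eid (nth [::] Fs i) j)) (iota 0 c)) (iota 0 m).
    apply: eq_in_has => i; rewrite mem_iota => im; apply: eq_in_all => j.
    by rewrite mem_iota => jc; rewrite gE.
  apply/hasP/hasP => [[F FFs vF]|[i]].
    exists (index F Fs); last by rewrite nth_index// edgeE.
    by rewrite mem_iota; apply: leq_trans Fsm; rewrite index_mem.
  rewrite mem_iota => im; case: (ltnP i (size Fs)) => iFs.
    have FFs := mem_nth [::] iFs; rewrite edgeE// => h; by exists (nth [::] Fs i).
  rewrite nth_default// => /allP/(_ 0); rewrite mem_iota => /(_ c_gt0).
  by rewrite /eid nth_default ?inE//; lia.
apply/idP/hasP => [/onthP[j jv]|[j]].
  have jl : j < l by apply: leq_trans Yl; rewrite -onthTE jv.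
  exists j; first by rewrite mem_iota.
  rewrite /g ltnNge leq_addr /= addKn /vid jv.
  by rewrite onthE (nth_map v) ?index_mem ?mem_vs// nth_index.
rewrite mem_iota => jl; rewrite /g ltnNge leq_addr /= addKn /vid.
case jv: (onth Y j) => [u|]; last by rewrite onth_default//; lia.
rewrite onthE (nth_map u) ?index_mem ?mem_vs// nth_index// => /eqP[<-].
by apply/onthP; exists j.
Qed.

End Formulas.

(** * Scoping of the variables *)

Section WellFormed.
Local Open Scope nat_scope.
Variables (R : realType) (k : R) (c m l s : nat).
Notation b := (bag_size c m l).
Notation bag_f := (bag_f c m l).
Notation cover_f := (cover_f k c m l s).
Notation fhw_cmd := (fhw_cmd k c m l s).
Notation final_f := (final_f k c m l s).
Notation reach_f := (reach_f c m l).
Notation win_f := (win_f k c m l s).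

Lemma wf_act_f n x : x < n -> wf n (act_f n x).
Proof. by move=> xn; rewrite /= !ltnS leqnn (ltnW xn). Qed.

Lemma wf_adj_f n x y : x < n -> y < n -> wf n (adj_f n x y).
Proof. by move=> xn yn; rewrite /= !ltnS leqnn (ltnW xn) (ltnW yn). Qed.

Lemma wf_bag_f n x t : x < n -> t + b <= n -> wf n (bag_f n x t).
Proof.
move=> xn tn; rewrite wf_or !wf_ors_map; apply/andP; split; apply/allP => i.
  rewrite mem_iota => im; rewrite wf_ands_map; apply/allP => j; rewrite mem_iota => jc.
  rewrite /= xn /=; apply: leq_trans tn; rewrite -addnS leq_add2l /bag_size.
  apply: (@leq_trans (i.+1 * c)); first by rewrite mulSn -addnS addnC leq_add2r.
  by apply: leq_trans (leq_addr _ _); rewrite leq_mul2r; lia.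
by rewrite mem_iota => il; rewrite /= xn /=; apply: leq_trans tn; rewrite -addnS leq_add2l /bag_size; lia.
Qed.

Lemma wf_cover_f n t : t + b <= n -> wf n (cover_f n t).
Proof.
move=> tn; rewrite wf_exs wf_ors_map; apply/allP => QQ _.
rewrite wf_all wf_imp wf_act_f// wf_imp wf_bag_f//=; last by lia.
rewrite wf_ors_map; apply/allP => Q _; rewrite wf_ands_map; apply/allP => j _ /=.
by rewrite ltnSn ltnS leq_add2l ltnW.
Qed.

Lemma wf_rel n a t xs : t + b <= n -> all (fun x => x < n) xs ->
  wf n (FRel a (iota t b ++ xs)).
Proof.
move=> tn xsn; rewrite /= all_cat xsn andbT; apply/allP => i; rewrite mem_iota; lia.
Qed.

Lemma wfc_lfp a r f : wf (r + r) f -> wfc 0 (lfp a r f).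
Proof.
rewrite /lfp !wf_loops add0n /= => ->; rewrite andbT.
by apply/allP => i; rewrite mem_iota; lia.
Qed.

Lemma wf_fhw_cmd : wfc 0 fhw_cmd.
Proof.
have wf_reach : wf (b.+2 + b.+2) reach_f.
  rewrite /reach_f; cbv zeta.
  rewrite wf_and; apply/andP; split; first by apply: wf_act_f; lia.
  rewrite wf_and; apply/andP; split; first by rewrite wf_neg; apply: wf_bag_f; lia.
  rewrite wf_or; apply/andP; split; first by apply/andP; split; lia.
  rewrite wf_ex wf_and; apply/andP; split; last by apply: wf_adj_f; lia.
  by apply: wf_rel; rewrite /= ?andbT; lia.
have wf_win : wf (b.+1 + b.+1) win_f.
  rewrite /win_f; cbv zeta; rewrite wf_exs.
  rewrite wf_and; apply/andP; split; first exact: wf_cover_f.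
  rewrite wf_and; apply/andP; split; rewrite !wf_all.
    rewrite wf_imp; apply/andP; split; first by apply: wf_rel; rewrite /= ?andbT; lia.
    rewrite wf_imp; apply/andP; split; first by apply: wf_adj_f; lia.
    by rewrite wf_imp; apply/andP; split; apply: wf_bag_f; lia.
  rewrite wf_imp; apply/andP; split; first by apply: wf_act_f; lia.
  rewrite wf_imp; apply/andP; split; first by apply: wf_rel; rewrite /= ?andbT; lia.
  rewrite wf_imp; apply/andP; split; first by rewrite wf_neg; apply: wf_bag_f; lia.
  by apply: wf_rel; rewrite /= ?andbT; lia.
have h1 := wfc_lfp false wf_reach; have h2 := wfc_lfp true wf_win.
exact: introT andP (conj h1 h2).
Qed.

Lemma wf_final_f : wf 0 final_f.
Proof.
rewrite /final_f wf_exs add0n.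
rewrite wf_and; apply/andP; split; first exact: wf_cover_f.
rewrite wf_and; apply/andP; split; rewrite wf_all wf_imp; apply/andP; split.
- by apply: wf_act_f; lia.
- by rewrite wf_neg; apply: wf_bag_f; lia.
- by apply: wf_act_f; lia.
- by apply: wf_rel; rewrite /= ?andbT; lia.
Qed.

End WellFormed.

(** * The decision procedure *)

Lemma nth_rows (V : finType) (vs : seq V) (es : seq {set V}) (v0 : V) (i j : nat) :
  (i < size vs)%N ->
  nth false (flatten [seq [seq v \in e | v <- vs] | e : {set V} <- es]) (j * size vs + i) =
  (nth v0 vs i \in nth finset.set0 es j).
Proof.
move=> ivs; elim: es j => [|e es IH] j; first by rewrite !nth_nil inE.
rewrite /= nth_cat size_map; case: j => [|j]; first by rewrite add0n ivs (nth_map v0).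
by rewrite mulSn -addnA ltnNge leq_addr /= addKn IH.
Qed.

Lemma size_rows (V : finType) (vs : seq V) (es : seq {set V}) :
  size (flatten [seq [seq v \in e | v <- vs] | e : {set V} <- es]) = (size es * size vs)%N.
Proof. by elim: es => //= e es IH; rewrite size_cat size_map IH mulSn. Qed.

Lemma fhw_decidable (R : realType) (c d : nat) (k : R) : (1 <= c)%N ->
  exists (P : seq instr) (C D : nat), forall (V : finType) (H : hypergraph V) (w : seq bool),
    cd_hypergraph c d H -> encodes H w ->
    answers_within P w (C * size w ^ D)%N (fhw R H <= k%:E)%E.
Proof.
move=> c0; have [m [l game]] := fhw_le_cops_win k d c0.
have [s support] := support_bound k d c0.
have [C [D correct]] := program_correct (wf_fhw_cmd k c m l s) (wf_final_f k c m l s).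
exists (program (fhw_cmd k c m l s) (final_f k c m l s)), C, D.
move=> V H w cdH [vs [es [pvs pes ->]]].
set bs := flatten _; have := correct (size vs) bs.
suff -> : decides (fhw_cmd k c m l s) (final_f k c m l s) (size vs) bs = (fhw R H <= k%:E)%E by [].
rewrite /decides; set M := (_ + _)%N.
have vsM : (size vs < M)%N by rewrite /M addnS ltnS leq_addr.
have vs_uniq : uniq vs by rewrite (perm_uniq pvs) enum_uniq.
have mem_vs v : v \in vs by rewrite (perm_mem pvs) mem_enum.
have mem_es e : (e \in es) = (e \in edges H) by rewrite (perm_mem pes) mem_enum.
have esM : (size es < M)%N.
  (* With at least one vertex the matrix has at least as many entries as there are edges; without
     vertices there are no edges, since edges are nonempty. *)
  rewrite /M addnS ltnS size_rows; case: (posnP (size vs)) => [vs0|vs0].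
    case: es pes mem_es @bs correct @M vsM => //= e es _ mem_es *; exfalso.
    have eH : e \in edges H by rewrite -mem_es mem_head.
    have [e0|[v _]] := set_0Vmem e; first by move: eH; rewrite e0 (negPf (edges_neq0 H)).
    by have := mem_vs v; rewrite (size0nil vs0).
  by rewrite (leq_trans (leq_pmulr _ vs0))// leq_addl.
have incE i j : inc_of_raw (size vs) (nth false bs) i j =
    if onth vs i is Some v then v \in nth finset.set0 es j else false.
  rewrite /inc_of_raw; case: ltnP => [ivs|ivs]; last by rewrite onth_default.
  case vi: (onth vs i) => [v|]; last by have := onthTE vs i; rewrite vi ivs.
  by rewrite /bs (nth_rows es v)//= (@onth_nth _ v _ _ _ vi).
have supp X : covered k H X -> exists2 S : {set {set V}}, S \subset edges H &
    (#|S| <= s)%N /\ forall th : R, 0 < th -> approx_cover k S X th.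
  exact: support.
have correct' := fhw_cmd_correct m l vs_uniq mem_vs vsM mem_es esM incE c0 supp.
have game' := game V H (bag_family k H vs es M c m l) cdH.
have toF B : covered k H B -> basic_set H c m l B -> bag_family k H vs es M c m l B.
  exact: bag_family_basic.
have {}game' := game' toF (fun B => @proj1 _ _).
by apply/idP/idP => [/correct'/game'|/game'/correct'].
Qed.

Theorem theorem5p3 (R : realType) :
  exists deg : nat -> nat -> R -> nat,
    forall (c d : nat) (k : R), (1 <= c)%N ->
      exists (P : seq instr) (C : nat),
        forall (V : finType) (H : hypergraph V) (w : seq bool),
          cd_hypergraph c d H -> encodes H w ->
          answers_within P w (C * size w ^ deg c d k)%N
            (fhw R H <= k%:E)%E.
Proof.
(* Choice turns the degree into a function of [c], [d] and [k], with the value 0 when [c] is 0. *)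
have /choice[deg degP] : forall x : nat * nat * R, exists D : nat, (1 <= x.1.1)%N ->
    exists (P : seq instr) (C : nat), forall (V : finType) (H : hypergraph V) (w : seq bool),
      cd_hypergraph x.1.1 x.1.2 H -> encodes H w ->
      answers_within P w (C * size w ^ D)%N (fhw R H <= x.2%:E)%E.
  move=> [[c d] k] /=; have [c0|] := boolP (1 <= c)%N; last by exists 0%N.
  by have [P [C [D h]]] := fhw_decidable d k c0; exists D => _; exists P, C.
exists (fun c d k => deg (c, d, k)) => c d k c0.
exact: degP (c, d, k) c0.
Qed.
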